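(* Let $\delta>0$. Suppose that the pairs $(\eta_t,a_t)\in\mathbb{R}\times\{0,1\}$ are independent over $t$; that $E(\eta_t\mid a_t=1)=0$ and $E(\eta_t^2\mid a_t=1)=1$; that the conditional distribution of $\eta_t$ given $a_t=1$ does not depend on $t$; that $P(a_t=1)=g(t/n)$, where $g$ is a measurable non-constant deterministic function with $0<g(u)<1$ for $u\in(0,1]$, satisfying a piecewise Lipschitz condition on $(0,1]$; and that $\sigma_t=v(t/n)$, where $v$ is a deterministic function on $(0,1]$ satisfying a piecewise Lipschitz condition on $(0,1]$ and $0<\inf_{r\in(0,1]}v(r)\le\sup_{r\in(0,1]}v(r)<\infty$. Suppose also that $E(|\eta_t|^{4\delta})<\infty$. Then, for any integer $m\ge1$, $\sqrt n\,\widehat{\Gamma}_{ns,\sigma}^{(\delta)}(m)$ converges in distribution to $\mathcal{N}(0,\zeta I_m)$ as $n\to\infty$, where $I_m$ is the $m\times m$ identity matrix and $\zeta=\tilde\zeta/\dot\zeta$ with $$\tilde\zeta=E\{|\eta_t|^{2\delta}|a_t=1\}^2\int_0^1v^{4\delta}(s)g^2(s)ds-2E\{|\eta_t|^{2\delta}|a_t=1\}E\{|\eta_t|^{\delta}|a_t=1\}^2\int_0^1v^{4\delta}(s)g^3(s)ds+E\{|\eta_t|^{\delta}|a_t=1\}^4\int_0^1v^{4\delta}(s)g^4(s)ds,$$ $$\dot\zeta=E\{|\eta_t|^{2\delta}|a_t=1\}^2\left(\int_0^1v^{2\delta}(s)g(s)ds\right)^2-2E\{|\eta_t|^{2\delt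a}|a_t=1\}E\{|\eta_t|^{\delta}|a_t=1\}^2\left(\int_0^1v^{2\delta}(s)g^2(s)ds\right)\left(\int_0^1v^{2\delta}(s)g(s)ds\right)+E\{|\eta_t|^{\delta}|a_t=1\}^4\left(\int_0^1v^{2\delta}(s)g^2(s)ds\right)^2.$$
   Context: The latent returns are $\widetilde r_t=\sigma_t\eta_t$ with $\sigma_t>0$, and the observed returns are $r_t=a_t\widetilde r_t$, $t=1,\dots,n$, with $a_t\in\{0,1\}$. Since $P(a_t=1)=g(t/n)$ and $\sigma_t=v(t/n)$ depend on $n$, the variables form a triangular array; the double subscript is suppressed. For $u\le0$, $g(u)$ is set equal to $g(0)=\lim_{u\downarrow0}g(u)$. Piecewise Lipschitz condition for a function $f$ on $(0,1]$: there exist a positive integer $p$ and mutually disjoint intervals $I_1,\dots,I_p$ with $I_1\cup\dots\cup I_p=(0,1]$ such that $f(u)=\sum_{l=1}^p f_l(u)\mathbf{1}_{\{u\in I_l\}}$, $u\in(0,1]$, where each $f_l$ is Lipschitz on $I_l$. The corrected power autocorrelations (with $E(|r_t|^\delta)$ treated as known) are $$\widehat{\Gamma}_{ns,\sigma}^{(\delta)}(m)=\left(\hat\rho_{ns,\sigma}^{(\delta)}(1),\dots,\hat\rho_{ns,\sigma}^{(\delta)}(m)\right)',\qquad \hat\rho_{ns,\sigma}^{(\delta)}(h)=\hat\gamma_{ns,\sigma}^{(\delta)}(h)\,\hat\gamma_{ns,\sigma}^{(\delta)}(0)^{-1},$$ $$\hat\gamma_{ns,\sigma}^{(\delta)}(h)=n^{-1}\sum_{t=1+h}^{n}\left\{|r_t|^\delta-E(|r_t|^\delta)\right\}\left\{|r_{t-h}|^\delta-E(|r_{t-h}|^\delta)\right\}.$$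 *)

(* Defs.v *)
From mathcomp Require Import all_boot all_order all_algebra.
From mathcomp Require Import finmap.
From mathcomp Require Import all_classical all_reals all_analysis.

Set Implicit Arguments.
Unset Strict Implicit.
Unset Printing Implicit Defensive.

Import Order.TTheory GRing.Theory Num.Theory.
Import numFieldTopology.Exports numFieldNormedType.Exports.

Local Open Scope classical_set_scope.
Local Open Scope ring_scope.

Section PiecewiseLipschitz.
Context {R : realType}.

Definition piecewise_lipschitz (f : R -> R) : Prop :=
  exists p : nat, (0 < p)%N /\
  exists (I : 'I_p -> interval R) (fl : 'I_p -> R -> R),
    [/\ trivIset setT (fun l => [set` I l]),
        \bigcup_l [set` I l] = [set` `]0, 1]],
        (forall u, u \in `]0, 1] ->
          f u = \sum_(l < p) fl l u * \1_[set` I l] u) &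
        (forall l, [lipschitz (fl l x) | x in [set` I l]])].

End PiecewiseLipschitz.

Section Probability.
Context {R : realType} {d : measure_display} {T : measurableType d}.
Variable P : probability T R.

(* Mutual independence of the family (X i) for i in D. *)
Definition independent_family (I : choiceType) (D : set I)
    (d' : measure_display) (T' : measurableType d') (X : I -> T -> T') : Prop :=
  forall (J : {fset I}) (B : I -> set T'),
    [set` J] `<=` D ->
    (forall i, i \in J -> measurable (B i)) ->
    P (\bigcap_(i in [set` J]) (X i @^-1` B i)) =
    \big[*%E/1%E]_(i <- J) P (X i @^-1` B i).

(* The next two are only meaningful for events A of positive probability. *)
Definition cond_distribution (A : set T) (X : T -> R) (B : set R) : R :=
  fine (P (X @^-1` B `&` A)) / fine (P A).

Definition cond_expectation (A : set T) (X : T -> R) : \bar R :=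
  ((fine (P A))^-1%:E * \int[P]_(w in A) (X w)%:E)%E.

End Probability.

Section ConvergenceInDistribution.
Context {R : realType}.

(* The X n may live on different probability spaces; the limit law is given by
   its joint cdf F. *)
Definition cvg_in_distribution (d : nat -> measure_display)
    (T : forall n, measurableType (d n)) (P : forall n, probability (T n) R)
    (m : nat) (X : forall n, T n -> 'rV[R]_m) (F : 'rV[R]_m -> R) : Prop :=
  forall x : 'rV[R]_m, {for x, continuous F} ->
    (fun n => fine (P n [set w | forall j, X n w 0 j <= x 0 j])) @ \oo --> F x.

(* Integral over R^m with respect to Lebesgue measure, for nonnegative
   measurable f, as an iterated integral (Tonelli). *)
Fixpoint integral_rV (m : nat) : ('rV[R]_m -> \bar R) -> \bar R :=
  match m with
  | 0 => fun f => f 0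
  | m'.+1 => fun f => (\int[lebesgue_measure]_(t in [set: R])
      integral_rV (fun y : 'rV_m' => f (row_mx (t%:M : 'rV_1) y)))%E
  end.

(* Density and joint cdf of N(mu, Sigma), for positive definite Sigma. *)
Definition multinormal_pdf (m : nat) (mu : 'rV[R]_m) (Sigma : 'M[R]_m)
    (x : 'rV[R]_m) : R :=
  expR (- ((x - mu) *m invmx Sigma *m (x - mu)^T) 0 0 / 2)
  / Num.sqrt ((2 * pi) ^+ m * \det Sigma).

Definition multinormal_cdf (m : nat) (mu : 'rV[R]_m) (Sigma : 'M[R]_m)
    (x : 'rV[R]_m) : R :=
  fine (integral_rV (fun y =>
    (if [forall j, y 0 j <= x 0 j] then multinormal_pdf mu Sigma y else 0)%:E)).

End ConvergenceInDistribution.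

Section Returns.
Context {R : realType} {d : measure_display} {T : measurableType d}.
Variables (P : probability T R) (delta : R) (v : R -> R).
(* Row n of the array: eta t and a t, used for 1 <= t <= n only. *)
Variables (n : nat) (eta : nat -> T -> R) (a : nat -> T -> bool).

Definition volatility (t : nat) : R := v (t%:R / n%:R).

Definition latent_return (t : nat) (w : T) : R := volatility t * eta t w.

Definition observed_return (t : nat) (w : T) : R :=
  (a t w)%:R * latent_return t w.

Definition abs_power_return (t : nat) (w : T) : R :=
  `|observed_return t w| `^ delta.

Definition centered_power_return (t : nat) (w : T) : R :=
  abs_power_return t w - fine ('E_P[abs_power_return t]).

Definition power_autocov (h : nat) (w : T) : R :=
  n%:R^-1 * \sum_(1 + h <= t < n.+1)
    centered_power_return t w * centered_power_return (t - h)%N w.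

Definition power_autocorr (h : nat) (w : T) : R :=
  power_autocov h w * (power_autocov 0 w)^-1.

Definition power_autocorr_vec (m : nat) (w : T) : 'rV[R]_m :=
  \row_(i < m) power_autocorr i.+1 w.

End Returns.

Section LimitVariance.
Context {R : realType}.
(* m1 and m2 are the conditional absolute moments of order delta and 2 delta. *)
Variables (delta m1 m2 : R) (v g : R -> R).

Local Notation int01 q k :=
  (\int[lebesgue_measure]_(s in `]0, 1]) (v s `^ (q * delta) * g s ^+ k)).

Definition zeta_num : R :=
  m2 ^+ 2 * int01 4 2 - 2 * m2 * m1 ^+ 2 * int01 4 3 + m1 ^+ 4 * int01 4 4.

Definition zeta_den : R :=
  m2 ^+ 2 * int01 2 1 ^+ 2 - 2 * m2 * m1 ^+ 2 * int01 2 2 * int01 2 1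
  + m1 ^+ 4 * int01 2 2 ^+ 2.

Definition zeta : R := zeta_num / zeta_den.

End LimitVariance.

(* Main.v *)
(* With Y t the centered powers (Y 0 = 0) and D the mean of the Y t ^ 2, the h-th
   coordinate of the normalized statistic is n^(-1/2) sum_t Y t * Y (t - h)
   divided by D.

   Joint law of the numerators: the products Y t * Y (t - h) are martingale
   differences, and Lindeberg replacement applies. Orthant indicators are
   smoothed into products of normal distribution functions, which solve the heat
   equation, so that adding the k-th term to the sums and removing its variance
   from the Gaussian smoothing cancels up to third order. The only correction is
   that Y (k - i) * Y (k - j) is not constant given the past; evaluating the test
   function at the sums up to time k - m instead, at a cost of lower order, makes
   it independent of these factors, which then average out.

   The denominators concentrate by Chebyshev's inequality, and the event is
   sandwiched between orthants perturbed by k up to the event |D - G| > k, with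
   k -> 0 at the end. The limits of the normalized variances are Riemann sums,
   obtained by dominated convergence from the almost everywhere continuity of
   piecewise Lipschitz functions. *)
Require Import Defs.
From mathcomp Require Import all_boot all_order all_algebra.
From mathcomp Require Import finmap.
From mathcomp Require Import all_classical all_reals all_analysis measurable_realfun.
From mathcomp Require Import ring lra.

Set Implicit Arguments.
Unset Strict Implicit.
Unset Printing Implicit Defensive.

Import Order.TTheory GRing.Theory Num.Theory.
Import numFieldTopology.Exports numFieldNormedType.Exports.

Local Open Scope classical_set_scope.
Local Open Scope ring_scope.

(** * Independence *)

(** No conditional expectation is ever formed: the martingale property enters only through
    expectations of products, one factor measurable with respect to the variables before a given
    time and the other with respect to those from that time on.

    The increments are unbounded, so the expansion of the test function carries a random scale [rho]
    that need not be small. Its cube is integrable because [Y t] and [Y (t - h)] are independent: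
    the third absolute moment of their product is a product of two third moments. Hence fourth
    moments of [Y], that is moments of order 4 delta of eta, suffice. Each of the n + 1 replacements
    costs a multiple of n^(-3/2), the whole n^(-1/2).

    Let f(u) be the variance of the centred power at rescaled time u. The normalized numerators have
    limiting variance the integral of f^2 at every lag, the denominator tends to the integral of f,
    and zeta is the first divided by the square of the second, expanded in powers of g. The limit is
    nondegenerate because f > 0, which follows from 0 < g < 1, [m1 ^+ 2 <= m2] and [0 < m2]. *)

Definition L1 {d} {T : measurableType d} {R : realType}
  (mu : {measure set T -> \bar R}) (X : T -> R) : Prop :=
  mu.-integrable setT (EFin \o X).

(** * Integrability and expectation of real random variables *)

Section RealExpectation.
Context {d : measure_display} {T : measurableType d} {R : realType}.
Variable P : probability T R.
Implicit Types X Y : T -> R.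

Lemma L1_measurable X : L1 P X -> measurable_fun setT X.
Proof. by move=> /measurable_int /measurable_EFinP. Qed.

Lemma L1_le X Y : measurable_fun setT X -> (forall w, `|X w| <= Y w) ->
  L1 P Y -> L1 P X.
Proof.
move=> mX XY; apply: le_integrable => //; first exact/measurable_EFinP.
move=> w _ /=; rewrite lee_fin; apply: le_trans (XY w) _; exact: ler_norm.
Qed.

Lemma L1_cst c : L1 P (fun=> c).
Proof. exact: finite_measure_integrable_cst. Qed.

Lemma L1_abs X : L1 P X -> L1 P (fun w => `|X w|).
Proof. exact: integrable_norm. Qed.

Lemma L1D X Y : L1 P X -> L1 P Y -> L1 P (fun w => X w + Y w).
Proof. by move=> LX LY; exact: (integrableD measurableT LX LY). Qed.

Lemma L1B X Y : L1 P X -> L1 P Y -> L1 P (fun w => X w - Y w).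
Proof. by move=> LX LY; exact: (integrableB measurableT LX LY). Qed.

Lemma L1Z c X : L1 P X -> L1 P (fun w => c * X w).
Proof. by move=> LX; exact: (integrableZl measurableT c LX). Qed.

Lemma L1_sum (I : Type) (s : seq I) (Q : pred I) (X : I -> T -> R) :
  (forall i, Q i -> L1 P (X i)) -> L1 P (fun w => \sum_(i <- s | Q i) X i w).
Proof.
move=> LX; have := @integrable_sum _ _ _ P setT measurableT I s Q
  (fun i => EFin \o X i) LX.
by apply: eq_integrable => // w _; rewrite /= sumEFin.
Qed.

Lemma L1_bounded c X : measurable_fun setT X -> (forall w, `|X w| <= c) -> L1 P X.
Proof. by move=> mX Xc; apply: L1_le mX Xc (L1_cst c). Qed.

Lemma L1_bounded_mul c X Y : measurable_fun setT X -> (forall w, `|X w| <= c) ->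
  L1 P Y -> L1 P (fun w => X w * Y w).
Proof.
move=> mX Xc LY; apply: (@L1_le _ (fun w => c * `|Y w|)).
- by apply: measurable_funM => //; exact: L1_measurable.
- by move=> w; rewrite normrM ler_wpM2r.
- exact/L1Z/L1_abs.
Qed.

Lemma expect_cst c : \int[P]_w c = c.
Proof. 
rewrite Rintegral_cst // -[RHS]mulr1; congr (_ * _).
by rewrite (_ : 1 = fine 1%:E) //; congr fine; exact: probability_setT. Qed.

Lemma expectD X Y : L1 P X -> L1 P Y ->
  \int[P]_w (X w + Y w) = \int[P]_w X w + \int[P]_w Y w.
Proof. exact: RintegralD. Qed.

Lemma expectB X Y : L1 P X -> L1 P Y ->
  \int[P]_w (X w - Y w) = \int[P]_w X w - \int[P]_w Y w.
Proof. exact: RintegralB. Qed.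

Lemma expectZ c X : L1 P X -> \int[P]_w (c * X w) = c * \int[P]_w X w.
Proof. exact: RintegralZl. Qed.

Lemma expect_sum (I : Type) (s : seq I) (Q : pred I) (X : I -> T -> R) :
  (forall i, Q i -> L1 P (X i)) ->
  \int[P]_w (\sum_(i <- s | Q i) X i w) = \sum_(i <- s | Q i) \int[P]_w X i w.
Proof.
move=> LX; elim: s => [|i s IHs].
  rewrite big_nil -[RHS](expect_cst 0).
  by apply: eq_Rintegral => w _; rewrite big_nil.
rewrite big_cons; case: ifPn => Qi; last first.
  by rewrite -IHs; apply: eq_Rintegral => w _; rewrite big_cons (negbTE Qi).
rewrite -IHs -expectD; first 1 last.
- exact: LX.
- exact: L1_sum.
by apply: eq_Rintegral => w _; rewrite big_cons Qi.
Qed.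

Lemma expect_le X Y : L1 P X -> L1 P Y -> (forall w, X w <= Y w) ->
  \int[P]_w X w <= \int[P]_w Y w.
Proof. by move=> LX LY XY; apply: le_Rintegral. Qed.

Lemma expect_abs_le X Y : measurable_fun setT X -> (forall w, `|X w| <= Y w) ->
  L1 P Y -> `|\int[P]_w X w| <= \int[P]_w Y w.
Proof.
move=> mX XY LY; have LX := L1_le mX XY LY.
apply: le_trans (le_normr_Rintegral measurableT LX) _.
by apply: expect_le => //; exact: L1_abs.
Qed.

End RealExpectation.

(** * Independence of the sigma-algebras of disjoint blocks of variables *)

Section Independence.
Context {R : realType} {d : measure_display} {T : measurableType d}.
Variable P : probability T R.
Variables (dZ : measure_display) (TZ : measurableType dZ) (Z : nat -> T -> TZ).

(** The pi-system to which the definition of [independent_family] applies directly. The sets [B i]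
    are measurable for every [i], not only on [J], which makes closure under intersection a
    pointwise matter. *)
Definition cylinders (D : set nat) : set (set T) :=
  [set A | exists J : {fset nat}, exists B : nat -> set TZ,
    [/\ [set` J] `<=` D, forall i, measurable (B i) &
      A = \bigcap_(i in [set` J]) (Z i @^-1` B i)]].

Lemma cylindersT D : cylinders D setT.
Proof.
exists fset0, (fun=> setT); split=> [i /=|//|]; first by rewrite inE.
by apply/seteqP; split=> // x _ i /=; rewrite inE.
Qed.

Lemma cylinders1 D i (B : set TZ) : D i -> measurable B ->
  cylinders D (Z i @^-1` B).
Proof.
move=> Di mB; exists [fset i]%fset, (fun=> B); split => //.
  by move=> j /=; rewrite inE => /eqP ->.
apply/seteqP; split => [x Bx j /=|x]; first by rewrite inE => /eqP ->.
by apply; rewrite /= inE.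
Qed.

Lemma cylinders_setI D : setI_closed (cylinders D).
Proof.
move=> _ _ [J1 [B1 [J1D mB1 ->]]] [J2 [B2 [J2D mB2 ->]]].
(* Outside its own index set a family contributes no condition, hence [setT]. *)
exists (J1 `|` J2)%fset, (fun i => (if i \in J1 then B1 i else setT) `&`
                                   (if i \in J2 then B2 i else setT)); split.
- by move=> i /=; rewrite inE => /orP[/J1D|/J2D].
- by move=> i; apply: measurableI; case: ifP.
- apply/seteqP; split => [x [h1 h2] i /= _|x h]; first split.
  + by case: ifPn => // iJ; exact: h1.
  + by case: ifPn => // iJ; exact: h2.
  + split => i /= iJ; have := h i; rewrite /= inE iJ ?orbT => /(_ isT);
    by case.
Qed.

Hypothesis mZ : forall i, measurable_fun setT (Z i).

Lemma cylinders_measurable D : cylinders D `<=` measurable.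
Proof.
move=> _ [J [B [_ mB ->]]]; apply: fin_bigcap_measurable => //= i _.
by rewrite -[_ @^-1` _]setTI; exact: mZ.
Qed.

(** A copy of [T] with the coarser sigma-algebra of the block [D]: being a function of the variables
    in [D] becomes plain measurability on this type. *)
Definition sub_sigma D : measurableType _ := g_sigma_algebraType (cylinders D).

Lemma sub_sigma_measurable D (A : set (sub_sigma D)) :
  measurable A -> measurable (A : set T).
Proof.
by apply: smallest_sub; [exact: sigma_algebra_measurable|exact: cylinders_measurable].
Qed.

Lemma measurable_fun_sub_sigma D d' (T' : measurableType d') (f : T -> T') :
  measurable_fun (setT : set (sub_sigma D)) f -> measurable_fun (setT : set T) f.
Proof.
by move=> mf _ B mB; apply: sub_sigma_measurable; exact: mf.
Qed.

Lemma measurable_gen D i : D i -> measurable_fun (setT : set (sub_sigma D)) (Z i).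
Proof.
move=> Di _ B mB; rewrite setTI; apply: sub_sigma_algebra; exact: cylinders1.
Qed.

Hypothesis indepZ : independent_family P setT Z.

(** Disjointness lets the two families of sets be merged into one family [C] over the union of the
    index sets, to which mutual independence applies. *)
Lemma indep_cylinders D1 D2 A B : [disjoint D1 & D2] ->
  cylinders D1 A -> cylinders D2 B -> P (A `&` B) = (P A * P B)%E.
Proof.
move=> /disj_setPS D12 [J1 [B1 [J1D mB1 ->]]] [J2 [B2 [J2D mB2 ->]]].
pose C i := if i \in J1 then B1 i else B2 i.
have nJ i : i \in J1 -> i \notin J2.
  by move=> /J1D iD; apply/negP => /J2D iD'; exact: (D12 i).
have -> : \bigcap_(i in [set` J1]) (Z i @^-1` B1 i) `&`
          \bigcap_(i in [set` J2]) (Z i @^-1` B2 i) =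
          \bigcap_(i in [set` (J1 `|` J2)%fset]) (Z i @^-1` C i).
  apply/seteqP; split => [x [h1 h2] i /=|x h].
    by rewrite inE /C; case: ifPn => [iJ _|_ /= iJ]; [exact: h1|exact: h2].
  split => i /= iJ; have := h i; rewrite /C /= inE iJ ?orbT => /(_ isT) //.
  by case: ifP => // /nJ; rewrite iJ.
rewrite !indepZ //; last by move=> i _; rewrite /C; case: ifP.
have PJ : perm_eq (J1 `|` J2)%fset (J1 ++ J2).
  apply: uniq_perm; first exact: fset_uniq.
    rewrite cat_uniq !fset_uniq andbT /=; apply/hasPn => i iJ.
    by apply/negP => /nJ; rewrite iJ.
  by move=> i; rewrite !inE mem_cat.
rewrite (perm_big _ PJ) big_cat; congr (_ * _)%E; apply: eq_big_seq => i iJ; rewrite /C.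
  by rewrite iJ.
by case: ifP => // /nJ; rewrite iJ.
Qed.

(** Uniqueness of measures on a pi-system, used twice. For fixed [C] the finite measures P(E and C)
    and P(C) P(E) of [E] agree on cylinders, hence on the sigma-algebra they generate. This extends
    the first event with the second fixed, then the second with the first a cylinder. *)
Lemma indep_sub_sigma D1 D2 (A : set (sub_sigma D1)) (B : set (sub_sigma D2)) :
  [disjoint D1 & D2] -> measurable A -> measurable B ->
  P ((A : set T) `&` (B : set T)) = (P A * P B)%E.
Proof.
move=> D12.
have step (G : set (set T)) (C : set T) : setI_closed G -> G setT ->
    G `<=` measurable -> measurable C ->
    (forall E, G E -> P (E `&` C) = (P E * P C)%E) ->
    forall E, <<s G >> E -> P (E `&` C) = (P E * P C)%E.
  move=> GI GT Gm mC GE E sE.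
  have C0 : 0 <= fine (P C) by rewrite fine_ge0.
  have [c PCE] : exists c : {nonneg R}, P C = c%:num%:E.
    by exists (NngNum C0); rewrite /= fineK ?fin_num_measure.
  have := @g_sigma_algebra_measure_unique _ R _ G Gm (fun=> setT) (fun=> GT) _
    (mrestr P mC) (mscale c P) GI _ _ _ sE.
  rewrite /mrestr /mscale PCE muleC; apply.
  - by apply/seteqP; split => // x _; exists 0%N.
  - by move=> F GF; have := GE _ GF; rewrite PCE muleC.
  - by move=> _; change (P (setT `&` C) < +oo)%E; rewrite setTI -ge0_fin_numE // fin_num_measure.
move=> mA mB; have mBT := sub_sigma_measurable mB.
move: (A) mA; apply: (step) => //.
- exact: cylinders_setI.
- exact: cylindersT.
- exact: cylinders_measurable.
move=> E GE; rewrite setIC muleC; move: (B) mB; apply: (step) => //.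
- exact: cylinders_setI.
- exact: cylindersT.
- exact: cylinders_measurable.
- exact: cylinders_measurable GE.
by move=> F GF; rewrite setIC muleC; apply: indep_cylinders D12 GE GF.
Qed.

Local Open Scope ereal_scope.

(** The identity maps from [T] to its two coarser copies are independent random elements, so their
    joint law is the product of the marginal laws and Tonelli separates the integral. *)
Lemma ge0_expectation_indep D1 D2 (X Y : T -> R) : [disjoint D1 & D2] ->
  measurable_fun (setT : set (sub_sigma D1)) X ->
  measurable_fun (setT : set (sub_sigma D2)) Y ->
  (forall w, 0 <= X w)%R -> (forall w, 0 <= Y w)%R ->
  \int[P]_w (X w * Y w)%:E = \int[P]_w (X w)%:E * \int[P]_w (Y w)%:E.
Proof.
move=> D12 mX mY X0 Y0.
have mid D : measurable_fun setT (idfun : T -> sub_sigma D).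
  by move=> _ B mB; rewrite setTI; exact: (sub_sigma_measurable mB).
pose id1 : {mfun T >-> sub_sigma D1} := mfun_Sub (mem_set (mid D1)).
pose id2 : {mfun T >-> sub_sigma D2} := mfun_Sub (mem_set (mid D2)).
have mid12 : measurable_fun setT (fun w : T => (w : sub_sigma D1, w : sub_sigma D2)).
  exact: measurable_fun_pair (mid D1) (mid D2).
pose id12 : {mfun T >-> (sub_sigma D1 * sub_sigma D2)%type} :=
  mfun_Sub (mem_set mid12).
pose mu1 := distribution P id1; pose mu2 := distribution P id2.
have muE : forall C, measurable C -> (mu1 \x mu2) C = distribution P id12 C.
  apply: product_measure_unique => A B mA mB; exact: (@indep_sub_sigma D1 D2 A B).
pose TT : measurableType _ := (sub_sigma D1 * sub_sigma D2)%type.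
pose f : TT -> \bar R := fun z => (X z.1 * Y z.2)%:E.
have mf : measurable_fun [set: TT] f.
  apply/measurable_EFinP; apply: measurable_funM.
    exact: measurableT_comp mX measurable_fst.
  exact: measurableT_comp mY measurable_snd.
have f0 z : 0 <= f z by rewrite lee_fin mulr_ge0.
transitivity (\int[distribution P id12]_z f z).
  by rewrite ge0_integral_distribution.
transitivity (\int[mu1 \x mu2]_z f z).
  by apply: eq_measure_integral => C mC _; exact/esym/muE.
rewrite fubini_tonelli1 // /fubini_F /f /=.
transitivity (\int[mu1]_x ((X x)%:E * \int[mu2]_y (Y y)%:E)).
  apply: eq_integral => x _.
  under eq_integral do rewrite EFinM.
  rewrite ge0_integralZl //.
  - exact/measurable_EFinP.
  - by move=> y _; rewrite lee_fin.
  - by rewrite lee_fin.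
rewrite ge0_integralZr //; last 3 first.
- exact/measurable_EFinP.
- by move=> y _; rewrite lee_fin.
- by apply: integral_ge0 => y _; rewrite lee_fin.
by congr (_ * _); rewrite ge0_integral_distribution //; exact/measurable_EFinP.
Qed.

Local Close Scope ereal_scope.

Lemma L1_indep_ge0 D1 D2 (X Y : T -> R) : [disjoint D1 & D2] ->
  measurable_fun (setT : set (sub_sigma D1)) X ->
  measurable_fun (setT : set (sub_sigma D2)) Y ->
  (forall w, 0 <= X w)%R -> (forall w, 0 <= Y w)%R -> L1 P X -> L1 P Y ->
  L1 P (fun w => X w * Y w) /\
  \int[P]_w (X w * Y w) = (\int[P]_w X w) * (\int[P]_w Y w).
Proof.
move=> D12 mX mY X0 Y0 LX LY.
have E := ge0_expectation_indep D12 mX mY X0 Y0.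
have fX := integrable_fin_num measurableT LX.
have fY := integrable_fin_num measurableT LY.
split; last by rewrite /Rintegral E fineM.
apply/integrableP; split.
  by apply/measurable_EFinP/measurable_funM;
    [exact: measurable_fun_sub_sigma mX|exact: measurable_fun_sub_sigma mY].
under eq_integral do rewrite /= ger0_norm ?mulr_ge0 //.
rewrite E -ge0_fin_numE; first exact: fin_numM.
by apply: mule_ge0; apply: integral_ge0 => w _; rewrite lee_fin.
Qed.

(** Integrability of the product is concluded, not assumed: each of the four products of positive
    and negative parts is integrable by the nonnegative case. *)
Lemma expect_indep D1 D2 (X Y : T -> R) : [disjoint D1 & D2] ->
  measurable_fun (setT : set (sub_sigma D1)) X ->
  measurable_fun (setT : set (sub_sigma D2)) Y -> L1 P X -> L1 P Y ->
  L1 P (fun w => X w * Y w) /\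
  \int[P]_w (X w * Y w) = (\int[P]_w X w) * (\int[P]_w Y w).
Proof.
move=> D12 mX mY LX LY.
pose p (f : T -> R) w : R := Num.max (f w) 0.
pose n (f : T -> R) w : R := Num.max (- f w) 0.
have mp D (f : T -> R) : measurable_fun (setT : set (sub_sigma D)) f ->
    measurable_fun (setT : set (sub_sigma D)) (p f).
  by move=> mf; apply: measurable_maxr.
have mn D (f : T -> R) : measurable_fun (setT : set (sub_sigma D)) f ->
    measurable_fun (setT : set (sub_sigma D)) (n f).
  by move=> mf; apply: measurable_maxr => //; exact: measurableT_comp.
have p0 f w : 0 <= p f w by rewrite le_max lexx orbT.
have n0 f w : 0 <= n f w by rewrite le_max lexx orbT.
have pn f w : f w = p f w - n f w.
  by rewrite /p /n; case: (leP (f w) 0) => h; [rewrite max_l ?oppr_ge0//|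
    rewrite max_r ?oppr_le0 1?ltW//]; rewrite ?sub0r ?opprK ?subr0.
have Lp (f : T -> R) D : measurable_fun (setT : set (sub_sigma D)) f -> L1 P f -> L1 P (p f).
  move=> mf Lf; apply: L1_le (L1_abs Lf).
    by apply: measurable_fun_sub_sigma; apply: mp; exact: mf.
  by move=> w; rewrite ger0_norm // ge_max ler_norm normr_ge0.
have Ln (f : T -> R) D : measurable_fun (setT : set (sub_sigma D)) f -> L1 P f -> L1 P (n f).
  move=> mf Lf; apply: L1_le (L1_abs Lf).
    by apply: measurable_fun_sub_sigma; apply: mn; exact: mf.
  by move=> w; rewrite ger0_norm // ge_max -normrN ler_norm normr_ge0.
have [L11 E11] := L1_indep_ge0 D12 (mp _ _ mX) (mp _ _ mY) (p0 X) (p0 Y)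
  (Lp _ _ mX LX) (Lp _ _ mY LY).
have [L12 E12] := L1_indep_ge0 D12 (mp _ _ mX) (mn _ _ mY) (p0 X) (n0 Y)
  (Lp _ _ mX LX) (Ln _ _ mY LY).
have [L21 E21] := L1_indep_ge0 D12 (mn _ _ mX) (mp _ _ mY) (n0 X) (p0 Y)
  (Ln _ _ mX LX) (Lp _ _ mY LY).
have [L22 E22] := L1_indep_ge0 D12 (mn _ _ mX) (mn _ _ mY) (n0 X) (n0 Y)
  (Ln _ _ mX LX) (Ln _ _ mY LY).
have -> : (fun w => X w * Y w) = fun w =>
    (p X w * p Y w - p X w * n Y w) - (n X w * p Y w - n X w * n Y w).
  by apply/funext => w; rewrite [in LHS](pn X) [in LHS](pn Y); ring.
split; first by apply: L1B; apply: L1B.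
rewrite expectB; [|by apply: L1B..].
rewrite !expectB // E11 E12 E21 E22.
have EE (f : T -> R) D : measurable_fun (setT : set (sub_sigma D)) f -> L1 P f ->
    \int[P]_w f w = \int[P]_w p f w - \int[P]_w n f w.
  move=> mf Lf; rewrite -expectB; [|exact: Lp mf Lf|exact: Ln mf Lf].
  by apply: eq_Rintegral => w _; exact: pn.
by rewrite (EE X _ mX LX) (EE Y _ mY LY); ring.
Qed.

End Independence.

(** * Second-order expansions of products *)

Section Expansions.
Context {R : realType}.
Implicit Types (K L a b rho : R) (y : nat -> R).

(* [a] equals [a0 + a1 + a2] up to third order, where [ai] has order [i] in
   [rho]; [rho] is not assumed to be small *)
Definition expansion K rho a a0 a1 a2 : Prop :=
  [/\ `|a| <= 1 /\ `|a0| <= 1,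
      `|a1| <= K * rho /\ `|a2| <= K * rho ^+ 2,
      `|a - a0| <= K * rho,
      `|a - a0 - a1| <= K * rho ^+ 2 &
      `|a - a0 - a1 - a2| <= K * rho ^+ 3].

Lemma ler_norm_mul a b K L : `|a| <= K -> `|b| <= L -> `|a * b| <= K * L.
Proof. by move=> aK bL; rewrite normrM ler_pM. Qed.

Lemma ler_norm_add a b K L : `|a| <= K -> `|b| <= L -> `|a + b| <= K + L.
Proof. by move=> aK bL; apply: le_trans (ler_normD _ _) _; rewrite lerD. Qed.

(** Every error is split so that each summand pairs a remainder of one factor with a term of the
    other of complementary order. The largest constant that arises is [K + 2 * (L * K) + L], at most
    [4 * L * K] since both constants are at least 1. *)
Lemma expansionM K L rho a a0 a1 a2 b b0 b1 b2 : 1 <= K -> 1 <= L -> 0 <= rho ->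
  expansion K rho a a0 a1 a2 -> expansion L rho b b0 b1 b2 ->
  expansion (4 * L * K) rho (a * b) (a0 * b0) (a1 * b0 + a0 * b1)
    (a2 * b0 + a1 * b1 + a0 * b2).
Proof.
move=> K1 L1 r0 [[ha ha0] [ha1 ha2] ha3 ha4 ha5] [[hb hb0] [hb1 hb2] hb3 hb4 hb5].
have KL : 1 <= L * K by rewrite mulr_ege1.
have LKL : L <= L * K by rewrite ler_peMr // (le_trans ler01).
have KKL : K <= L * K by rewrite ler_peMl // (le_trans ler01).
have r2 : 0 <= rho ^+ 2 by rewrite exprn_ge0.
have r3 : 0 <= rho ^+ 3 by rewrite exprn_ge0.
have f (x z : R) : 0 <= x -> z <= 4 * L * K -> z * x <= 4 * L * K * x.
  by move=> x0 zx; rewrite ler_wpM2r.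
split; [split|split| | |].
- by rewrite -[leRHS]mulr1; apply: ler_norm_mul.
- by rewrite -[leRHS]mulr1; apply: ler_norm_mul.
- apply: (@le_trans _ _ ((K + L) * rho)); last by apply: f => //; lra.
  apply: le_trans (ler_norm_add (ler_norm_mul ha1 hb0) (ler_norm_mul ha0 hb1)) _.
  by rewrite mulr1 mul1r mulrDl.
- apply: (@le_trans _ _ ((K + L * K + L) * rho ^+ 2)); last by apply: f => //; lra.
  apply: le_trans (ler_norm_add (ler_norm_add (ler_norm_mul ha2 hb0)
    (ler_norm_mul ha1 hb1)) (ler_norm_mul ha0 hb2)) _.
  by rewrite le_eqVlt; apply/orP; left; apply/eqP; ring.
- apply: (@le_trans _ _ ((K + L) * rho)); last by apply: f => //; lra.
  have -> : a * b - a0 * b0 = a * (b - b0) + (a - a0) * b0 by ring.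
  apply: le_trans (ler_norm_add (ler_norm_mul ha hb3) (ler_norm_mul ha3 hb0)) _.
  by rewrite le_eqVlt; apply/orP; left; apply/eqP; ring.
- apply: (@le_trans _ _ ((K + L * K + L) * rho ^+ 2)); last by apply: f => //; lra.
  have -> : a * b - a0 * b0 - (a1 * b0 + a0 * b1) =
    a * (b - b0 - b1) + (a - a0) * b1 + (a - a0 - a1) * b0 by ring.
  apply: le_trans (ler_norm_add (ler_norm_add (ler_norm_mul ha hb4)
    (ler_norm_mul ha3 hb1)) (ler_norm_mul ha4 hb0)) _.
  by rewrite le_eqVlt; apply/orP; left; apply/eqP; ring.
- apply: (@le_trans _ _ ((K + 2 * (L * K) + L) * rho ^+ 3));
    last by apply: f => //; lra.
  have -> : a * b - a0 * b0 - (a1 * b0 + a0 * b1) -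
      (a2 * b0 + a1 * b1 + a0 * b2) =
    a * (b - b0 - b1 - b2) + (a - a0) * b2 + (a - a0 - a1) * b1
      + (a - a0 - a1 - a2) * b0 by ring.
  apply: le_trans (ler_norm_add (ler_norm_add (ler_norm_add (ler_norm_mul ha hb5)
    (ler_norm_mul ha3 hb2)) (ler_norm_mul ha4 hb1)) (ler_norm_mul ha5 hb0)) _.
  by rewrite le_eqVlt; apply/orP; left; apply/eqP; ring.
Qed.

(** The class of coefficients of the expansion, seen as functions of the lagged sums. The Lipschitz
    clause makes [f] depend on the first [m] coordinates only. Measurability is required along
    measurable families over an arbitrary measurable type, so that it also holds with respect to the
    past sigma-algebras [sub_sigma]. *)
Definition regular (m : nat) K (f : (nat -> R) -> R) : Prop :=
  [/\ forall y, `|f y| <= K,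
      forall y y', `|f y - f y'| <= K * \sum_(j < m) `|y j - y' j| &
      forall d (T : measurableType d) (Y : nat -> T -> R),
        (forall j, measurable_fun setT (Y j)) ->
        measurable_fun setT (fun w => f (Y ^~ w))].

Lemma regular_le m m' K K' f : (m <= m')%N -> K <= K' -> regular m K f ->
  regular m' K' f.
Proof.
move=> mm' KK' [fK fL fm]; split => //.
  by move=> y; exact: le_trans (fK y) KK'.
move=> y y'; apply: le_trans (fL y y') _; apply: ler_pM => //.
- exact: le_trans (normr_ge0 _) (fK y).
- by apply: sumr_ge0.
- rewrite -[in leRHS](subnKC mm') big_split_ord /= lerDl; exact: sumr_ge0.
Qed.

Lemma regularM m K L f g : regular m K f -> regular m L g ->
  regular m (2 * L * K) (fun y => f y * g y).
Proof.
move=> [fK fL fm] [gK gL gm].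
have K0 : 0 <= K := le_trans (normr_ge0 _) (fK (fun=> 0)).
have L0 : 0 <= L := le_trans (normr_ge0 _) (gK (fun=> 0)).
split.
- move=> y; apply: le_trans (ler_norm_mul (fK y) (gK y)) _.
  by have := mulr_ge0 K0 L0; lra.
- move=> y y'.
  have -> : f y * g y - f y' * g y' = f y * (g y - g y') + (f y - f y') * g y'.
    by ring.
  apply: le_trans (ler_norm_add (ler_norm_mul (fK y) (gL y y'))
    (ler_norm_mul (fL y y') (gK y'))) _.
  by rewrite le_eqVlt; apply/orP; left; apply/eqP; ring.
- by move=> d T Y mY; apply: measurable_funM; [exact: fm|exact: gm].
Qed.

Lemma regular_coord m K (u : R -> R) (j : nat) : (j < m)%N ->
  (forall x, `|u x| <= K) -> (forall x x', `|u x - u x'| <= K * `|x - x'|) ->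
  measurable_fun setT u -> regular m K (fun y => u (y j)).
Proof.
move=> jm uK uL mu; split => // [y y'|d T Y mY].
  apply: le_trans (uL _ _) _; rewrite ler_wpM2l //.
    exact: le_trans (normr_ge0 _) (uK 0).
  by rewrite (bigD1 (Ordinal jm)) //= lerDl sumr_ge0.
exact: measurableT_comp.
Qed.

Lemma regular_cst m K c : `|c| <= K -> regular m K (fun=> c).
Proof.
move=> cK; split => // y y'; rewrite subrr normr0 mulr_ge0 //.
  exact: le_trans cK.
exact: sumr_ge0.
Qed.

(** The coefficients [A] and [B] are chosen before the increments [h], the variances [c] and the
    perturbed factors [p]: they depend on the current sums alone, which later makes them independent
    of the new variable. Each further factor multiplies the constant by [4 * K]. *)
Lemma prod_expansion (m : nat) K (u0 u1 u2 : nat -> R -> R) : 1 <= K ->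
  (forall j x, `|u0 j x| <= 1) ->
  (forall j x x', `|u0 j x - u0 j x'| <= K * `|x - x'|) ->
  (forall j, measurable_fun setT (u0 j)) ->
  (forall j x, `|u1 j x| <= K) ->
  (forall j x x', `|u1 j x - u1 j x'| <= K * `|x - x'|) ->
  (forall j, measurable_fun setT (u1 j)) ->
  (forall j x, `|u2 j x| <= K) ->
  (forall j x x', `|u2 j x - u2 j x'| <= K * `|x - x'|) ->
  (forall j, measurable_fun setT (u2 j)) ->
  exists (A : nat -> (nat -> R) -> R) (B : nat -> nat -> (nat -> R) -> R),
  [/\ regular m ((4 * K) ^+ m) (fun y => \prod_(j < m) u0 j (y j)),
      forall i, regular m ((4 * K) ^+ m) (A i),
      forall i j, regular m ((4 * K) ^+ m) (B i j) &
      forall y (h c p : nat -> R) rho, 0 <= rho ->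
        (forall j, (j < m)%N -> expansion K rho (p j) (u0 j (y j))
           (h j * u1 j (y j)) ((h j ^+ 2 - c j) * u2 j (y j))) ->
        expansion ((4 * K) ^+ m) rho (\prod_(j < m) p j)
          (\prod_(j < m) u0 j (y j)) (\sum_(i < m) h i * A i y)
          (\sum_(i < m) \sum_(j < m)
             (h i * h j - (i == j :> nat)%:R * c i) * B i j y)].
Proof.
move=> K1 b0 l0 m0 b1 l1 m1 b2 l2 m2.
have K0 : 0 <= K := le_trans ler01 K1.
elim: m => [|m [A [B [rP rA rB E]]]].
  exists (fun _ _ => 0), (fun _ _ _ => 0); rewrite expr0; split.
  - have -> : (fun y => \prod_(j < 0) u0 j (y j)) = fun=> 1.
      by apply/funext => y; rewrite big_ord0.
    by apply: regular_cst; rewrite normr1.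
  - by move=> i; apply: regular_cst; rewrite normr0.
  - by move=> i j; apply: regular_cst; rewrite normr0.
  - move=> y h c p rho r0 _; rewrite !big_ord0 /expansion !subrr ?subr0 normr0 normr1.
    by rewrite !mul1r !exprn_ge0.
have Km1 : 1 <= (4 * K) ^+ m by rewrite exprn_ege1 // (le_trans K1) //; lra.
have KS : (4 * K) ^+ m.+1 = 2 * (2 * K * (4 * K) ^+ m) by rewrite exprS; ring.
have le2 : 2 * K * (4 * K) ^+ m <= (4 * K) ^+ m.+1.
  by rewrite KS; have := mulr_ge0 K0 (le_trans ler01 Km1); lra.
have le1 : K <= (4 * K) ^+ m.+1.
  by rewrite exprSr -{1}[K]mul1r; apply: ler_pM => //; lra.
have rM f g : regular m ((4 * K) ^+ m) f -> regular m.+1 K g ->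
    regular m.+1 ((4 * K) ^+ m.+1) (fun y => f y * g y).
  move=> rf rg; apply: (@regular_le m.+1 _ _ _ _ (leqnn _) le2); apply: regularM => //.
  exact: regular_le (leqnSn m) (lexx _) rf.
have r0 : regular m.+1 K (fun y => u0 m (y m)).
  by apply: regular_coord => // x; exact: le_trans (b0 _ _) K1.
have r1 : regular m.+1 K (fun y => u1 m (y m)) by exact: regular_coord.
have r2 : regular m.+1 K (fun y => u2 m (y m)) by exact: regular_coord.
pose P y := \prod_(j < m) u0 j (y j).
exists (fun i y => if (i < m)%N then A i y * u0 m (y m) else P y * u1 m (y m)).
(* A cross term of two factors is stored once, at [i < j], so the entries below the diagonal are
   zero. On the diagonal sits the second-order term of a single factor. *)
exists (fun i j y => if (i < m)%N then
  if (j < m)%N then B i j y * u0 m (y m) else A i y * u1 m (y m)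
  else if (j < m)%N then 0 else P y * u2 m (y m)); split.
- have -> : (fun y => \prod_(j < m.+1) u0 j (y j)) = fun y => P y * u0 m (y m).
    by apply/funext => y; rewrite big_ord_recr.
  exact: rM.
- by move=> i; case: (i < m)%N; exact: rM.
- move=> i j; case: (i < m)%N; case: (j < m)%N; try exact: rM.
  by apply: regular_cst; rewrite normr0 (le_trans K0).
- move=> y h c p rho rho0 Ep.
  have Em : expansion ((4 * K) ^+ m) rho _ _ _ _ :=
    E y h c p rho rho0 (fun j jm => Ep j (ltnW jm)).
  have := expansionM Km1 K1 rho0 Em (Ep m (ltnSn m)).
  rewrite -exprS !big_ord_recr /= ltnn eqxx mul1r.
  congr expansion.
  + congr (_ + _); last by rewrite mulrCA.
    by rewrite big_distrl; apply: eq_bigr => i _ /=; rewrite ltn_ord mulrA.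
  + rewrite [X in _ = _ + (X + _)]big1 ?add0r; last first.
      by move=> i _; rewrite ltn_ord mulr0.
    congr (_ + _); last by rewrite -expr2 mulrCA.
    rewrite !big_distrl -big_split /=; apply: eq_bigr => i _.
    rewrite big_ord_recr /= ltn_ord ltnn ltn_eqF // mul0r subr0.
    congr (_ + _); last by ring.
    by rewrite big_distrl; apply: eq_bigr => j _ /=; rewrite ltn_ord mulrA.
Qed.

End Expansions.

(** * Mean value theorem and Taylor remainder *)

Section MeanValue.
Context {R : realType}.
Implicit Types f df : R -> R.

Lemma MVT_shift f df x h : (forall t : R, is_derive t 1 f (df t)) ->
  exists2 th, `|th| <= `|h| & f (x + h) - f x = df (x + th) * h.
Proof.
move=> fdf.
have cf : continuous f.
  by move=> t; apply/differentiable_continuous/derivable1_diffP; case: (fdf t).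
have [h0|h0] := leP 0 h.
  have [|c cI ->] := @MVT_segment R f df x (x + h) _ (fun t _ => fdf t)
      (continuous_subspaceT cf); first by rewrite lerDl.
  move: cI; rewrite in_itv /= => /andP[xc cxh].
  exists (c - x); last by congr (df _ * _); ring.
  by rewrite !ger0_norm ?subr_ge0 // lerBlDl.
have [|c cI E] := @MVT_segment R f df (x + h) x _ (fun t _ => fdf t)
    (continuous_subspaceT cf); first by rewrite gerDl ltW.
move: cI; rewrite in_itv /= => /andP[xhc cx].
exists (c - x).
  rewrite (ltr0_norm h0) ler0_norm ?subr_le0 // lerN2 lerBrDl //.
by rewrite -opprB E -mulrN; congr (df _ * _); ring.
Qed.

Lemma lipschitz_derive f df K : (forall t : R, is_derive t 1 f (df t)) ->
  (forall t, `|df t| <= K) -> forall x y, `|f x - f y| <= K * `|x - y|.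
Proof.
move=> fdf dfK x y; have [th _] := MVT_shift y (x - y) fdf.
rewrite subrKC => ->; rewrite normrM.
exact: ler_wpM2r.
Qed.

(** Two mean value steps: the derivative of the remainder at [th] is [th] times an increment of [f2]
    over a distance at most [|h|]. *)
Lemma taylor_lipschitz f f1 f2 K : (forall t : R, is_derive t 1 f (f1 t)) ->
  (forall t : R, is_derive t 1 f1 (f2 t)) ->
  (forall x y, `|f2 x - f2 y| <= K * `|x - y|) ->
  forall x h, `|f (x + h) - f x - h * f1 x - h ^+ 2 / 2 * f2 x| <= K * `|h| ^+ 3.
Proof.
move=> ff1 f12 f2K x h.
have K0 : 0 <= K.
  by have := f2K 1 0; rewrite subr0 normr1 mulr1; apply: le_trans.
pose g t := f (x + t) - f x - t * f1 x - t ^+ 2 / 2 * f2 x.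
pose dg t := f1 (x + t) - f1 x - t * f2 x.
have gdg (t : R) : is_derive t 1 g (dg t).
  have ft : is_derive t (1 : R) (fun t => f (x + t)) (f1 (x + t) * 1).
    apply: is_derive1_comp.
    by apply: is_derive_eq; rewrite add0r.
  by apply: is_derive_eq; rewrite /dg /GRing.scale /=; field.
have [th thh] := MVT_shift 0 h gdg; rewrite add0r.
rewrite /g addr0 subrr mul0r expr0n /= !mul0r !subr0 => ->.
rewrite add0r normrM exprSr mulrA; apply: ler_wpM2r => //.
rewrite /dg; have [th2 th2h ->] := MVT_shift x th f12.
rewrite [X in X - _]mulrC -mulrBr normrM [leLHS]mulrC expr2 mulrA.
apply: ler_pM => //; apply: le_trans (f2K _ _) _.
rewrite addrC addKr; apply: ler_wpM2l => //; exact: le_trans thh.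
Qed.

End MeanValue.

(** * The normal distribution function *)

Section NormalCdf.
Context {R : realType}.

Definition npdf : R -> R := normal_pdf 0 1.
Definition ncdf (x : R) : R := \int[lebesgue_measure]_(t in `]-oo, x]) npdf t.

Lemma npdfE x : npdf x = normal_peak 1 * expR (- (x ^+ 2) / 2).
Proof.
by rewrite /npdf normal_pdfE ?oner_eq0 // /normal_fun subr0 expr1n.
Qed.

Lemma npdf_ge0 x : 0 <= npdf x. Proof. exact: normal_pdf_ge0. Qed.

(** The exponential of x^2/2 is the square of that of x^2/4, which is at least 1 + x^2/4. This
    quartic decay is enough for the polynomials, of degree at most 3, that occur in the derivatives
    of [heat]. *)
Lemma npdf_decay x : npdf x * (1 + x ^+ 2 / 4) ^+ 2 <= 1.
Proof.
have p1 : normal_peak (1 : R) <= 1.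
  rewrite /normal_peak expr1n mul1r invf_le1.
    rewrite -[leLHS]sqrtr1 ler_sqrt; have := @pi_ge2 R; lra.
  by rewrite sqrtr_gt0 pmulrn_lgt0 // pi_gt0.
have e1 : (1 + x ^+ 2 / 4) ^+ 2 <= expR (x ^+ 2 / 2).
  have -> : x ^+ 2 / 2 = (x ^+ 2 / 4) *+ 2 by rewrite -mulr_natr; field.
  rewrite mulr2n expRD -expr2; apply: lerXn2r; rewrite ?nnegrE ?expR_ge0 ?expR_ge1Dx //.
  by rewrite addr_ge0 // divr_ge0 // sqr_ge0.
rewrite npdfE -mulrA -[leRHS]mul1r; apply: ler_pM => //.
- exact: normal_peak_ge0.
- by rewrite mulr_ge0 ?expR_ge0 ?sqr_ge0.
apply: le_trans (ler_wpM2l (expR_ge0 _) e1) _.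
by rewrite -expRD mulNr addNr expR0.
Qed.

Lemma npdf_poly_bound (x q : R) : `|q| <= 16 * (1 + x ^+ 2 / 4) ^+ 2 ->
  `|q * npdf x| <= 16.
Proof.
move=> h; rewrite normrM (ger0_norm (npdf_ge0 x)).
apply: le_trans (ler_wpM2r (npdf_ge0 x) h) _.
by have := npdf_decay x; rewrite mulrC; lra.
Qed.

Lemma is_derive_npdf (x : R) : is_derive x 1 npdf (- x * npdf x).
Proof.
have -> : npdf = fun x => normal_peak 1 * expR (- (x ^+ 2) / 2).
  by apply/funext => y; exact: npdfE.
by apply: is_derive_eq; rewrite /GRing.scale /=; field.
Qed.

Lemma integrable_npdf A : measurable A ->
  lebesgue_measure.-integrable A (EFin \o npdf).
Proof.
move=> mA; apply: (@integrableS _ _ _ _ setT) => //.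
exact: integrable_normal_pdf.
Qed.

Lemma is_derive_ncdf (x : R) : is_derive x 1 ncdf (npdf x).
Proof.
have xx1 : x < x + 1 by rewrite ltrDl.
have [dF F'] := @continuous_FTC1 R npdf -oo%O x (x + 1) xx1
  (integrable_npdf (measurable_itv _)) (ltNyr _)
  (@continuous_normal_pdf R 0 1 (oner_neq0 _) x).
apply: DeriveDef; first exact: dF.
by rewrite -derive1E F'.
Qed.

#[local] Existing Instance is_derive_npdf.
#[local] Existing Instance is_derive_ncdf.

(* [heat c s y] is the probability that [y + N(0, s)] is at most [c]; it solves
   the heat equation, [heat1] and [heat2] being its derivative in [y] and half
   of its second one, i.e. its derivative in [s]. *)
Definition heat (c s y : R) := ncdf ((c - y) / Num.sqrt s).
Definition heat1 (c s y : R) := - (npdf ((c - y) / Num.sqrt s) / Num.sqrt s).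
Definition heat2 (c s y : R) :=
  let z := (c - y) / Num.sqrt s in - (z * npdf z / (2 * s)).

Section HeatDerivatives.
Variables c s : R.
Hypothesis s0 : 0 < s.

Let q0 : Num.sqrt s != 0. Proof. by rewrite sqrtr_eq0 -ltNge. Qed.
Let sq : Num.sqrt s * Num.sqrt s = s.
Proof. by rewrite -expr2 sqr_sqrtr // ltW. Qed.

Let sqV : s^-1 = (Num.sqrt s)^-1 * (Num.sqrt s)^-1.
Proof. by rewrite -invfM sq. Qed.

Let dz (y : R) : is_derive y 1 (fun y => (c - y) * (Num.sqrt s)^-1) (- (Num.sqrt s)^-1).
Proof. by apply: is_derive_eq; rewrite /GRing.scale /=; ring. Qed.

Lemma is_derive_heat (y : R) : is_derive y 1 (heat c s) (heat1 c s y).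
Proof.
have := @is_derive1_comp _ ncdf _ _ _ _ (is_derive_ncdf _) (dz y).
by rewrite mulrN.
Qed.

Let dnz (y : R) : is_derive y 1 (fun y => npdf ((c - y) * (Num.sqrt s)^-1))
  ((c - y) / s * npdf ((c - y) / Num.sqrt s)).
Proof.
have := @is_derive1_comp _ npdf _ _ _ _ (is_derive_npdf _) (dz y).
by congr is_derive; rewrite sqV; ring.
Qed.

Lemma is_derive_heat1 (y : R) : is_derive y 1 (heat1 c s) (2 * heat2 c s y).
Proof.
have := is_deriveN (is_deriveZ ((Num.sqrt s)^-1) (dnz y)).
have -> : - ((Num.sqrt s)^-1 \*: (fun y => npdf ((c - y) * (Num.sqrt s)^-1)))
  = heat1 c s by apply/funext => x; rewrite /heat1 /= mulrC.
by congr is_derive; rewrite /GRing.scale /= /heat2 invfM sqV; field.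
Qed.

Lemma is_derive_heat2 (y : R) : let z := (c - y) / Num.sqrt s in
  is_derive y 1 (heat2 c s) ((1 - z ^+ 2) / 2 * npdf z / (s * Num.sqrt s)).
Proof.
move=> z; have := is_deriveN (is_deriveZ ((2 * s)^-1) (is_deriveM (dz y) (dnz y))).
set f := (- _); have -> : f = heat2 c s.
  by apply/funext => x; rewrite /f /heat2; congr (- _); exact: mulrC.
by congr is_derive; rewrite /GRing.scale /= /z !invfM sqV; field.
Qed.

End HeatDerivatives.

Section HeatTime.
Variables c y : R.

Let dz (s : R) : 0 < s -> is_derive s 1 (fun s => (c - y) * (Num.sqrt s)^-1)
  (- ((c - y) / Num.sqrt s / (2 * s))).
Proof.
move=> s0.
have q0 : Num.sqrt s != 0 by rewrite sqrtr_eq0 -ltNge.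
have sqV : s^-1 = (Num.sqrt s)^-1 * (Num.sqrt s)^-1.
  by rewrite -invfM -expr2 sqr_sqrtr // ltW.
have h := @is_deriveV _ Num.sqrt _ _ _ q0 (is_derive1_sqrt s0).
have := is_deriveZ (c - y) h.
by congr is_derive; rewrite /GRing.scale /= !invfM sqV; ring.
Qed.

Lemma is_derive_heat_time (s : R) : 0 < s ->
  is_derive s 1 (fun s => heat c s y) (heat2 c s y).
Proof.
move=> s0; have := @is_derive1_comp _ ncdf _ _ _ _ (is_derive_ncdf _) (dz s0).
by congr is_derive; rewrite /heat2; ring.
Qed.

Lemma is_derive_heat2_time (s : R) : 0 < s -> let z := (c - y) / Num.sqrt s in
  is_derive s 1 (fun s => heat2 c s y) ((3 * z - z ^+ 3) / 4 * npdf z / s ^+ 2).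
Proof.
move=> s0 z.
have s20 : 2 * s != 0 by rewrite mulf_neq0 // gt_eqF.
have d1 := @is_derive1_comp _ npdf _ _ _ _ (is_derive_npdf _) (dz s0).
have d2 : is_derive s 1 (fun s => (2 * s)^-1) (- (2 * s ^+ 2)^-1).
  have d0 : is_derive s (1 : R) (fun s => 2 * s) 2.
    by apply: is_derive_eq; rewrite /GRing.scale /=; ring.
  have := @is_deriveV _ (fun s => 2 * s) s 2 1 s20 d0.
  by congr is_derive; rewrite /GRing.scale /=; field; rewrite gt_eqF.
have := is_deriveN (is_deriveM (is_deriveM (dz s0) d1) d2).
set f := (- _); have -> : f = (fun s => heat2 c s y).
  by apply/funext => x; rewrite /f /heat2 !fctE.
congr is_derive.
transitivity (- (z * npdf z * - (2 * s ^+ 2)^-1 + (2 * s)^-1 *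
  (z * (- z * npdf z * - (z / (2 * s))) + npdf z * - (z / (2 * s))))) => //.
by field; rewrite gt_eqF.
Qed.

End HeatTime.

Lemma ncdf_ge0 x : 0 <= ncdf x.
Proof. by apply: Rintegral_ge0 => t _; exact: npdf_ge0. Qed.

Lemma ncdf_le1 x : ncdf x <= 1.
Proof.
rewrite -lee_fin fineK; last exact: integrable_fin_num (integrable_npdf _).
exact: (@probability_le1 _ _ _ (normal_prob (0 : R) 1)).
Qed.

(** * Bounds and third-order expansion of the Gaussian smoothing *)

Section HeatBounds.
Variables c e : R.
Hypotheses (e0 : 0 < e) (e1 : e <= 1).

(** One constant for all derivatives: 16 bounds the polynomial times the density, and the worst
    denominator is [s ^+ 2] in the time derivative of [heat2], where [s] is at least [e ^+ 2]. *)
Let K := 16 / e ^+ 4.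

Let decayE (z : R) : 16 * (1 + z ^+ 2 / 4) ^+ 2 = 16 + 8 * z ^+ 2 + (z ^+ 2) ^+ 2.
Proof. by field. Qed.

Let K_ge (k : nat) (a b : R) : (k <= 4)%N -> `|a| <= 16 -> e ^+ k <= b ->
  `|a / b| <= K.
Proof.
move=> k4 a16 eb; have b0 : 0 < b by apply: lt_le_trans eb; rewrite exprn_gt0.
rewrite normrM normfV (gtr0_norm b0) ler_pM //; first by rewrite invr_ge0 ltW.
rewrite lef_pV2 ?posrE ?exprn_gt0 //; apply: le_trans eb.
by rewrite ler_wiXn2l // ltW.
Qed.

Let sqrt_ge (s : R) : e ^+ 2 <= s -> e <= Num.sqrt s.
Proof.
move=> es; rewrite -(ger0_norm (ltW e0)) -sqrtr_sqr ler_sqrt //.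
by apply: le_trans es; rewrite sqr_ge0.
Qed.

Let s_gt0 (s : R) : e ^+ 2 <= s -> 0 < s.
Proof. by apply: lt_le_trans; rewrite exprn_gt0. Qed.

Lemma heat_bound s y : `|heat c s y| <= 1.
Proof. by rewrite ger0_norm ?ncdf_ge0 ?ncdf_le1. Qed.

Lemma heat1_bound s y : e ^+ 2 <= s -> `|heat1 c s y| <= K.
Proof.
move=> es; rewrite /heat1 normrN; apply: (@K_ge 1) => //; last exact: sqrt_ge.
rewrite -[npdf _]mul1r; apply: npdf_poly_bound.
by rewrite normr1 decayE; set z := _ / _; have := sqr_ge0 z; have := sqr_ge0 (z ^+ 2); lra.
Qed.

Lemma dheat1_bound s y : e ^+ 2 <= s -> `|2 * heat2 c s y| <= K.
Proof.
move=> es; have s0 := s_gt0 es.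
have -> : 2 * heat2 c s y =
  (- ((c - y) / Num.sqrt s)) * npdf ((c - y) / Num.sqrt s) / s.
  by rewrite /heat2; field; rewrite gt_eqF // sqrtr_eq0 -ltNge.
apply: (@K_ge 2) => //; apply: npdf_poly_bound.
set z := _ / _; rewrite normrN decayE ler_norml.
have := sqr_ge0 (z - 1); have := sqr_ge0 (z + 1); have := sqr_ge0 (z ^+ 2).
by move=> *; apply/andP; split; nra.
Qed.

Lemma heat2_bound s y : e ^+ 2 <= s -> `|heat2 c s y| <= K.
Proof.
move=> es; apply: le_trans (dheat1_bound y es).
by rewrite normrM normr_nat ler_peMl // ler1n.
Qed.

Lemma dheat2_bound s z : e ^+ 2 <= s ->
  `|(1 - z ^+ 2) / 2 * npdf z / (s * Num.sqrt s)| <= K.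
Proof.
move=> es; apply: (@K_ge 3) => //; last first.
  by rewrite exprSr ler_pM ?exprn_ge0 ?sqrt_ge // ltW.
apply: npdf_poly_bound; rewrite decayE ler_norml.
have := sqr_ge0 z; have := sqr_ge0 (z ^+ 2).
by move=> *; apply/andP; split; lra.
Qed.

Lemma heat2_time_bound s z : e ^+ 2 <= s ->
  `|(3 * z - z ^+ 3) / 4 * npdf z / s ^+ 2| <= K.
Proof.
move=> es; apply: (@K_ge 4) => //; last first.
  by rewrite (_ : 4 = 2 * 2)%N // exprM lerXn2r ?nnegrE ?sqr_ge0 // ltW // s_gt0.
apply: npdf_poly_bound.
(* These squares bound |z|^3 / 4 by z^4 + z^2 / 64, and [h3], [h4] bound |z| by (z^2 + 1) / 2. *)
have h1 := sqr_ge0 (z ^+ 2 - z / 8); have h2 := sqr_ge0 (z ^+ 2 + z / 8).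
have h3 := sqr_ge0 (z - 1); have h4 := sqr_ge0 (z + 1); have h5 := sqr_ge0 z.
by rewrite decayE ler_norml; apply/andP; split; nra.
Qed.

Lemma heat_lipschitz s y y' : e ^+ 2 <= s ->
  `|heat c s y - heat c s y'| <= K * `|y - y'|.
Proof.
move=> es; apply: lipschitz_derive (fun t => is_derive_heat c (s_gt0 es) t) _ _ _.
by move=> t; exact: heat1_bound.
Qed.

Lemma heat1_lipschitz s y y' : e ^+ 2 <= s ->
  `|heat1 c s y - heat1 c s y'| <= K * `|y - y'|.
Proof.
move=> es; apply: lipschitz_derive (fun t => is_derive_heat1 c (s_gt0 es) t) _ _ _.
by move=> t; exact: dheat1_bound.
Qed.

Lemma heat2_lipschitz s y y' : e ^+ 2 <= s ->
  `|heat2 c s y - heat2 c s y'| <= K * `|y - y'|.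
Proof.
move=> es; apply: lipschitz_derive (fun t => is_derive_heat2 c (s_gt0 es) t) _ _ _.
by move=> t; exact: dheat2_bound.
Qed.

Lemma MVT_time (f df : R -> R) s q : e ^+ 2 <= s - q -> 0 <= q ->
  (forall t : R, 0 < t -> is_derive t 1 f (df t)) ->
  exists2 t, s - q <= t <= s & f s - f (s - q) = df t * q.
Proof.
move=> es q0 fdf; have sq : s - q <= s by rewrite gerBl.
have p0 t : s - q <= t -> 0 < t by move=> /(le_trans es) /s_gt0.
have [||t tI ->] := @MVT_segment R f df (s - q) s sq.
- by move=> t; rewrite in_itv /= => /andP[/ltW /p0 t0 _]; exact: fdf.
- apply: derivable_within_continuous => t; rewrite in_itv /= => /andP[/p0 t0 _].
  by case: (fdf t t0).
exists t; first by move: tI; rewrite in_itv.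
by congr (_ * _); ring.
Qed.

Let K1 : 1 <= K.
Proof.
rewrite /K ler_pdivlMr ?exprn_gt0 // mul1r.
by apply: (@le_trans _ _ 1); [rewrite exprn_ile1 // ltW|rewrite ler1n].
Qed.

(** Space is expanded at the fixed variance [s]. The change of variance contributes [q] times
    [heat2] at an intermediate time and at [y + h]; moving it back to [(s, y)] costs K q + K |h|,
    which is of order [rho], and the factor [q <= rho ^+ 2] supplies the other two orders. *)
Let heat_remainder s q y h rho : e ^+ 2 <= s - q -> 0 <= q -> rho <= 1 ->
  `|h| <= rho -> q <= rho ^+ 2 ->
  `|heat c (s - q) (y + h) - heat c s y - h * heat1 c s y
    - (h ^+ 2 - q) * heat2 c s y| <= 4 * K * rho ^+ 3.
Proof.
move=> esq q0 r1 hr qr; have r0 : 0 <= rho := le_trans (normr_ge0 _) hr.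
have K0 : 0 <= K := le_trans ler01 K1.
have es : e ^+ 2 <= s by apply: le_trans esq _; rewrite gerBl.
have [t /andP[st ts] Et] := MVT_time esq q0 (is_derive_heat_time c (y + h)).
have est : e ^+ 2 <= s - (s - t) by rewrite subKr (le_trans esq).
have st0 : 0 <= s - t by rewrite subr_ge0.
have [t' /andP[]] := MVT_time est st0 (is_derive_heat2_time c (y + h)).
rewrite subKr => tt' t's Et'.
have h1 : `|heat2 c s (y + h) - heat2 c t (y + h)| <= K * q.
  rewrite Et' normrM; apply: ler_pM => //.
    by apply: heat2_time_bound; rewrite (le_trans esq) // (le_trans st).
  by rewrite ger0_norm // lerBlDl -lerBlDr.
have h2 : `|heat2 c s (y + h) - heat2 c s y| <= K * `|h|.
  by have := heat2_lipschitz (y + h) y es; rewrite addrAC subrr add0r.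
have h3 : `|heat c s (y + h) - heat c s y - h * heat1 c s y
    - h ^+ 2 / 2 * (2 * heat2 c s y)| <= 2 * K * `|h| ^+ 3.
  apply: (taylor_lipschitz (fun t => is_derive_heat c (s_gt0 es) t)
    (fun t => is_derive_heat1 c (s_gt0 es) t)) => x x'.
  rewrite -mulrBr normrM normr_nat -mulrA; apply: ler_wpM2l => //.
  exact: heat2_lipschitz.
have h4 : heat c (s - q) (y + h) = heat c s (y + h) - heat2 c t (y + h) * q.
  by rewrite -Et; ring.
have -> : heat c (s - q) (y + h) - heat c s y - h * heat1 c s y
    - (h ^+ 2 - q) * heat2 c s y =
  q * ((heat2 c s (y + h) - heat2 c t (y + h)) - (heat2 c s (y + h) - heat2 c s y))
  + (heat c s (y + h) - heat c s y - h * heat1 c s y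
    - h ^+ 2 / 2 * (2 * heat2 c s y)) by rewrite h4; field.
apply: le_trans (ler_normD _ _) _.
have -> : 4 * K * rho ^+ 3 = rho ^+ 2 * (K * rho + K * rho) + 2 * K * rho ^+ 3 by ring.
apply: lerD; last first.
  apply: le_trans h3 _; apply: ler_wpM2l; first by rewrite mulr_ge0.
  exact: lerXn2r.
rewrite normrM ger0_norm //; apply: ler_pM => //.
apply: le_trans (ler_normB _ _) _; apply: lerD.
  apply: le_trans h1 _; rewrite ler_wpM2l // (le_trans qr) // expr2.
  by rewrite ler_piMl.
by apply: le_trans h2 _; rewrite ler_wpM2l.
Qed.

(** For [rho <= 1] the lower orders follow from the third by adding the terms back, which gives 4 +
    1 + 1 = 6. For [rho > 1] each power of [rho] dominates the smaller ones, so the bounds on the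
    separate terms suffice. *)
Lemma heat_expansion s q y h rho : e ^+ 2 <= s - q -> 0 <= q ->
  `|h| <= rho -> q <= rho ^+ 2 ->
  expansion (6 * K) rho (heat c (s - q) (y + h)) (heat c s y)
    (h * heat1 c s y) ((h ^+ 2 - q) * heat2 c s y).
Proof.
move=> esq q0 hr qr; have r0 : 0 <= rho := le_trans (normr_ge0 _) hr.
have es : e ^+ 2 <= s by apply: le_trans esq _; rewrite gerBl.
have a1 : `|h * heat1 c s y| <= K * rho.
  by rewrite mulrC; apply: ler_norm_mul => //; exact: heat1_bound.
have a2 : `|(h ^+ 2 - q) * heat2 c s y| <= K * rho ^+ 2.
  rewrite mulrC; apply: ler_norm_mul; first exact: heat2_bound.
  have h2 : h ^+ 2 <= rho ^+ 2 by rewrite -real_normK ?num_real // lerXn2r.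
  have h2' := sqr_ge0 h.
  by rewrite ler_norml; apply/andP; split; lra.
have b1 := heat_bound (s - q) (y + h); have b0 := heat_bound s y.
have R3 := @heat_remainder s q y h rho esq q0.
move: a1 a2 b1 b0 R3; set A := heat c _ _; set A0 := heat c s y.
set A1 := h * _; set A2 := (_ - q) * _ => a1 a2 b1 b0 R3.
have [rho1|rho1] := leP rho 1.
  have {}R3 := R3 rho1 hr qr.
  have r2 : rho ^+ 2 <= rho by rewrite expr2 ler_piMl.
  have r3 : rho ^+ 3 <= rho ^+ 2 by rewrite exprS ler_piMl ?sqr_ge0.
  have k1 : K * rho ^+ 2 <= K * rho by rewrite ler_wpM2l // (le_trans ler01).
  have k2 : K * rho ^+ 3 <= K * rho ^+ 2 by rewrite ler_wpM2l // (le_trans ler01).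
  have k3 : 0 <= K * rho ^+ 3 by rewrite mulr_ge0 ?exprn_ge0 // (le_trans ler01).
  have E : A - A0 = (A - A0 - A1 - A2) + A2 + A1 by ring.
  have R2 : `|A - A0 - A1 - A2 + A2| <= 5 * K * rho ^+ 2.
    by apply: le_trans (ler_norm_add R3 a2) _; lra.
  split; [by []|split| | |].
  - lra.
  - lra.
  - by rewrite E; apply: le_trans (ler_norm_add R2 a1) _; lra.
  - by rewrite E addrK; apply: le_trans R2 _; lra.
  - by apply: le_trans R3 _; lra.
have r2 : rho <= rho ^+ 2 by rewrite expr2 ler_peMl // ltW.
have r3 : rho ^+ 2 <= rho ^+ 3 by rewrite exprS ler_peMl ?sqr_ge0 // ltW.
have k1 : K * rho <= K * rho ^+ 2 by rewrite ler_wpM2l // (le_trans ler01).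
have k2 : K * rho ^+ 2 <= K * rho ^+ 3 by rewrite ler_wpM2l // (le_trans ler01).
have k3 : 1 <= K * rho by rewrite mulr_ege1 // ltW.
have R1 : `|A - A0| <= 1 + 1 by apply: ler_norm_add => //; rewrite normrN.
have R2 : `|A - A0 - A1| <= 1 + 1 + K * rho.
  by apply: ler_norm_add => //; rewrite normrN.
have {}R3 : `|A - A0 - A1 - A2| <= 1 + 1 + K * rho + K * rho ^+ 2.
  by apply: ler_norm_add => //; rewrite normrN.
split; [by []|split| | |]; lra.
Qed.

End HeatBounds.

Lemma ncdf_continuous : continuous ncdf.
Proof.
move=> t; apply/differentiable_continuous/derivable1_diffP.
by case: (is_derive_ncdf t).
Qed.

Lemma ncdf_nondecreasing : {homo ncdf : x y / x <= y}.
Proof.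
move=> x y xy; rewrite -subr_ge0 -(subrKC x y).
have [th _ ->] := MVT_shift x (y - x) is_derive_ncdf.
by rewrite mulr_ge0 ?npdf_ge0 // subr_ge0.
Qed.

(** [ncdf] is by definition the distribution function of the identity variable under the standard
    normal law, and its limits at infinity are obtained as such. *)
Let idR : measurableTypeR R -> R := idfun.

Let measurable_idR : measurable_fun setT idR.
Proof. exact: (@measurable_id _ _ setT). Qed.

Let idRV : {RV (normal_prob (0 : R) 1) >-> R} := mfun_Sub (mem_set measurable_idR).

Let cdf_idRV : fine \o cdf idRV = ncdf.
Proof. by []. Qed.

Lemma cvg_ncdfy : ncdf x @[x --> +oo%R] --> (1 : R).
Proof. by rewrite -cdf_idRV; apply: fine_cvg; exact: cvg_cdfy1. Qed.

Lemma cvg_ncdfNy : ncdf x @[x --> -oo%R] --> (0 : R).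
Proof. by rewrite -cdf_idRV; apply: fine_cvg; exact: cvg_cdfNy0. Qed.

End NormalCdf.

(** * Lindeberg replacement for lagged products *)

Section ElementaryBounds.
Context {R : realType}.
Implicit Types a b x : R.

Lemma normr_le_sum_pow4 x : `|x| <= 1 + x ^+ 4.
Proof.
rewrite ler_norml; have := sqr_ge0 (x ^+ 2 - 1 / 2); have := sqr_ge0 (x - 1 / 2).
have := sqr_ge0 (x + 1 / 2) => h1 h2 h3.
by rewrite (_ : x ^+ 4 = (x ^+ 2) ^+ 2); [apply/andP; split; nra|ring].
Qed.

Lemma sqr_le_sum_pow4 x : x ^+ 2 <= 1 + x ^+ 4.
Proof.
have := sqr_ge0 (x ^+ 2 - 1 / 2) => h3.
by rewrite (_ : x ^+ 4 = (x ^+ 2) ^+ 2); [nra|ring].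
Qed.

Lemma cube_le_sum_pow4 x : `|x| ^+ 3 <= 1 + x ^+ 4.
Proof.
have -> : x ^+ 4 = (`|x| ^+ 2) ^+ 2.
  by rewrite (real_normK (num_real x)) -exprM.
have := normr_ge0 x; set y := `|x| => y0.
have h1 : 0 <= (y ^+ 2 - y) ^+ 2 by rewrite sqr_ge0.
have h2 : 0 <= (y ^+ 2 - 1) ^+ 2 by rewrite sqr_ge0.
have h3 : 0 <= (y ^+ 2) ^+ 2 by rewrite sqr_ge0.
nra.
Qed.

Lemma norm_mul2_le a b : `|a * b| <= (a ^+ 2 + b ^+ 2) / 2.
Proof.
have h1 := sqr_ge0 (a - b); have h2 := sqr_ge0 (a + b).
by rewrite ler_norml; apply/andP; split; nra.
Qed.

Lemma norm_mul4_le (a b x y : R) :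
  `|a * b * (x * y)| <= (a ^+ 4 + b ^+ 4 + x ^+ 4 + y ^+ 4) / 4.
Proof.
apply: le_trans (norm_mul2_le _ _) _.
have h1 := sqr_ge0 (a ^+ 2 - b ^+ 2); have h2 := sqr_ge0 (x ^+ 2 - y ^+ 2).
by nra.
Qed.

Lemma cube_sum_le (n : nat) a (x : nat -> R) : 0 <= a -> (forall i, 0 <= x i) ->
  (a + \sum_(i < n) x i) ^+ 3 <= 4 ^+ n * (a ^+ 3 + \sum_(i < n) x i ^+ 3).
Proof.
move=> a0 x0; elim: n => [|n IH]; first by rewrite !big_ord0 !addr0 mul1r.
rewrite !big_ord_recr /= addrA.
have cube2 (u w : R) : 0 <= u -> 0 <= w -> (u + w) ^+ 3 <= 4 * (u ^+ 3 + w ^+ 3).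
  move=> u0 w0; have : 0 <= (u + w) * (u - w) ^+ 2 by rewrite mulr_ge0 ?addr_ge0 ?sqr_ge0.
  by nra.
apply: le_trans (cube2 _ _ _ (x0 n)) _; first by rewrite addr_ge0 // sumr_ge0.
rewrite addrA mulrDr [leRHS]mulrDr; apply: lerD.
  by rewrite [4 ^+ n.+1]exprS -mulrA ler_wpM2l.
by rewrite ler_wpM2r ?exprn_ge0 // ler_eXnr // ler1n.
Qed.

End ElementaryBounds.

Section Lindeberg.
Context {d : measure_display} {T : measurableType d} {R : realType}.
Variables (P : probability T R) (Y : nat -> T -> R) (s2 : nat -> R) (M : R).
Hypothesis mY : forall t, measurable_fun setT (Y t).
Hypothesis indepY : independent_family P setT Y.
Hypothesis Y0 : forall w, Y 0%N w = 0.
Hypothesis EY : forall t, \int[P]_w Y t w = 0.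
Hypothesis EY2 : forall t, \int[P]_w (Y t w ^+ 2) = s2 t.
Hypothesis LY4 : forall t, L1 P (fun w => Y t w ^+ 4).
Hypothesis EY4 : forall t, \int[P]_w (Y t w ^+ 4) <= M.

Local Notation past k := (sub_sigma Y [set t | (t < k)%N]).
Local Notation future k := (sub_sigma Y [set t | (k <= t)%N]).

Let L1_pow4 (f : T -> R) t : measurable_fun setT f ->
  (forall w, `|f w| <= 1 + Y t w ^+ 4) -> L1 P f.
Proof. by move=> mf fY; apply: L1_le mf fY _; apply: L1D => //; exact: L1_cst. Qed.

Let E1_pow4 t : \int[P]_w (1 + Y t w ^+ 4) <= 1 + M.
Proof. by rewrite expectD ?expect_cst ?lerD2l //; exact: L1_cst. Qed.

Let M0 : 0 <= M.
Proof.
apply: le_trans (EY4 0); apply: Rintegral_ge0 => w _.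
by rewrite (_ : Y 0%N w ^+ 4 = (Y 0%N w ^+ 2) ^+ 2) ?sqr_ge0 // -exprM.
Qed.

Lemma LY t : L1 P (Y t).
Proof. by apply: (L1_pow4 (t := t)) => // w; exact: normr_le_sum_pow4. Qed.

Lemma LY2 t : L1 P (fun w => Y t w ^+ 2).
Proof.
apply: (L1_pow4 (t := t)); first exact: measurable_funX.
by move=> w; rewrite ger0_norm ?sqr_ge0 // sqr_le_sum_pow4.
Qed.

Lemma LY3 t : L1 P (fun w => `|Y t w| ^+ 3).
Proof.
apply: (L1_pow4 (t := t)); first by apply: measurable_funX; exact: measurableT_comp.
by move=> w; rewrite ger0_norm ?exprn_ge0 // cube_le_sum_pow4.
Qed.

Lemma EY3 t : \int[P]_w (`|Y t w| ^+ 3) <= 1 + M.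
Proof.
apply: le_trans (E1_pow4 t); apply: expect_le; first exact: LY3.
  by apply: L1D => //; exact: L1_cst.
by move=> w; exact: cube_le_sum_pow4.
Qed.

Lemma s2_ge0 t : 0 <= s2 t.
Proof. by rewrite -EY2; apply: Rintegral_ge0 => w _; exact: sqr_ge0. Qed.

Lemma s2_le t : s2 t <= 1 + M.
Proof.
rewrite -EY2; apply: le_trans (E1_pow4 t); apply: expect_le; first exact: LY2.
  by apply: L1D => //; exact: L1_cst.
by move=> w; exact: sqr_le_sum_pow4.
Qed.

Lemma LYY t u : L1 P (fun w => Y t w * Y u w).
Proof.
apply: (@L1_le _ _ _ _ _ (fun w => (Y t w ^+ 2 + Y u w ^+ 2) * 2^-1)).
- exact: measurable_funM.
- by move=> w; exact: norm_mul2_le.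
- under eq_fun do rewrite mulrC; apply: L1Z; apply: L1D; exact: LY2.
Qed.

Lemma EYY_abs t u : \int[P]_w `|Y t w * Y u w| <= 1 + M.
Proof.
apply: (@le_trans _ _ (\int[P]_w (2^-1 * (Y t w ^+ 2 + Y u w ^+ 2)))).
  apply: expect_le; first exact/L1_abs/LYY.
    by apply: L1Z; apply: L1D; exact: LY2.
  by move=> w; rewrite [leRHS]mulrC norm_mul2_le.
rewrite expectZ; last by apply: L1D; exact: LY2.
rewrite expectD; [|exact: LY2..]; rewrite !EY2.
by have := s2_le t; have := s2_le u; lra.
Qed.

Lemma LY_mul4 a b t u : L1 P (fun w => Y a w * Y b w * (Y t w * Y u w)).
Proof.
apply: (@L1_le _ _ _ _ _
  (fun w => 4^-1 * (Y a w ^+ 4 + Y b w ^+ 4 + Y t w ^+ 4 + Y u w ^+ 4))).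
- by apply: measurable_funM; exact: measurable_funM.
- by move=> w; rewrite [leRHS]mulrC norm_mul4_le.
- by apply: L1Z; do 3 apply: L1D => //.
Qed.

Lemma EY_mul4_abs a b t u : \int[P]_w `|Y a w * Y b w * (Y t w * Y u w)| <= M.
Proof.
apply: (@le_trans _ _ (\int[P]_w
    (4^-1 * (Y a w ^+ 4 + Y b w ^+ 4 + Y t w ^+ 4 + Y u w ^+ 4)))).
  apply: expect_le; first exact/L1_abs/LY_mul4.
    by apply: L1Z; do 3 apply: L1D => //.
  by move=> w; rewrite [leRHS]mulrC norm_mul4_le.
rewrite expectZ; last by do 3 apply: L1D => //.
rewrite !expectD //; try by do 2 (try apply: L1D => //).
by have := EY4 a; have := EY4 b; have := EY4 t; have := EY4 u; lra.
Qed.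

Lemma past_future_disjoint k : [disjoint [set t | (t < k)%N] & [set t | (k <= t)%N]].
Proof. by apply/disj_setPS => t /= [+ kt]; rewrite ltnNge kt. Qed.

Lemma past_Y k t : (t < k)%N || (t == 0)%N ->
  measurable_fun (setT : set (past k)) (Y t).
Proof.
case: (ltnP t k) => [tk _|_ /= /eqP ->]; first exact: measurable_gen.
by rewrite (_ : Y 0%N = cst 0) //; apply/funext => w; exact: Y0.
Qed.

Lemma future_Y k t : (k <= t)%N -> measurable_fun (setT : set (future k)) (Y t).
Proof. by move=> kt; exact: measurable_gen. Qed.

Lemma expect_past_future k (F G : T -> R) :
  measurable_fun (setT : set (past k)) F -> measurable_fun (setT : set (future k)) G ->
  L1 P F -> L1 P G ->
  L1 P (fun w => F w * G w) /\
  \int[P]_w (F w * G w) = (\int[P]_w F w) * (\int[P]_w G w).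
Proof. exact: (expect_indep mY indepY (past_future_disjoint k)). Qed.

Lemma past_measurable k (F : T -> R) :
  measurable_fun (setT : set (past k)) F -> measurable_fun (setT : set T) F.
Proof. exact: measurable_fun_sub_sigma. Qed.

Lemma EYY0 t u : t != u -> \int[P]_w (Y t w * Y u w) = 0.
Proof.
wlog tu : t u / (t < u)%N => [H|_].
  case: (ltngtP t u) => [tu _|ut _|-> //].
  - by apply: H => //; rewrite ltn_eqF.
  - by rewrite -(H u t ut) ?ltn_eqF //; apply: eq_Rintegral => w _; rewrite mulrC.
have [_ ->] := expect_past_future (past_Y (k := u) (t := t) (introT orP (or_introl tu)))
  (future_Y (leqnn u)) (LY t) (LY u).
by rewrite EY mul0r.
Qed.

Lemma EYY t u : \int[P]_w (Y t w * Y u w) = (t == u)%:R * s2 t.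
Proof.
case: eqVneq => [<-|tu]; last by rewrite EYY0 // mul0r.
by rewrite mul1r -EY2; apply: eq_Rintegral => w _; rewrite expr2.
Qed.

Variables (m : nat) (r e : R) (c : nat -> R) (N : nat).
Hypotheses (r0 : 0 <= r) (e0 : 0 < e) (e1 : e <= 1).

(* Since [Y 0 = 0], the truncated difference [t - j.+1] discards the lags that
   reach before time 1. *)
Definition lagprod (t j : nat) (w : T) : R := Y t w * Y (t - j.+1)%N w.

Definition lagsum (k j : nat) (w : T) : R := r * \sum_(t < k) lagprod t j w.

Definition lagvar (t j : nat) : R := r ^+ 2 * (s2 t * s2 (t - j.+1)%N).

Definition smoothing_var (k j : nat) : R := e ^+ 2 + \sum_(k <= t < N) lagvar t j.

(* Constant in [k] up to third order in [r]: the variances [lagvar t j] of the terms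
   [t >= k], not yet in the sums, are in the smoothing. *)
Definition lindeberg_fun (k : nat) (w : T) : R :=
  \prod_(j < m) heat (c j) (smoothing_var k j) (lagsum k j w).

Let M1 := 1 + M.

Let M1_ge1 : 1 <= M1. Proof. by rewrite lerDl. Qed.

Let M1_ge0 : 0 <= M1. Proof. exact: le_trans ler01 M1_ge1. Qed.

Lemma lagvar_ge0 t j : 0 <= lagvar t j.
Proof. by rewrite !mulr_ge0 ?sqr_ge0 ?s2_ge0. Qed.

Lemma smoothing_varS k j : (k < N)%N ->
  smoothing_var k.+1 j = smoothing_var k j - lagvar k j.
Proof. by move=> kN; rewrite /smoothing_var [in RHS]big_ltn //; ring. Qed.

Lemma smoothing_var_ge k j : e ^+ 2 <= smoothing_var k j.
Proof. by rewrite lerDl; apply: sumr_ge0 => t _; exact: lagvar_ge0. Qed.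

Lemma lagsumS k j w : lagsum k.+1 j w = lagsum k j w + r * lagprod k j w.
Proof. by rewrite /lagsum big_ord_recr mulrDr. Qed.

Let lag_past t j k : (t <= k)%N -> (t - j.+1 < k)%N || (t - j.+1 == 0)%N.
Proof.
case: t => [|t] tk; first by rewrite sub0n orbT.
by rewrite subSS (leq_ltn_trans (leq_subr _ _) tk).
Qed.

Lemma past_lagsum p k j : (p <= k)%N ->
  measurable_fun (setT : set (past k)) (lagsum p j).
Proof.
move=> pk; apply: measurable_funM => //.
apply: measurable_sum => t; apply: measurable_funM; apply: past_Y.
  by rewrite (leq_trans (ltn_ord t)).
by apply: lag_past; rewrite ltnW // (leq_trans (ltn_ord t)).
Qed.

Lemma regular_past p k K A : (p <= k)%N -> regular m K A ->
  measurable_fun (setT : set (past k)) (fun w => A (lagsum p ^~ w)).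
Proof. by move=> pk [_ _ mA]; apply: mA => j; exact: past_lagsum. Qed.

Lemma regular_L1 k K A : regular m K A -> L1 P (fun w => A (lagsum k ^~ w)).
Proof.
move=> rA; case: (rA) => Ab _ _; apply: (@L1_bounded _ _ _ _ K) => //.
exact: past_measurable (regular_past (leqnn k) rA).
Qed.

Lemma past_lag k i : measurable_fun (setT : set (past k)) (Y (k - i.+1)%N).
Proof.
by apply: past_Y; exact: lag_past.
Qed.

(** [Y k] is centred and independent of the remaining factors, all of which lie in the past of
    [k]. *)
Lemma first_order_term k i K A : regular m K A ->
  L1 P (fun w => r * lagprod k i w * A (lagsum k ^~ w)) /\
  \int[P]_w (r * lagprod k i w * A (lagsum k ^~ w)) = 0.
Proof.
move=> rA; case: (rA) => Ab _ _.
have pF : measurable_fun (setT : set (past k))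
    (fun w => A (lagsum k ^~ w) * Y (k - i.+1)%N w).
  by apply: measurable_funM; [exact: regular_past rA|exact: past_lag].
have LF : L1 P (fun w => A (lagsum k ^~ w) * Y (k - i.+1)%N w).
  apply: (L1_bounded_mul (c := K)) => //; last exact: LY.
  exact: past_measurable (regular_past (leqnn k) rA).
have [LG EG] := expect_past_future pF (future_Y (leqnn k)) LF (LY k).
have -> : (fun w => r * lagprod k i w * A (lagsum k ^~ w)) =
    fun w => r * (A (lagsum k ^~ w) * Y (k - i.+1)%N w * Y k w).
  by apply/funext => w; rewrite /lagprod; ring.
by split; [exact: L1Z|rewrite expectZ // EG EY !mulr0].
Qed.

Let lagsum_diff k j w : `|lagsum k j w - lagsum (k - m) j w| <=
  r * \sum_(k - m <= t < k) `|lagprod t j w|.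
Proof.
rewrite /lagsum -mulrBr -!(big_mkord xpredT (fun t => lagprod t j w)).
rewrite (@big_cat_nat _ _ _ (k - m)%N 0%N k) ?leq_subr //= addrAC subrr add0r.
by rewrite normrM ger0_norm // ler_wpM2l // ler_norm_sum.
Qed.

(* Replacing [lagsum k] by [lagsum (k - m)] costs a further factor [r] and makes
   the [B]-factor independent of [Y (k - i.+1)] and [Y (k - j.+1)]. *)
Lemma second_order_term k i j K B : (i < m)%N -> (j < m)%N -> regular m K B ->
  let F w := (r * lagprod k i w * (r * lagprod k j w) - (i == j)%:R * lagvar k i)
    * B (lagsum k ^~ w) in
  L1 P F /\ `|\int[P]_w F w| <= 2 * K * m%:R ^+ 2 * M1 ^+ 3 * r ^+ 3.
Proof.
move=> im jm rB F; case: (rB) => Bb Bl _.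
have K0 : 0 <= K := le_trans (normr_ge0 _) (Bb (fun=> 0)).
set a := (k - i.+1)%N; set b := (k - j.+1)%N.
pose dl : R := (i == j)%:R.
pose Bk w := B (lagsum k ^~ w); pose Bp w := B (lagsum (k - m) ^~ w).
have mBk : measurable_fun (setT : set (past k)) Bk by exact: regular_past rB.
have mBp : measurable_fun (setT : set (past (k - m))) Bp by exact: regular_past rB.
have mBkT := past_measurable mBk; have mBpT := past_measurable mBp.
pose U w := Y a w * Y b w.
have mU : measurable_fun setT U by exact: measurable_funM.
have LU : L1 P U := LYY a b.
have LUB : L1 P (fun w => Bk w * U w).
  by apply: (L1_bounded_mul (c := K) mBkT) => // w; exact: Bb.
have LB : L1 P Bk by exact: regular_L1 rB.
have mBU : measurable_fun (setT : set (past k)) (fun w => Bk w * U w).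
  by apply: measurable_funM => //; apply: measurable_funM; exact: past_lag.
have mYk2 : measurable_fun (setT : set (future k)) (fun w => Y k w ^+ 2).
  by apply: measurable_funX; exact: future_Y.
have [L2 E2] := expect_past_future mBU mYk2 LUB (LY2 k).
pose G w := U w - dl * s2 a.
have LG : L1 P G by apply: L1B => //; exact: L1_cst.
have mG : measurable_fun setT G by exact: measurable_funB.
(* [Y k ^ 2] is independent of the rest and averages to [s2 k]; what remains is the covariance of
   the lagged pair, centred as [G]. *)
have EF : L1 P F /\ \int[P]_w F w = r ^+ 2 * s2 k * \int[P]_w (Bk w * G w).
  have FE : F = fun w => r ^+ 2 * (Bk w * U w * Y k w ^+ 2)
      - r ^+ 2 * (dl * s2 k * s2 a) * Bk w.
    apply/funext => w; rewrite /F /lagprod /lagvar -/a -/b -/(Bk w) -/dl /U.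
    by ring.
  rewrite FE; split; first by apply: L1B; exact: L1Z.
  rewrite expectB ?expectZ //; try exact: L1Z.
  rewrite E2 EY2.
  have -> : \int[P]_w (Bk w * G w) =
      \int[P]_w (Bk w * U w) - dl * s2 a * \int[P]_w Bk w.
    rewrite -expectZ // -expectB //; last exact: L1Z.
    by apply: eq_Rintegral => w _; rewrite /G; ring.
  by ring.
case: EF => LF EF; split => //; rewrite EF.
have EG : \int[P]_w G w = 0.
  rewrite expectB //; last exact: L1_cst.
  rewrite expect_cst EYY /dl; case: (eqVneq i j) => [ij|ij].
    by rewrite /a /b ij eqxx !mul1r subrr.
  case: (eqVneq a b) => [ab|_]; last by rewrite !mul0r subrr.
  (* Distinct lags reach the same index only when both are truncated to 0, where [Y] vanishes. *)
  have a0 : a = 0%N.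
    apply/eqP; move: ab ij; rewrite /a /b => ab; apply: contra_neqT => ka.
    have ik : (i.+1 < k)%N by rewrite -subn_gt0 lt0n.
    have jk : (j.+1 < k)%N by rewrite -subn_gt0 -ab subn_gt0.
    by have := congr1 (subn k) ab; rewrite !subKn ?(ltnW ik, ltnW jk) // => -[].
  rewrite a0 mul0r subr0 mul1r -EY2.
  rewrite -[RHS](expect_cst P 0); apply: eq_Rintegral => w _.
  by rewrite Y0 expr0n.
(* Since [i] and [j] are below [m], both lagged indices are at least [k - m], also after truncation.
   Thus [G] is independent of [Bp], and being centred it allows [Bp] to be subtracted at no cost. *)
have fG : measurable_fun (setT : set (future (k - m))) G.
  by apply: measurable_funB => //; apply: measurable_funM; apply: future_Y;
    rewrite leq_sub2l.
have LBp : L1 P Bp by exact: regular_L1 rB.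
have [LBG EBG] := expect_past_future mBp fG LBp LG.
have LBkG : L1 P (fun w => Bk w * G w) by
  apply: (L1_bounded_mul (c := K) mBkT) => // w; exact: Bb.
have -> : \int[P]_w (Bk w * G w) = \int[P]_w ((Bk w - Bp w) * G w).
  have -> : \int[P]_w ((Bk w - Bp w) * G w) =
     \int[P]_w (Bk w * G w) - \int[P]_w (Bp w * G w).
    by rewrite -expectB //; apply: eq_Rintegral => w _; ring.
  by rewrite EBG EG mulr0 subr0.
(* [H t l] bounds |G| |lagprod t l|. The Lipschitz bound on [Bk - Bp] produces at most [m] times for
   each of the [m] coordinates, whence the factor [m%:R ^+ 2]. *)
pose H t l w := `|U w * lagprod t l w| + dl * s2 a * `|lagprod t l w|.
have LH t l : L1 P (H t l).
  apply: L1D; first by apply/L1_abs; exact: LY_mul4.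
  by apply/L1Z/L1_abs; exact: LYY.
have dl01 : 0 <= dl <= 1 by rewrite /dl; case: (i == j); rewrite /= ?lexx ?ler01.
have ds : 0 <= dl * s2 a <= M1.
  case/andP: dl01 => dl0 dl1; rewrite mulr_ge0 ?s2_ge0 //=.
  rewrite -[leRHS]mul1r; apply: ler_pM => //; [exact: s2_ge0|exact: s2_le].
have EH t l : \int[P]_w H t l w <= 2 * M1 ^+ 2.
  rewrite expectD; [|by apply/L1_abs; exact: LY_mul4
                    |by apply/L1Z/L1_abs; exact: LYY].
  rewrite expectZ; last by apply/L1_abs; exact: LYY.
  have h1 := EY_mul4_abs a b t (t - l.+1)%N.
  have h2 : dl * s2 a * \int[P]_w `|lagprod t l w| <= M1 * M1.
    case/andP: ds => ds0 ds1; apply: ler_pM => //; last exact: EYY_abs.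
    by apply: Rintegral_ge0.
  have h3 : M <= M1 ^+ 2.
    by apply: (@le_trans _ _ M1); rewrite ?lerDr // expr2 ler_peMl.
  have -> : 2 * M1 ^+ 2 = M1 ^+ 2 + M1 * M1 by ring.
  by apply: lerD => //; apply: le_trans h3.
pose Z w := K * (r * \sum_(l < m) \sum_(k - m <= t < k) H t l w).
have LZ : L1 P Z.
  by apply/L1Z/L1Z; apply: L1_sum => l _; apply: L1_sum => t _.
have ZB w : `|(Bk w - Bp w) * G w| <= Z w.
  rewrite normrM mulrC.
  have hG : `|G w| <= `|U w| + dl * s2 a.
    apply: le_trans (ler_normB _ _) _; rewrite lerD2l ger0_norm //.
    by case/andP: ds.
  apply: le_trans (ler_pM (normr_ge0 _) (normr_ge0 _) hG (Bl _ _)) _.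
  rewrite mulrCA /Z ler_wpM2l //.
  rewrite !mulr_sumr; apply: ler_sum => l _.
  have hU : 0 <= `|U w| + dl * s2 a by apply: le_trans hG.
  apply: le_trans (ler_wpM2l hU (lagsum_diff _ _ _)) _.
  rewrite mulrCA ler_wpM2l // mulr_sumr; apply: ler_sum => t _.
  by rewrite /H (normrM (U w)) mulrDl.
have EZ : \int[P]_w Z w <= K * (r * (m%:R ^+ 2 * (2 * M1 ^+ 2))).
  rewrite expectZ; last first.
    by apply/L1Z; apply: L1_sum => l _; apply: L1_sum => t _.
  rewrite ler_wpM2l // expectZ; last first.
    by apply: L1_sum => l _; apply: L1_sum => t _.
  rewrite ler_wpM2l // expect_sum; last by move=> l _; apply: L1_sum => t _.
  apply: (@le_trans _ _ (\sum_(l < m) m%:R * (2 * M1 ^+ 2))); last first.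
    by rewrite sumr_const card_ord -[leLHS]mulr_natl mulrA -expr2.
  apply: ler_sum => l _; rewrite expect_sum //.
  apply: (@le_trans _ _ (\sum_(k - m <= t < k) (2 * M1 ^+ 2))).
    by apply: ler_sum => t _; exact: EH.
  rewrite sumr_const_nat -[leLHS]mulr_natl ler_wpM2r ?mulr_ge0 ?exprn_ge0 // ler_nat.
  by rewrite leq_subLR addnC -maxnE leq_maxr.
have hE := expect_abs_le (measurable_funM (measurable_funB mBkT mBpT) mG) ZB LZ.
rewrite normrM ger0_norm; last by rewrite mulr_ge0 ?sqr_ge0 ?s2_ge0.
have rs : r ^+ 2 * s2 k <= r ^+ 2 * M1 by rewrite ler_wpM2l ?sqr_ge0 ?s2_le.
apply: le_trans (ler_pM _ _ rs (le_trans hE EZ)) _ => //.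
  by rewrite mulr_ge0 ?sqr_ge0 ?s2_ge0.
by rewrite le_eqVlt; apply/orP; left; apply/eqP; ring.
Qed.

(** A random scale common to all coordinates: the sum dominates every increment [r * lagprod k j],
    and [M1] makes [rho ^+ 2] dominate every [lagvar k j], as [s2] is at most [M1]. *)
Let rho k (w : T) : R := r * (M1 + \sum_(j < m) `|lagprod k j w|).

(** The cube of a lagged product has degree 6 in [Y], but its two factors are independent, so two
    third absolute moments suffice. *)
Lemma third_order_term k : L1 P (fun w => rho k w ^+ 3) /\
  \int[P]_w (rho k w ^+ 3) <= 4 ^+ m * (m%:R + 1) * M1 ^+ 3 * r ^+ 3.
Proof.
pose Z w := r ^+ 3 * (4 ^+ m * (M1 ^+ 3 + \sum_(j < m) `|lagprod k j w| ^+ 3)).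
have L3 j : L1 P (fun w => `|lagprod k j w| ^+ 3) /\
    \int[P]_w (`|lagprod k j w| ^+ 3) <= M1 ^+ 2.
  have mF : measurable_fun (setT : set (past k)) (fun w => `|Y (k - j.+1)%N w| ^+ 3).
    by apply: measurable_funX; apply: measurableT_comp => //; exact: past_lag.
  have mG : measurable_fun (setT : set (future k)) (fun w => `|Y k w| ^+ 3).
    by apply: measurable_funX; apply: measurableT_comp => //; exact: future_Y.
  have [LFG EFG] := expect_past_future mF mG (LY3 _) (LY3 _).
  have -> : (fun w => `|lagprod k j w| ^+ 3) =
      fun w => `|Y (k - j.+1)%N w| ^+ 3 * `|Y k w| ^+ 3.
    by apply/funext => w; rewrite /lagprod normrM exprMn mulrC.
  split => //; rewrite EFG expr2.
  by apply: ler_pM; rewrite ?EY3 //; apply: Rintegral_ge0 => w _; rewrite exprn_ge0.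
have LS : L1 P (fun w => \sum_(j < m) `|lagprod k j w| ^+ 3).
  by apply: L1_sum => j _; exact: (L3 j).1.
have LMS : L1 P (fun w => M1 ^+ 3 + \sum_(j < m) `|lagprod k j w| ^+ 3).
  by apply: L1D => //; exact: L1_cst.
have LZ : L1 P Z by apply/L1Z/L1Z.
have S0 w : 0 <= \sum_(j < m) `|lagprod k j w| by apply: sumr_ge0.
have rZ w : rho k w ^+ 3 <= Z w.
  rewrite exprMn; apply: ler_wpM2l; first exact: exprn_ge0.
  exact: (@cube_sum_le _ m M1 (fun j => `|lagprod k j w|)).
have rho0 w : 0 <= rho k w ^+ 3.
  by rewrite exprn_ge0 // mulr_ge0 // addr_ge0.
have Lrho : L1 P (fun w => rho k w ^+ 3).
  apply: L1_le LZ; last by move=> w; rewrite ger0_norm.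
  apply: measurable_funX; apply: measurable_funM => //; apply: measurable_funD => //.
  apply: measurable_sum => j; apply: measurableT_comp => //.
  exact: measurable_funM.
split => //; apply: le_trans (expect_le Lrho LZ rZ) _.
rewrite expectZ; last exact: L1Z.
rewrite expectZ // expectD //; last exact: L1_cst.
rewrite expect_cst expect_sum; last by move=> j _; exact: (L3 j).1.
rewrite [leRHS]mulrC ler_wpM2l ?exprn_ge0 // -mulrA ler_wpM2l ?exprn_ge0 //.
rewrite mulrDl mul1r addrC lerD2r.
apply: (@le_trans _ _ (\sum_(j < m) M1 ^+ 3)).
  apply: ler_sum => j _; apply: le_trans (L3 j).2 _.
  by rewrite [leRHS]exprS ler_peMl ?exprn_ge0.
by rewrite sumr_const card_ord mulr_natl.
Qed.

Lemma lindeberg_measurable k : measurable_fun setT (lindeberg_fun k).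
Proof.
apply: measurable_prod => j _.
have es := smoothing_var_ge k j.
have ch : continuous (heat (c j) (smoothing_var k j)).
  move=> t; apply/differentiable_continuous/derivable1_diffP.
  have s0 : 0 < smoothing_var k j by apply: lt_le_trans es; rewrite exprn_gt0.
  by case: (is_derive_heat (c j) s0 t).
apply: measurableT_comp; first exact: continuous_measurable_fun.
exact: past_measurable (past_lagsum j (leqnn k)).
Qed.

Lemma lindeberg_bounded k w : `|lindeberg_fun k w| <= 1.
Proof.
rewrite /lindeberg_fun; elim/big_ind: _ => [|x y x1 y1|j _].
- by rewrite normr1.
- by rewrite -[leRHS]mulr1; exact: ler_norm_mul.
- exact: heat_bound.
Qed.

(** The first factor is the constant of [prod_expansion] for scalar constant [6 * (16 / e ^+ 4)]. In
    the last one, [2 * m%:R ^+ 4] comes from [m ^ 2] second-order terms and the rest from the cubed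
    scale. *)
Definition lindeberg_const : R :=
  (4 * (6 * (16 / e ^+ 4))) ^+ m * M1 ^+ 3 *
  (2 * m%:R ^+ 4 + 4 ^+ m * (m%:R + 1)).

(** The change splits into a first-order part [F1] of mean zero, a second-order part [F2] of mean of
    order r^3, and a remainder of at most [K'] times [rho ^+ 3]. *)
Lemma lindeberg_step k : (k < N)%N ->
  `|\int[P]_w lindeberg_fun k.+1 w - \int[P]_w lindeberg_fun k w|
    <= lindeberg_const * r ^+ 3.
Proof.
move=> kN; set K := 16 / e ^+ 4; pose L := 6 * K; pose K' := (4 * L) ^+ m.
have K1 : 1 <= K.
  rewrite /K ler_pdivlMr ?exprn_gt0 // mul1r.
  by apply: (@le_trans _ _ 1); [rewrite exprn_ile1 // ltW|rewrite ler1n].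
have KL : K <= L by rewrite /L; lra.
have L_ge1 : 1 <= L by exact: le_trans KL.
have es j := smoothing_var_ge k j.
have s0 j : 0 < smoothing_var k j by apply: lt_le_trans (es j); rewrite exprn_gt0.
have cm f df : (forall t : R, is_derive t 1 f (df t)) -> measurable_fun setT (f : R -> R).
  move=> fdf; apply: continuous_measurable_fun => t.
  by apply/differentiable_continuous/derivable1_diffP; case: (fdf t).
have KLM (x y z : R) : x <= K * `|y - z| -> x <= L * `|y - z|.
  by move=> h; apply: le_trans h _; rewrite ler_wpM2r.
have [A [B [_ rA rB Ex]]] := @prod_expansion R m L
  (fun j => heat (c j) (smoothing_var k j)) (fun j => heat1 (c j) (smoothing_var k j))
  (fun j => heat2 (c j) (smoothing_var k j)) L_ge1
  (fun j x => heat_bound (c j) _ x)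
  (fun j x y => KLM _ _ _ (heat_lipschitz (c j) e0 e1 x y (es j)))
  (fun j => cm _ _ (is_derive_heat (c j) (s0 j)))
  (fun j x => le_trans (heat1_bound (c j) e0 e1 x (es j)) KL)
  (fun j x y => KLM _ _ _ (heat1_lipschitz (c j) e0 e1 x y (es j)))
  (fun j => cm _ _ (is_derive_heat1 (c j) (s0 j)))
  (fun j x => le_trans (heat2_bound (c j) e0 e1 x (es j)) KL)
  (fun j x y => KLM _ _ _ (heat2_lipschitz (c j) e0 e1 x y (es j)))
  (fun j => cm _ _ (is_derive_heat2 (c j) (s0 j))).
pose F1 w := \sum_(i < m) r * lagprod k i w * A i (lagsum k ^~ w).
pose F2 w := \sum_(i < m) \sum_(j < m)
  (r * lagprod k i w * (r * lagprod k j w) - (i == j :> nat)%:R * lagvar k i)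
  * B i j (lagsum k ^~ w).
have LF1 : L1 P F1 by apply: L1_sum => i _; exact: (first_order_term k i (rA i)).1.
have L2 (i j : 'I_m) := second_order_term k (ltn_ord i) (ltn_ord j) (rB i j).
have LF2 : L1 P F2.
  by apply: L1_sum => i _; apply: L1_sum => j _; exact: (L2 i j).1.
have EF1 : \int[P]_w F1 w = 0.
  rewrite expect_sum; last by move=> i _; exact: (first_order_term k i (rA i)).1.
  by rewrite big1 // => i _; exact: (first_order_term k i (rA i)).2.
have EF2 : `|\int[P]_w F2 w| <= K' * M1 ^+ 3 * (2 * m%:R ^+ 4) * r ^+ 3.
  rewrite expect_sum; last by move=> i _; apply: L1_sum => j _; exact: (L2 i j).1.
  apply: le_trans (ler_norm_sum _ _ _) _.
  apply: (@le_trans _ _ (\sum_(i < m) \sum_(j < m)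
      (2 * K' * m%:R ^+ 2 * M1 ^+ 3 * r ^+ 3))).
    apply: ler_sum => i _; rewrite expect_sum; last by move=> j _; exact: (L2 i j).1.
    apply: le_trans (ler_norm_sum _ _ _) _.
    by apply: ler_sum => j _; exact: (L2 i j).2.
  rewrite !sumr_const card_ord -[in leLHS]mulr_natl -[X in X *+ m]mulr_natl.
  by rewrite le_eqVlt; apply/orP; left; apply/eqP; ring.
have [Lr Er] := third_order_term k.
have Lphi k' : L1 P (lindeberg_fun k').
  exact: L1_bounded (lindeberg_measurable k') (lindeberg_bounded k').
have rem w : `|lindeberg_fun k.+1 w - lindeberg_fun k w - F1 w - F2 w|
    <= K' * rho k w ^+ 3.
  have S0 : 0 <= \sum_(j < m) `|lagprod k j w| by apply: sumr_ge0.
  have rho0 : 0 <= rho k w by rewrite mulr_ge0 // addr_ge0.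
  have [] := Ex (lagsum k ^~ w) (fun j => r * lagprod k j w) (lagvar k)
    (fun j => heat (c j) (smoothing_var k j - lagvar k j)
       (lagsum k j w + r * lagprod k j w)) (rho k w) rho0.
    move=> j jm; apply: heat_expansion => //.
    - by rewrite -smoothing_varS // smoothing_var_ge.
    - exact: lagvar_ge0.
    - rewrite normrM ger0_norm // ler_wpM2l //.
      rewrite (bigD1 (Ordinal jm)) //= addrCA lerDl addr_ge0 //.
      by apply: sumr_ge0.
    - rewrite exprMn ler_wpM2l ?sqr_ge0 //.
      apply: (@le_trans _ _ (M1 * M1)).
        by apply: ler_pM; rewrite ?s2_ge0 ?s2_le.
      by rewrite -expr2 lerXn2r ?nnegrE ?addr_ge0 // lerDl.
  move=> _ _ _ _ h; have PE : lindeberg_fun k.+1 w = \prod_(j < m)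
      heat (c j) (smoothing_var k j - lagvar k j) (lagsum k j w + r * lagprod k j w).
    by apply: eq_bigr => j _; rewrite smoothing_varS // lagsumS.
  by rewrite PE; exact: h.
have Lrem : L1 P (fun w => lindeberg_fun k.+1 w - lindeberg_fun k w - F1 w - F2 w).
  by apply: L1B => //; apply: L1B => //; exact: L1B.
have -> : \int[P]_w lindeberg_fun k.+1 w - \int[P]_w lindeberg_fun k w =
    \int[P]_w F2 w + \int[P]_w
      (lindeberg_fun k.+1 w - lindeberg_fun k w - F1 w - F2 w).
  rewrite expectB //; last by apply: L1B => //; exact: L1B.
  rewrite expectB //; last exact: L1B.
  by rewrite expectB // EF1 subr0 subrKC.
apply: le_trans (ler_normD _ _) _.
have -> : lindeberg_const * r ^+ 3 = K' * M1 ^+ 3 * (2 * m%:R ^+ 4) * r ^+ 3 +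
    K' * (4 ^+ m * (m%:R + 1) * M1 ^+ 3 * r ^+ 3).
  by rewrite /lindeberg_const -/K -/L -/K'; ring.
apply: lerD => //.
have K'0 : 0 <= K' by rewrite exprn_ge0 // mulr_ge0 // (le_trans ler01).
apply: le_trans (expect_abs_le (L1_measurable Lrem) rem (L1Z K' Lr)) _.
by rewrite expectZ // ler_wpM2l.
Qed.

(** Telescoping: at [N] the smoothing retains only the variance [e ^+ 2], while at 0 the sums are
    empty and the smoothing carries the whole variance. *)
Lemma lindeberg_bound :
  `|\int[P]_w (\prod_(j < m) heat (c j) (e ^+ 2) (lagsum N j w)) -
    \prod_(j < m) heat (c j) (e ^+ 2 + \sum_(0 <= t < N) lagvar t j) 0|
  <= N%:R * (lindeberg_const * r ^+ 3).
Proof.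
have step k : (k <= N)%N ->
    `|\int[P]_w lindeberg_fun k w - \int[P]_w lindeberg_fun 0 w|
    <= k%:R * (lindeberg_const * r ^+ 3).
  elim: k => [|k IH] kN; first by rewrite subrr normr0 mul0r.
  rewrite -[X in `|X - _|](subrK (\int[P]_w lindeberg_fun k w)) -addrA.
  apply: le_trans (ler_normD _ _) _.
  rewrite -[k.+1%:R]natr1 mulrDl mul1r [leRHS]addrC; apply: lerD.
    exact: lindeberg_step.
  exact: (IH (ltnW kN)).
have := step N (leqnn N).
have -> : lindeberg_fun 0 =
    fun=> \prod_(j < m) heat (c j) (e ^+ 2 + \sum_(0 <= t < N) lagvar t j) 0.
  apply/funext => w; apply: eq_bigr => j _.
  by rewrite /lagsum big_ord0 mulr0.
rewrite expect_cst (_ : lindeberg_fun N =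
  fun w => \prod_(j < m) heat (c j) (e ^+ 2) (lagsum N j w)) //.
by apply/funext => w; apply: eq_bigr => j _; rewrite /smoothing_var big_geq // addr0.
Qed.

End Lindeberg.

(** * Riemann sums of piecewise Lipschitz functions *)

Section RiemannSums.
Context {R : realType}.
Local Notation mu := (@lebesgue_measure R).
Local Notation I01 := (`]0, 1]%classic : set R).

Definition cell (n t : nat) : set R := `](t.-1)%:R / n%:R, t%:R / n%:R]%classic.

Lemma in_cell n t s : \1_(cell n t) s = ((t.-1)%:R / n%:R < s <= t%:R / n%:R)%R%:R :> R.
Proof. by rewrite indicE mem_setE /= in_itv. Qed.

Lemma sum_cells n k (s : R) : (0 < n)%N -> 0 < s ->
  \sum_(1 <= t < k.+1) \1_(cell n t) s = (s <= k%:R / n%:R)%R%:R :> R.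
Proof.
move=> n0 s0; elim: k => [|k IH].
  by rewrite big_geq // mul0r leNgt s0.
rewrite big_nat_recr //= IH in_cell /=.
have kk : k%:R / n%:R <= k.+1%:R / n%:R :> R.
  by rewrite ler_pM2r ?invr_gt0 ?ltr0n // ler_nat.
case: (leP s (k%:R / n%:R)) => h /=; last by rewrite add0r.
by rewrite addr0 (le_trans h kk).
Qed.

Lemma cell_sub n t : (1 <= t <= n)%N -> cell n t `<=` I01.
Proof.
move=> /andP[t1 tn] x; rewrite /cell /= !in_itv /= => /andP[tx xt].
have n0 : 0 < n%:R :> R by rewrite ltr0n (leq_trans t1).
rewrite (le_lt_trans _ tx) ?divr_ge0 //= (le_trans xt) //.
by rewrite ler_pdivrMr // mul1r ler_nat.
Qed.

Lemma cell_measure n t : (1 <= t <= n)%N -> mu (cell n t) = (n%:R^-1)%:E.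
Proof.
move=> /andP[t1 tn].
have n0 : 0 < n%:R :> R by rewrite ltr0n (leq_trans t1).
rewrite lebesgue_measure_itv /= lte_fin.
case: t t1 tn => //= t _ tn.
rewrite ltr_pM2r ?invr_gt0 // ltr_nat ltnSn -EFinB -mulrBl -natrB //.
by rewrite subSnn mul1r.
Qed.

Definition step_fun (n : nat) (a : nat -> R) (s : R) : R :=
  \sum_(1 <= t < n.+1) a t * \1_(cell n t) s.

Lemma integrable_cell n t a : mu.-integrable I01 (fun s => (a * \1_(cell n t) s)%:E).
Proof.
apply: (@integrableS _ _ _ _ setT) => //.
under eq_fun do rewrite EFinM.
by apply: integrableZl => //; exact: integrable_indic_itv.
Qed.

Lemma integral_step_fun n a : (0 < n)%N ->
  \int[mu]_(s in I01) step_fun n a s = n%:R^-1 * \sum_(1 <= t < n.+1) a t.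
Proof.
move=> n0; rewrite /Rintegral.
under eq_integral do rewrite -sumEFin.
rewrite integral_sum //; last by move=> t; exact: integrable_cell.
rewrite big_nat (eq_bigr (fun t => (a t / n%:R)%:E)); last first.
  move=> t tn.
  under eq_integral do rewrite EFinM.
  rewrite integralZl //; last first.
    by apply: (@integrableS _ _ _ _ setT) => //; exact: integrable_indic_itv.
  rewrite integral_indic //; last exact: measurable_itv.
  rewrite setIidl; last exact: cell_sub.
  by rewrite EFinM; congr (_ * _)%E; exact: cell_measure.
by rewrite -big_nat sumEFin /= -mulr_suml mulrC.
Qed.

Lemma measurable_step_fun n a : measurable_fun setT (step_fun n a).
Proof.
apply: measurable_sum => t; apply: measurable_funM => //.
by apply: measurable_indic; exact: measurable_itv.
Qed.

Lemma step_fun_dist n a s b c : (0 < n)%N -> 0 < s -> s <= 1 ->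
  (forall t, (1 <= t <= n)%N -> (t.-1)%:R / n%:R < s <= t%:R / n%:R ->
    `|a t - b| <= c) -> `|step_fun n a s - b| <= c.
Proof.
move=> n0 s0 s1 h.
have S1 : \sum_(1 <= t < n.+1) \1_(cell n t) s = 1 :> R.
  by rewrite sum_cells // divff ?pnatr_eq0 -?lt0n // s1.
have -> : step_fun n a s - b = \sum_(1 <= t < n.+1) (a t - b) * \1_(cell n t) s.
  rewrite -[in LHS](mulr1 b) -S1 mulr_sumr -sumrB.
  by apply: eq_bigr => t _; rewrite mulrBl.
apply: le_trans (ler_norm_sum _ _ _) _.
rewrite -[c]mulr1 -S1 mulr_sumr big_nat [leRHS]big_nat; apply: ler_sum => t tn.
rewrite normrM in_cell.
case: (boolP ((t.-1)%:R / n%:R < s <= t%:R / n%:R)) => hs /=.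
  by rewrite normr1 !mulr1; exact: h.
by rewrite normr0 !mulr0.
Qed.

(** The array [a] need not sample [F]: it has only to approach [F s] on the cell containing [s].
    This form also covers products of values at lagged points. *)
Lemma riemann_sum (a : nat -> nat -> R) (F : R -> R) (M : R) :
  (forall n t, (1 <= t <= n)%N -> `|a n t| <= M) ->
  measurable_fun I01 F ->
  {ae mu, forall s, I01 s -> forall e, 0 < e -> \forall n \near \oo,
     forall t, (1 <= t <= n)%N -> (t.-1)%:R / n%:R < s <= t%:R / n%:R ->
       `|a n t - F s| <= e} ->
  (fun n => n%:R^-1 * \sum_(1 <= t < n.+1) a n t) @ \oo -->
    \int[mu]_(s in I01) F s.
Proof.
move=> aM mF aF.
(* The shift by one guarantees at least one cell; [cvg_shiftn] removes it at the end. *)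
pose f n s := (step_fun n.+1 (a n.+1) s)%:E.
have M0 : 0 <= M by apply: le_trans (aM 1 1 isT)%N.
have H1 n : measurable_fun I01 (f n).
  by apply/measurable_EFinP; apply: measurable_funTS; exact: measurable_step_fun.
have H2 : measurable_fun I01 (EFin \o F) by exact/measurable_EFinP.
have H3 : {ae mu, forall s, I01 s -> f ^~ s @ \oo --> (EFin \o F) s}.
  move: aF; apply: filterS; first exact: (ae_filter_ringOfSetsType mu).
  move=> s h Is; apply: cvg_EFin; first by near=> n.
  apply/cvgrPdist_le => e e0.
  have [N _ hN] := h Is e e0.
  exists N => // n /= Nn; rewrite distrC; move: Is; rewrite /= in_itv /= => /andP[s0 s1].
  by apply: step_fun_dist => // t tn st; apply: (hN n.+1) => //=; exact: leqW.
have H4 : mu.-integrable I01 (EFin \o (fun=> M)).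
  have fI : (lebesgue_measure I01 < +oo)%E.
    by rewrite lebesgue_measure_itv /= lte_fin ltr01 -EFinB ltry.
  apply: measurable_bounded_integrable => //.
  + exists M; split; first exact: num_real.
    by move=> x Mx s _ /=; rewrite ger0_norm // ltW.
have H5 : {ae mu, forall s n, I01 s -> (`|f n s| <= (EFin \o (fun=> M)) s)%E}.
  apply: aeW => s n; rewrite /= in_itv /= => /andP[s0 s1].
  rewrite lee_fin -[step_fun _ _ _]subr0; apply: step_fun_dist => // t tn _.
  by rewrite subr0; exact: aM.
have [iF _ C] :=
  @dominated_convergence _ _ R mu I01 (measurable_itv _) f _ _ H1 H2 H3 H4 H5.
rewrite -(cvg_shiftn 1).
have : fine (\int[mu]_(x in I01) f n x)%E @[n --> \oo] --> fine (\int[mu]_(x in I01) (F x)%:E)%E.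
  by apply: fine_cvg; rewrite fineK //; exact: integrable_fin_num iF.
apply: cvg_trans; apply: near_eq_cvg; near=> n => /=.
by rewrite addn1 -integral_step_fun.
Unshelve. all: by end_near. Qed.

End RiemannSums.

(** * Continuity and measurability of piecewise Lipschitz functions *)

Section PiecewiseLipschitzTheory.
Context {R : realType}.
Local Notation I01 := (`]0, 1]%classic : set R).

Lemma lipschitz_bound (f : R -> R) (A : set R) : [lipschitz f x | x in A] ->
  exists2 K : R, 0 < K & forall x y, A x -> A y -> `|f x - f y| <= K * `|x - y|.
Proof.
move=> [M [Mr h]]; exists (Num.max M 0 + 1).
  by rewrite ltr_wpDl // le_max lexx orbT.
move=> x y Ax Ay; apply: (h (Num.max M 0 + 1) _ (x, y)) => //.
by rewrite (le_lt_trans (_ : M <= Num.max M 0)) ?le_max ?lexx // ltrDl.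
Qed.

(** The default 0 for an infinite bound merely puts one more point into the finite exceptional
    set. *)
Definition bound_point (b : itv_bound R) : R := if b is BSide _ x then x else 0.

Lemma near_itv (i : interval R) (s : R) : s \in i ->
  s != bound_point i.1 -> s != bound_point i.2 -> \forall u \near s, u \in i.
Proof.
case: i => [[b1 x1|[]] [b2 x2|[]]] //=; rewrite in_itv /=.
- move=> /andP[h1 h2] n1 n2.
  have l1 : x1 < s by move: h1; case: b1 => //=; rewrite lt_neqAle eq_sym n1.
  have l2 : s < x2 by move: h2; case: b2 => //=; rewrite lt_neqAle n2.
  near=> u; rewrite in_itv /=; apply/andP; split.
    suff : x1 < u by case: (b1) => //= /ltW.
    by near: u; exact: lt_nbhsr.
  suff : u < x2 by case: (b2) => //= /ltW.
  by near: u; exact: lt_nbhsl.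
- by rewrite andbF.
- move=> /andP[h1 _] n1 n2.
  have l1 : x1 < s by move: h1; case: b1 => //=; rewrite lt_neqAle eq_sym n1.
  near=> u; rewrite in_itv /= andbT.
  suff : x1 < u by case: (b1) => //= /ltW.
  by near: u; exact: lt_nbhsr.
- move=> h2 n1 n2.
  have l2 : s < x2 by move: h2; case: b2 => //=; rewrite lt_neqAle n2.
  near=> u; rewrite in_itv /=.
  suff : u < x2 by case: (b2) => //= /ltW.
  by near: u; exact: lt_nbhsl.
- by move=> *; near=> u; rewrite in_itv.
Unshelve. all: by end_near. Qed.

Lemma lipschitz_continuous_at (f h : R -> R) (A : set R) K (s : R) :
  (\forall u \near s, A u) -> (forall u, A u -> f u = h u) ->
  (forall x y, A x -> A y -> `|h x - h y| <= K * `|x - y|) -> 0 < K ->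
  {for s, continuous f}.
Proof.
move=> nA fh hK K0; have As : A s := nbhs_singleton nA.
apply/cvgrPdist_le => e e0; near=> u.
have Au : A u by near: u.
rewrite !fh //; apply: le_trans (hK _ _ As Au) _.
rewrite mulrC -ler_pdivlMr //; near: u.
by apply: (@cvgr_dist_le _ _ _ (nbhs s)) => //; rewrite divr_gt0.
Unshelve. all: by end_near. Qed.

(** Away from the endpoints of the pieces, [f] coincides near the point with a single Lipschitz
    function. Measurability comes from the pieces, each continuous on its interval and extended by
    zero. *)
Lemma piecewise_lipschitzP (f : R -> R) : piecewise_lipschitz f ->
  (exists N : set R, finite_set N /\
     forall s, I01 s -> ~ N s -> {for s, continuous f}) /\
  measurable_fun I01 f.
Proof.
move=> [p [p0 [J [fl [tI cI fE lf]]]]].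
have sub01 l : [set` J l] `<=` I01.
  by move=> x xl; rewrite -cI; exists l.
have fl_on l u : u \in J l -> f u = fl l u.
  move=> ul; rewrite fE; last exact: (sub01 l).
  rewrite (bigD1 l) //= big1 ?addr0.
    by rewrite indicE mem_set ?mulr1.
  move=> j jl; rewrite indicE memNset ?mulr0 // => uj.
  move/trivIsetP: tI => /(_ l j I I); rewrite eq_sym jl => /(_ isT).
  by move=> /seteqP[+ _] => /(_ u); apply; split.
split.
  pose N : set R := [set` [seq bound_point (J l).1 | l : 'I_p] ++
    [seq bound_point (J l).2 | l : 'I_p]].
  exists N; split; first exact: finite_seq.
  move=> s; rewrite -cI => -[l _ /= sl] Ns.
  have [K K0 hK] := lipschitz_bound (lf l).
  apply: (lipschitz_continuous_at _ (fl_on l) hK K0) => /=.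
  apply: near_itv => //.
    apply/eqP => sE; apply: Ns; rewrite /N /= mem_cat; apply/orP; left.
    by rewrite sE; apply: map_f; rewrite mem_enum.
  apply/eqP => sE; apply: Ns; rewrite /N /= mem_cat; apply/orP; right.
  by rewrite sE; apply: map_f; rewrite mem_enum.
have mfl l : measurable_fun setT (fl l \_ [set` J l]).
  apply/(measurable_restrictT _ _).1; first exact: measurable_itv.
  apply: subspace_continuous_measurable_fun; first exact: measurable_itv.
  have [K K0 hK] := lipschitz_bound (lf l).
  apply/subspace_continuousP => s Is; apply/cvgrPdist_le => e e0.
  rewrite near_withinE; near=> u => Iu.
  apply: le_trans (hK _ _ Is Iu) _.
  rewrite mulrC -ler_pdivlMr //; near: u.
  by apply: (@cvgr_dist_le _ _ _ (nbhs s)) => //; rewrite divr_gt0.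
apply: (eq_measurable_fun (fun u => \sum_(l < p) (fl l \_ [set` J l]) u)).
  move=> u /[!inE] u01; rewrite fE //; apply: eq_bigr => l _.
  by rewrite patchE indicE; case: ifP => _; rewrite ?mulr1 ?mulr0.
by apply: measurable_funTS; apply: measurable_sum => l.
Unshelve. all: by end_near. Qed.

End PiecewiseLipschitzTheory.

(** * The multivariate normal distribution function *)

Section MultinormalCdf.
Context {R : realType}.
Local Notation mu := (@lebesgue_measure R).

(** The constant [k] is general because each induction step moves the factor of the first coordinate
    into it. *)
Lemma integral_rV_prod (m : nat) (w : 'I_m -> R -> R) (c : 'I_m -> R) (k : R) :
  (forall j t, 0 <= w j t) -> (forall j, measurable_fun setT (w j)) ->
  (forall j, (\int[mu]_t (w j t)%:E = (c j)%:E)%E) -> 0 <= k ->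
  integral_rV (fun y : 'rV[R]_m => (k * \prod_(j < m) w j (y 0 j))%:E) =
  (k * \prod_(j < m) c j)%:E.
Proof.
elim: m w c k => [|m IH] w c k w0 mw wc k0 /=; first by rewrite !big_ord0.
have c0 j : 0 <= c j.
  by rewrite -lee_fin -wc; apply: integral_ge0 => t _; rewrite lee_fin.
transitivity (\int[mu]_t ((k * \prod_(j < m) c (lift ord0 j))%:E * (w ord0 t)%:E))%E.
  apply: eq_integral => t _.
  under [X in integral_rV X]eq_fun => y.
    rewrite big_ord_recl.
    rewrite (_ : row_mx (t%:M : 'rV_1) y 0 ord0 = t); last first.
      have -> : ord0 = lshift m (ord0 : 'I_1) by apply/val_inj.
      by rewrite row_mxEl mxE eqxx mulr1n.
    under eq_bigr => j _.
      rewrite (_ : row_mx (t%:M : 'rV_1) y 0 (lift ord0 j) = y 0 j); last first.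
        have -> : lift ord0 j = rshift 1 j by apply/val_inj.
        by rewrite row_mxEr.
      over.
    rewrite mulrA.
    over.
  rewrite (IH (fun j => w (lift ord0 j)) (fun j => c (lift ord0 j))) //.
    by rewrite -EFinM mulrAC.
  by rewrite mulr_ge0.
rewrite ge0_integralZl //.
- transitivity ((k * \prod_(j < m) c (lift ord0 j))%:E * (c ord0)%:E)%E.
    by congr (_ * _)%E; exact: wc.
  by rewrite -EFinM big_ord_recl mulrA mulrAC.
- by apply/measurable_EFinP; exact: mw.
- by move=> t _; rewrite lee_fin.
- by rewrite lee_fin mulr_ge0 // prodr_ge0.
Qed.

Lemma integral_scaled_npdf (q x : R) : 0 < q ->
  (\int[mu]_(t in `]-oo, x]) (npdf (t / q) / q)%:E = (ncdf (x / q))%:E)%E.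
Proof.
move=> q0; rewrite /ncdf /Rintegral fineK; last first.
  exact: integrable_fin_num (integrable_npdf (measurable_itv _)).
pose F : R -> R := fun t => t / q.
have dF t : is_derive t (1 : R) F q^-1.
  by apply: is_derive_eq; rewrite /GRing.scale /=; ring.
have F'E : F^`()%classic = cst q^-1.
  by apply/funext => t; rewrite derive1E; case: (dF t).
rewrite -[x / q]/(F x) (@increasing_ge0_integration_by_substitutionNy _ F npdf x).
- by apply: eq_integral => t _; rewrite !fctE F'E.
- by move=> a b _ _ ab; rewrite /F ltr_pM2r ?invr_gt0.
- by rewrite F'E => ? _; exact: cvg_cst.
- by rewrite F'E; exact: is_cvg_cst.
- by rewrite F'E; exact: cvg_cst.
- split; first by move=> t _; case: (dF t).
  apply: cvg_at_left_filter; apply/differentiable_continuous/derivable1_diffP.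
  by case: (dF x).
- apply/gt0_cvgMlNy; last exact: cvg_id.
  by rewrite invr_gt0.
- by apply: continuous_subspaceT; exact: continuous_normal_pdf.
- by move=> t _; exact: npdf_ge0.
Qed.

Lemma multinormal_pdf_scalar (m : nat) (z : R) (y : 'rV[R]_m) : 0 < z ->
  multinormal_pdf 0 z%:M y =
  \prod_(j < m) (npdf (y 0 j / Num.sqrt z) / Num.sqrt z).
Proof.
move=> z0; have q0 : 0 < Num.sqrt z by rewrite sqrtr_gt0.
rewrite /multinormal_pdf subr0 invmx_scalar mul_mx_scalar -scalemxAl det_scalar.
have -> : (z^-1 *: (y *m y^T)) 0 0 = \sum_(j < m) y 0 j ^+ 2 / z.
  rewrite !mxE mulr_sumr; apply: eq_bigr => j _.
  by rewrite !mxE mulrC -expr2.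
have -> : - (\sum_(j < m) y 0 j ^+ 2 / z) / 2 =
    \sum_(j < m) (- ((y 0 j / Num.sqrt z) ^+ 2) / 2).
  rewrite -sumrN mulr_suml; apply: eq_bigr => j _.
  by rewrite exprMn exprVn sqr_sqrtr // ltW.
have sX (a : R) n : 0 <= a -> Num.sqrt (a ^+ n) = Num.sqrt a ^+ n.
  by move=> a0; elim: n => [|n IH]; rewrite ?expr0 ?sqrtr1 // !exprS sqrtrM // IH.
have p0 : 0 <= 2 * pi * z by rewrite !mulr_ge0 ?pi_ge0 // ltW.
rewrite expR_sum -exprMn sX // -exprVn.
rewrite -[X in _ ^+ X]card_ord -prodr_const -big_split /=.
apply: eq_bigr => j _; rewrite npdfE /normal_peak expr1n mul1r.
rewrite (_ : pi *+ 2 = 2 * pi); last by rewrite mulr_natl.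
rewrite sqrtrM ?mulr_ge0 ?pi_ge0 // [in LHS]invfM.
by rewrite mulrA [in LHS](mulrC (expR _)).
Qed.

Lemma multinormal_cdf_scalar (m : nat) (z : R) (x : 'rV[R]_m) : 0 < z ->
  multinormal_cdf 0 z%:M x = \prod_(j < m) ncdf (x 0 j / Num.sqrt z).
Proof.
move=> z0; have q0 : 0 < Num.sqrt z by rewrite sqrtr_gt0.
(* The indicator of the orthant is distributed over the coordinates, which makes the integrand a
   product. *)
pose w (j : 'I_m) t := (t <= x 0 j)%R%:R * (npdf (t / Num.sqrt z) / Num.sqrt z).
have mpdf : measurable_fun setT (fun t : R => npdf (t / Num.sqrt z) / Num.sqrt z).
  apply: measurable_funM => //; apply: measurableT_comp; last exact: measurable_funM.
  exact: measurable_normal_pdf.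
have wE j t : w j t = ((fun t => npdf (t / Num.sqrt z) / Num.sqrt z) \_ `]-oo, x 0 j]) t.
  rewrite patchE mem_setE /= in_itv /= /w.
  by case: (t <= x 0 j); rewrite ?mul1r ?mul0r.
have w0 j t : 0 <= w j t by rewrite /w !mulr_ge0 // ?npdf_ge0 // invr_ge0 ltW.
have mw j : measurable_fun setT (w j).
  have -> : w j = (fun t => npdf (t / Num.sqrt z) / Num.sqrt z) \_ `]-oo, x 0 j].
    by apply/funext => t; exact: wE.
  apply/(measurable_restrictT _ _).1; first exact: measurable_itv.
  exact: measurable_funTS.
have iw j : (\int[mu]_t (w j t)%:E = (ncdf (x 0 j / Num.sqrt z))%:E)%E.
  rewrite -integral_scaled_npdf // [RHS]integral_mkcond.
  by apply: eq_integral => t _; rewrite /w patchE mem_setE /= in_itv /=;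
    case: (t <= x 0 j); rewrite ?mul1r ?mul0r.
have := integral_rV_prod w0 mw iw ler01; rewrite mul1r.
rewrite /multinormal_cdf => /(congr1 fine) /= <-; congr (fine (integral_rV _)).
apply/funext => y; rewrite mul1r; congr EFin.
case: ifPn => [/forallP yx|/forallPn [j yxj]].
  rewrite multinormal_pdf_scalar //; apply: eq_bigr => j _.
  by rewrite /w yx mul1r.
by rewrite (bigD1 j) //= /w (negbTE yxj) !mul0r.
Qed.

End MultinormalCdf.

(** * Powers of censored returns *)

Section IndependentComposition.
Context {R : realType} {d : measure_display} {T : measurableType d}.
Variable P : probability T R.

Lemma independent_family_comp (dZ dY : measure_display) (TZ : measurableType dZ)
    (TY : measurableType dY) (D : set nat) (Z : nat -> T -> TZ) (Y : nat -> T -> TY)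
    (F : nat -> TZ -> TY) (c : TY) :
  independent_family P D Z -> (forall i, D i -> measurable_fun setT (F i)) ->
  (forall i w, D i -> Y i w = F i (Z i w)) -> (forall i w, ~ D i -> Y i w = c) ->
  independent_family P setT Y.
Proof.
move=> iZ mF YF Yc J B _ mB.
have PT : P setT = 1%E := probability_setT P.
have nD i : ~ D i -> Y i @^-1` B i = if `[< B i c >] then setT else set0.
  move=> Di; apply/seteqP; split => w /=; rewrite (Yc i w Di).
    by move=> /asboolP ->.
  by case: ifPn => // /asboolP.
have [[i iJ [nDi nBi]]|hJ] := pselect (exists2 i, i \in J & ~ D i /\ ~ B i c).
  have Yi0 : Y i @^-1` B i = set0 by rewrite nD //; case: ifPn => // /asboolP.
  rewrite (big_fsetD1 i) //= Yi0 measure0 mul0e.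
  suff -> : \bigcap_(j in [set` J]) (Y j @^-1` B j) = set0 by rewrite measure0.
  by apply/seteqP; split => // w /(_ i iJ); rewrite Yi0.
have YT i : i \in J -> ~ D i -> Y i @^-1` B i = setT.
  move=> iJ Di; rewrite nD //; case: ifPn => // /asboolP nB.
  by case: hJ; exists i.
pose J1 := [fset i in J | `[< D i >]]%fset.
have J1P i : (i \in J1) = (i \in J) && `[< D i >] by rewrite !inE.
have -> : \bigcap_(j in [set` J]) (Y j @^-1` B j) =
    \bigcap_(j in [set` J1]) (Z j @^-1` (F j @^-1` B j)).
  apply/seteqP; split => [w h j /=|w h j /= jJ].
    by rewrite J1P => /andP[jJ /asboolP Dj]; have := h j jJ; rewrite /= YF.
  have [Dj|nDj] := pselect (D j); last first.
    by have : (Y j @^-1` B j) w by rewrite YT.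
  rewrite YF //; apply: (h j); rewrite /= J1P jJ; exact/asboolP.
rewrite iZ.
- rewrite -big_fset_condE /= big_mkcond /=; apply: eq_big_seq => i iJ.
  case: ifPn => /asboolP Di; last by rewrite YT.
  by congr (P _); apply/seteqP; split => w /=; rewrite YF.
- by move=> i /=; rewrite J1P => /andP[_ /asboolP].
- move=> i; rewrite J1P => /andP[iJ /asboolP Di].
  by rewrite -[_ @^-1` _]setTI; exact: (mF i Di measurableT _ (mB i iJ)).
Qed.

End IndependentComposition.

(** * Conditional expectations depend only on the conditional law *)

Section ConditionalLaw.
Context {R : realType}.
Local Open Scope ereal_scope.

(** The joint law of the pair, divided by the probability of the conditioning event, is a measure on
    the fixed space of pairs. Conditioning becomes integration over the half [D] where the second
    component is true, and on subsets of [D] this measure is the conditional law of a section.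
    Variables from different probability spaces are compared there. *)
Lemma cond_expectation_law d d' (T : measurableType d) (T' : measurableType d')
    (P : probability T R) (P' : probability T' R)
    (eta : {RV P >-> R}) (eta' : {RV P' >-> R})
    (a : {RV P >-> bool}) (a' : {RV P' >-> bool}) (f : R -> R) :
  (forall B : set R, measurable B ->
     cond_distribution P (a @^-1` [set true]) eta B =
     cond_distribution P' (a' @^-1` [set true]) eta' B) ->
  measurable_fun setT f -> (forall x, 0 <= f x)%R ->
  cond_expectation P (a @^-1` [set true]) (f \o eta) =
  cond_expectation P' (a' @^-1` [set true]) (f \o eta').
Proof.
move=> law mf f0.
pose TT : measurableType _ := (R * bool)%type.
pose D : set TT := [set z | z.2 = true].
have mD : measurable D.
  rewrite (_ : D = setT `&` snd @^-1` [set true]).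
    by apply: measurable_snd.
  by rewrite setTI.
pose F : TT -> \bar R := fun z => (f z.1)%:E.
have mF : measurable_fun D F.
  apply: measurable_funTS; apply/measurable_EFinP.
  exact: measurableT_comp mf measurable_fst.
have law_of : forall d1 (T1 : measurableType d1) (Q : probability T1 R)
    (et : {RV Q >-> R}) (b : {RV Q >-> bool}),
    exists2 nu : {measure set TT -> \bar R},
      (cond_expectation Q (b @^-1` [set true]) (f \o et) = \int[nu]_(z in D) F z)
      & forall C, measurable C -> C `<=` D ->
        nu C = (cond_distribution Q (b @^-1` [set true]) et (ysection C true))%:E.
  move=> d1 T1 Q et b.
  have mA : measurable (b @^-1` [set true]) by exact: measurable_funPTI.
  have mZ : measurable_fun setT (fun w => (et w, b w) : TT).
    exact: measurable_fun_pair.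
  pose Z : {mfun T1 >-> TT} := mfun_Sub (mem_set mZ).
  have c0 : (0 <= (fine (Q (b @^-1` [set true])))^-1)%R by rewrite invr_ge0 fine_ge0.
  exists (mscale (NngNum c0) (distribution Q Z)).
    rewrite ge0_integral_mscale //; last by move=> z _; rewrite lee_fin.
    rewrite ge0_integral_pushforward //; last by move=> z _; rewrite lee_fin.
  move=> C mC CD; rewrite /mscale /cond_distribution /= mulrC EFinM; congr (_ * _).
  have QE : pushforward Q Z C = Q (et @^-1` ysection C true `&` b @^-1` [set true]).
    rewrite /pushforward; congr (Q _); apply/seteqP; split => w /=.
      move=> Cw; have aw := CD _ Cw; rewrite /D /= in aw.
      by split => //; rewrite /ysection /= inE -aw.
    by rewrite /ysection /= inE => -[+ aw]; rewrite -[in X in X -> _]aw.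
  rewrite fineK; first exact: QE.
  rewrite fin_num_measure //; apply: measurableI => //.
  by apply: measurable_funPTI; exact: measurable_ysection.
have [nu -> nuE] := law_of _ _ _ eta a.
have [nu' -> nuE'] := law_of _ _ _ eta' a'.
apply: eq_measure_integral => C mC CD.
by rewrite nuE // nuE' // law //; exact: measurable_ysection.
Qed.

End ConditionalLaw.

(** * Moments of the censored and centred powers *)

Section CensoredMoments.
Context {d : measure_display} {T : measurableType d} {R : realType}.
Variables (P : probability T R) (eta : {RV P >-> R}) (a : {RV P >-> bool}).
Variable p : R.
Hypothesis Pa : P (a @^-1` [set true]) = p%:E.
Hypothesis p0 : 0 < p.

Let A := a @^-1` [set true].

Let mA : measurable A. Proof. exact: measurable_funPTI. Qed.

Let aE w : (a w)%:R = \1_A w :> R.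
Proof.
rewrite indicE; congr (_ %:R); congr nat_of_bool.
by apply/idP/idP => [aw|]; rewrite inE.
Qed.

Lemma censored_moment (f : R -> R) (c : R) : measurable_fun setT f ->
  (forall x, 0 <= f x) -> cond_expectation P A (f \o eta) = c%:E ->
  L1 P (fun w => (a w)%:R * f (eta w)) /\
  \int[P]_w ((a w)%:R * f (eta w)) = p * c.
Proof.
move=> mf f0; rewrite /cond_expectation -/A Pa /= => EI.
have mfe : measurable_fun setT (f \o eta) by exact: measurableT_comp.
have mU : measurable_fun setT (fun w => (a w)%:R * f (eta w)).
  apply: measurable_funM => //; rewrite (_ : (fun w => (a w)%:R) = \1_A).
    exact: measurable_indic.
  by apply/funext => w; exact: aE.
have IE : (\int[P]_w ((a w)%:R * f (eta w))%:E = (p * c)%:E)%E.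
  transitivity (\int[P]_(w in A) (f (eta w))%:E)%E.
    rewrite [RHS]integral_mkcond; apply: eq_integral => w _.
    by rewrite patchE aE indicE; case: ifP => _; rewrite ?mul1r ?mul0r.
  move: EI; set I := (\int[P]_(w in A) _)%E.
  have : (0 <= I)%E by apply: integral_ge0 => w _; rewrite lee_fin.
  (* An infinite integral is excluded: divided by [p > 0] it would stay infinite, whereas the
     conditional expectation is the real number [c]. *)
  case: I => [x _ [<-]| |//].
    by rewrite mulrA divff ?mul1r // gt_eqF.
  by rewrite mulry gtr0_sg ?invr_gt0 // mul1e.
split; last by rewrite /Rintegral IE.
apply/integrableP; split; first exact/measurable_EFinP.
under eq_integral do rewrite /= ger0_norm ?mulr_ge0 ?ler0n //.
by rewrite IE ltry.
Qed.

Lemma censored_prob : L1 P (fun w => (a w)%:R) /\ \int[P]_w (a w)%:R = p.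
Proof.
have [|||L E] := @censored_moment (fun=> 1) 1 => //.
  rewrite /cond_expectation -/A Pa /= integral_cst // mul1e.
  by rewrite [X in (_ * X)%E](_ : _ = p%:E) // -EFinM mulVf // gt_eqF.
have aM : (fun w => (a w)%:R * 1) = (fun w => (a w)%:R : R).
  by apply/funext => w; rewrite mulr1.
by rewrite aM mulr1 in L E.
Qed.

Section PowerMoments.
Variables (delta m1 m2 : R).
Hypothesis delta_gt0 : 0 < delta.
Hypothesis Em1 : cond_expectation P A (fun w => `|eta w| `^ delta) = m1%:E.
Hypothesis Em2 : cond_expectation P A (fun w => `|eta w| `^ (2 * delta)) = m2%:E.

Lemma measurable_abs_powR (q : R) : measurable_fun setT (fun x : R => `|x| `^ q).
Proof. by apply: (measurableT_comp (measurable_powR q)). Qed.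

Let powR_ge0' q (x : R) : 0 <= `|x| `^ q. Proof. exact: powR_ge0. Qed.

Let M1 := censored_moment (measurable_abs_powR delta) (powR_ge0' delta) Em1.
Let M2 := censored_moment (measurable_abs_powR (2 * delta)) (powR_ge0' _) Em2.

Lemma power_moment_ge0 : 0 <= m1.
Proof.
rewrite -(pmulr_rge0 _ p0) -M1.2; apply: Rintegral_ge0 => w _.
by rewrite mulr_ge0 ?ler0n ?powR_ge0.
Qed.

(** Nonnegativity of the conditional variance: the difference, times [p], is the integral of the
    square of |eta|^delta - m1 over the event that [a] is true. *)
Lemma power_moment_sqr_le : m1 ^+ 2 <= m2.
Proof.
have [L1p E1] := M1; have [L2 E2] := M2; have [L0 E0] := censored_prob.
rewrite -(ler_pM2l p0) -subr_ge0.
have -> : p * m2 - p * m1 ^+ 2 = \int[P]_w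
    ((a w)%:R * `|eta w| `^ (2 * delta) -
     (2 * m1 * ((a w)%:R * `|eta w| `^ delta) - m1 ^+ 2 * (a w)%:R)).
  rewrite expectB //; last by apply: L1B; exact: L1Z.
  rewrite expectB; [|exact: L1Z..].
  by rewrite !expectZ // E1 E2 E0; ring.
apply: Rintegral_ge0 => w _.
have -> : `|eta w| `^ (2 * delta) = (`|eta w| `^ delta) ^+ 2.
  by rewrite mulrC powRrM (powR_mulrn 2) // powR_ge0.
set x := _ `^ _; have := sqr_ge0 (x - m1); case: (a w) => /= h.
  by apply: le_trans h _; rewrite le_eqVlt; apply/orP; left; apply/eqP; ring.
by rewrite !mul0r !mulr0 !subrr.
Qed.

(** If [m2] were 0, then [eta] would vanish almost surely where [a] is true, against the conditional
    second moment 1. *)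
Lemma power_moment_gt0 : cond_expectation P A (fun w => eta w ^+ 2) = 1%E -> 0 < m2.
Proof.
move=> V.
have msq : measurable_fun setT (fun x : R => x ^+ 2) by exact: measurable_funX.
have [LV EV] := @censored_moment (fun x => x ^+ 2) 1 msq (fun x => sqr_ge0 x) V.
have [L2 E2] := M2.
rewrite lt_neqAle (le_trans (sqr_ge0 m1) power_moment_sqr_le) andbT.
apply/eqP => m20; move: E2; rewrite -m20 mulr0 => E2.
have I2 : (\int[P]_(w in setT) `|((a w)%:R * `|eta w| `^ (2 * delta))%:E| = 0)%E.
  have fI := integrable_fin_num measurableT L2.
  transitivity (\int[P]_w ((a w)%:R * `|eta w| `^ (2 * delta))%:E)%E.
    by apply: eq_integral => w _ /=; rewrite ger0_norm // mulr_ge0 ?powR_ge0.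
  by rewrite -[LHS]fineK //; congr EFin; exact: E2.
have mf : measurable_fun setT (fun w => ((a w)%:R * `|eta w| `^ (2 * delta))%:E).
  exact: measurable_int L2.
have mg : measurable_fun setT (fun w => ((a w)%:R * eta w ^+ 2)%:E).
  exact: measurable_int LV.
have ae0 := (ae_eq_integral_abs P measurableT mf).1 I2.
have ae1 : ae_eq P setT (fun w => ((a w)%:R * eta w ^+ 2)%:E) (cst 0%E).
  move: ae0; apply: filterS => w /= /(_ I) [] /eqP; rewrite mulf_eq0 => /orP[/eqP -> _|/eqP /powR_eq0_eq0 /eqP].
    by rewrite mul0r.
  by rewrite normr_eq0 => /eqP -> _; rewrite expr0n mulr0.
have I1 := (ae_eq_integral_abs P measurableT mg).2 ae1.
have : p = 0.
  rewrite -[p]mulr1 -EV /Rintegral -[RHS]/(fine 0%E) -I1; congr fine.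
  by apply: eq_integral => w _; rewrite /= ger0_norm // mulr_ge0 // sqr_ge0.
by apply/eqP; rewrite gt_eqF.
Qed.

End PowerMoments.

Section CenteredMoments.
Variables (delta sigma m1 m2 m4 : R).
Hypothesis delta_gt0 : 0 < delta.
Hypothesis sigma_gt0 : 0 < sigma.
Hypothesis Em1 : cond_expectation P A (fun w => `|eta w| `^ delta) = m1%:E.
Hypothesis Em2 : cond_expectation P A (fun w => `|eta w| `^ (2 * delta)) = m2%:E.
Hypothesis Em4 : cond_expectation P A (fun w => `|eta w| `^ (4 * delta)) = m4%:E.

Let W w := `|(a w)%:R * (sigma * eta w)| `^ delta.
Let mean := sigma `^ delta * (p * m1).
Let Y w := W w - mean.

Lemma measurable_censored_power : measurable_fun setT W.
Proof.
apply: (measurableT_comp (measurable_abs_powR delta)).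
apply: measurable_funM; last exact: measurable_funM.
rewrite (_ : (fun w => (a w)%:R) = \1_A); first exact: measurable_indic.
by apply/funext => w; exact: aE.
Qed.

(** Powers leave the indicator [a] unchanged only for a positive exponent, hence [k.+1]; where [a]
    is false, [0 < delta] gives 0 on both sides. *)
Let W_pow k w : W w ^+ k.+1 =
  sigma `^ (k.+1%:R * delta) * ((a w)%:R * `|eta w| `^ (k.+1%:R * delta)).
Proof.
have pw (x : R) : 0 <= x -> x `^ (k.+1%:R * delta) = (x `^ delta) ^+ k.+1.
  by move=> x0; rewrite mulrC powRrM powR_mulrn // powR_ge0.
rewrite !pw // ?ltW // /W; case: (a w) => /=.
  by rewrite !mul1r normrM gtr0_norm // powRM ?exprMn // ltW.
by rewrite !mul0r normr0 powR0 ?gt_eqF // expr0n mulr0.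
Qed.

Let W_moment k c :
  cond_expectation P A (fun w => `|eta w| `^ (k.+1%:R * delta)) = c%:E ->
  L1 P (fun w => W w ^+ k.+1) /\
  \int[P]_w (W w ^+ k.+1) = sigma `^ (k.+1%:R * delta) * (p * c).
Proof.
move=> Ec.
have [L E] := @censored_moment (fun x => `|x| `^ (k.+1%:R * delta)) _
  (measurable_abs_powR _) (fun x => powR_ge0 _ _) Ec.
have -> : (fun w => W w ^+ k.+1) = fun w =>
    sigma `^ (k.+1%:R * delta) * ((a w)%:R * `|eta w| `^ (k.+1%:R * delta)).
  by apply/funext => w; exact: W_pow.
by split; [exact: L1Z|rewrite expectZ // E].
Qed.

Lemma censored_power_mean : L1 P W /\ \int[P]_w W w = mean.
Proof.
by have := @W_moment 0 m1; rewrite mul1r => /(_ Em1).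
Qed.

Lemma centered_power_mean : \int[P]_w Y w = 0.
Proof.
have [L E] := censored_power_mean.
by rewrite expectB // ?E ?expect_cst ?subrr //; exact: L1_cst.
Qed.

Lemma centered_power_var : \int[P]_w (Y w ^+ 2) =
  sigma `^ (2 * delta) * (m2 * p - m1 ^+ 2 * p ^+ 2).
Proof.
have [L E] := censored_power_mean; have [L2 E2] := @W_moment 1 m2 Em2.
have -> : (fun w => Y w ^+ 2) = fun w => W w ^+ 2 - (2 * mean * W w - mean ^+ 2).
  by apply/funext => w; rewrite /Y; ring.
rewrite expectB //; last by apply: L1B; [exact: L1Z|exact: L1_cst].
rewrite expectB; [|exact: L1Z|exact: L1_cst].
rewrite E2 expectZ // E expect_cst /mean.
rewrite (mulrC 2 delta) powRrM (powR_mulrn 2) ?powR_ge0 //; ring.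
Qed.

Lemma centered_power_fourth : L1 P (fun w => Y w ^+ 4) /\
  \int[P]_w (Y w ^+ 4) <= 8 * (sigma `^ (4 * delta) * (p * m4) + mean ^+ 4).
Proof.
have [L4 E4] := @W_moment 3 m4 Em4.
have pow4 (x y : R) : (x - y) ^+ 4 <= 8 * (x ^+ 4 + y ^+ 4).
  have h1 := sqr_ge0 (x + y); have h2 := sqr_ge0 (x ^+ 2 - y ^+ 2).
  have h3 : ((x - y) ^+ 2) ^+ 2 <= (2 * (x ^+ 2 + y ^+ 2)) ^+ 2.
    apply: lerXn2r; rewrite ?nnegrE ?sqr_ge0 ?mulr_ge0 ?addr_ge0 ?sqr_ge0 //.
    by nra.
  have -> : (x - y) ^+ 4 = ((x - y) ^+ 2) ^+ 2 by rewrite -exprM.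
  by apply: le_trans h3 _; nra.
have LB : L1 P (fun w => 8 * (W w ^+ 4 + mean ^+ 4)).
  by apply/L1Z/L1D => //; exact: L1_cst.
have even4 (x : R) : 0 <= x ^+ 4 by rewrite -[4%N]/(2 * 2)%N exprM sqr_ge0.
have LY : L1 P (fun w => Y w ^+ 4).
  apply: L1_le LB; last by move=> w; rewrite ger0_norm // /Y pow4.
  by apply: measurable_funX; apply: measurable_funB => //; exact: measurable_censored_power.
split => //; apply: le_trans (expect_le LY LB (fun w => pow4 _ _)) _.
rewrite expectZ; last by apply: L1D => //; exact: L1_cst.
by rewrite expectD // ?E4 ?expect_cst //; exact: L1_cst.
Qed.

End CenteredMoments.

End CensoredMoments.

(** * Self-normalized sums *)

(** Inversion is continuous away from 0, and the singleton 0 is treated apart. *)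
Lemma measurable_invr (R : realType) : measurable_fun setT (@GRing.inv R).
Proof.
have o0 : open (~` [set 0 : R]).
  by rewrite openC; exact/accessible_closed_set1/hausdorff_accessible/Rhausdorff.
rewrite -(setvU [set 0 : R]); apply/measurable_funU => //.
  exact: open_measurable.
split.
  apply: open_continuous_measurable_fun => // x /[!inE] /= x0.
  by apply: inv_continuous; exact/eqP.
exact: measurable_fun_set1.
Qed.

Section ProbabilityBounds.
Context {d : measure_display} {T : measurableType d} {R : realType}.
Variable P : probability T R.

Lemma L1_indic (B : set T) : measurable B -> L1 P (\1_B : T -> R).
Proof. by move=> mB; exact: integrable_indic. Qed.

Lemma expect_indic (B : set T) : measurable B -> \int[P]_w (\1_B w : R) = fine (P B).
Proof. by move=> mB; rewrite /Rintegral integral_indic // setIT. Qed.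

Lemma measurable_set_ltr (f g : T -> R) : measurable_fun setT f ->
  measurable_fun setT g -> measurable [set w | f w < g w].
Proof.
move=> mf mg; rewrite -[X in measurable X]setTI.
exact: (measurable_fun_ltr mf mg measurableT (Y := [set true])).
Qed.

Lemma measurable_set_ler (f g : T -> R) : measurable_fun setT f ->
  measurable_fun setT g -> measurable [set w | f w <= g w].
Proof.
move=> mf mg; rewrite -[X in measurable X]setTI.
exact: (measurable_fun_ler mf mg measurableT (Y := [set true])).
Qed.

Lemma indicE_if (B : set T) w : (\1_B w : R) = if `[< B w >] then 1 else 0.
Proof.
rewrite indicE; case: ifPn => [/asboolP Bw|/asboolP Bw].
  by rewrite mem_set.
by rewrite memNset.
Qed.

Lemma chebyshev_real (X : T -> R) (eps : R) : measurable_fun setT X ->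
  L1 P (fun w => X w ^+ 2) -> 0 < eps ->
  eps ^+ 2 * fine (P [set w | eps < `|X w|]) <= \int[P]_w (X w ^+ 2).
Proof.
move=> mX LX e0.
have mB : measurable [set w | eps < `|X w|].
  by apply: measurable_set_ltr => //; exact: measurableT_comp.
rewrite -expect_indic // -expectZ; last exact: L1_indic.
apply: expect_le => //; first exact/L1Z/L1_indic.
move=> w; rewrite indicE_if; case: ifPn => [/asboolP /= h|_].
  by rewrite mulr1 -[leRHS]real_normK ?num_real // lerXn2r ?nnegrE // ltW.
by rewrite mulr0 sqr_ge0.
Qed.

End ProbabilityBounds.

(** * Concentration of the sum of squares *)

Section QuadraticVariation.
Context {d : measure_display} {T : measurableType d} {R : realType}.
Variables (P : probability T R) (Y : nat -> T -> R) (s2 : nat -> R) (M : R).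
Hypothesis mY : forall t, measurable_fun setT (Y t).
Hypothesis indepY : independent_family P setT Y.
Hypothesis EY2 : forall t, \int[P]_w (Y t w ^+ 2) = s2 t.
Hypothesis LY4 : forall t, L1 P (fun w => Y t w ^+ 4).
Hypothesis EY4 : forall t, \int[P]_w (Y t w ^+ 4) <= M.

Let Q t w := Y t w ^+ 2 - s2 t.

Let LQ t : L1 P (Q t).
Proof. by apply: L1B; [exact: (LY2 mY LY4)|exact: L1_cst]. Qed.

Let EQ t : \int[P]_w Q t w = 0.
Proof. by rewrite expectB ?EY2 ?expect_cst ?subrr //; [exact: (LY2 mY LY4)|exact: L1_cst]. Qed.

Let mQ t : measurable_fun setT (Q t).
Proof. by apply: measurable_funB => //; exact: measurable_funX. Qed.

Let Q2E t : (fun w => Q t w * Q t w) = fun w =>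
  Y t w ^+ 4 - (2 * s2 t * Y t w ^+ 2 - s2 t ^+ 2).
Proof. by apply/funext => w; rewrite /Q; ring. Qed.

Let LQ2 t : L1 P (fun w => Q t w * Q t w) /\ \int[P]_w (Q t w * Q t w) <= M.
Proof.
have LYt := LY2 mY LY4 t; have h := EY4 t.
have LB : L1 P (fun w => 2 * s2 t * Y t w ^+ 2 - s2 t ^+ 2).
  by apply: L1B; [exact: L1Z|exact: L1_cst].
rewrite Q2E; split; first exact: L1B.
rewrite expectB // expectB; [|exact: L1Z|exact: L1_cst].
by rewrite expectZ // EY2 expect_cst; have := sqr_ge0 (s2 t); nra.
Qed.

Let LQQ t u : L1 P (fun w => Q t w * Q u w) /\
  \int[P]_w (Q t w * Q u w) <= (t == u)%:R * M.
Proof.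
case: (eqVneq t u) => [<-|]; first by rewrite mul1r; exact: LQ2.
wlog tu : t u / (t < u)%N => [H tu|_].
  case: (ltngtP t u) => [|ut|E]; first by move/H; apply.
    have [L E] := H u t ut (negbT (ltn_eqF ut)).
    have -> : (fun w => Q t w * Q u w) = fun w => Q u w * Q t w.
      by apply/funext => w; rewrite mulrC.
    by split.
  by rewrite E eqxx in tu.
have mQs (D : set nat) i : D i ->
    measurable_fun (setT : set (sub_sigma Y D)) (Q i).
  move=> Di; apply: measurable_funB => //.
  by apply: measurable_funX; exact: measurable_gen.
have [L E] := expect_indep mY indepY (past_future_disjoint u)
  (mQs [set k | (k < u)%N] t tu) (mQs [set k | (u <= k)%N] u (leqnn u)) (LQ t) (LQ u).
by split => //; rewrite E EQ mul0r mul0r.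
Qed.

(** The centred squares [Q t] are independent, so only the diagonal survives, and each variance is
    at most the fourth moment of [Y t]. *)
Lemma quadratic_variation_var N :
  L1 P (fun w => (\sum_(t < N) Q t w) ^+ 2) /\
  \int[P]_w ((\sum_(t < N) Q t w) ^+ 2) <= N%:R * M.
Proof.
have -> : (fun w => (\sum_(t < N) Q t w) ^+ 2) =
    fun w => \sum_(t < N) \sum_(u < N) Q t w * Q u w.
  apply/funext => w; rewrite expr2 mulr_suml; apply: eq_bigr => t _.
  by rewrite mulr_sumr.
split; first by apply: L1_sum => t _; apply: L1_sum => u _; exact: (LQQ t u).1.
rewrite expect_sum; last by move=> t _; apply: L1_sum => u _; exact: (LQQ t u).1.
apply: (@le_trans _ _ (\sum_(t < N) M)); last by rewrite sumr_const card_ord mulr_natl.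
apply: ler_sum => t _; rewrite expect_sum; last by move=> u _; exact: (LQQ t u).1.
apply: (@le_trans _ _ (\sum_(u < N) (t == u)%:R * M)).
  by apply: ler_sum => u _; exact: (LQQ t u).2.
rewrite (bigD1 t) //= eqxx mul1r big1 ?addr0 // => u ut.
by rewrite eq_sym (negbTE ut) mul0r.
Qed.

Lemma measurable_quadratic_variation N :
  measurable_fun setT (fun w => \sum_(t < N) Q t w).
Proof. by apply: measurable_sum => t. Qed.

Lemma quadratic_variation_tail N (eps : R) : 0 < eps ->
  eps ^+ 2 * fine (P [set w | eps < `|\sum_(t < N) (Y t w ^+ 2 - s2 t)|]) <= N%:R * M.
Proof.
move=> e0; have [L E] := quadratic_variation_var N.
exact: le_trans (chebyshev_real (measurable_quadratic_variation N) L e0) E.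
Qed.

End QuadraticVariation.

(** * Comparison of the self-normalized event with smoothed orthants *)

Section Sandwich.
Context {d : measure_display} {T : measurableType d} {R : realType}.
Variables (P : probability T R) (m : nat) (S : nat -> T -> R) (D : T -> R).
Variables (x : nat -> R) (G k : R).
Hypothesis mS : forall j, measurable_fun setT (S j).
Hypothesis mD : measurable_fun setT D.
Hypotheses (k0 : 0 < k) (kG : k < G).

(** The standard deviation of the smoothing. A margin of [k] amounts to [k^-1] standard deviations,
    so its error vanishes together with [k]. *)
Let q := k ^+ 2.
Let Ev := [set w | forall j, (j < m)%N -> S j w / D w <= x j].
Let Bad := [set w | k < `|D w - G|].
(* Off [Bad], [S j / D <= x j] implies [S j <= up j - k] and is implied by
   [S j <= dn j + k]; the margin [k] exceeds the smoothing scale [q = k ^+ 2]. *)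
Let up j := x j * G + `|x j| * k + k.
Let dn j := x j * G - `|x j| * k - k.

Definition smoothed (c : nat -> R) w := \prod_(j < m) heat (c j) (q ^+ 2) (S j w).

Let q0 : 0 < q. Proof. by rewrite exprn_gt0. Qed.

Let heatE c y : heat c (q ^+ 2) y = ncdf ((c - y) / q).
Proof. by rewrite /heat sqrtr_sqr ger0_norm // ltW. Qed.

Lemma measurable_smoothed c : measurable_fun setT (smoothed c).
Proof.
apply: measurable_prod => j _.
rewrite (_ : (fun w => _) = fun w => ncdf ((c j - S j w) / q)); last first.
  by apply/funext => w; exact: heatE.
apply: measurableT_comp; first by apply: continuous_measurable_fun; exact: ncdf_continuous.
by apply: measurable_funM => //; exact: measurable_funB.
Qed.

Lemma smoothed_ge0 c w : 0 <= smoothed c w.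
Proof. by apply: prodr_ge0 => j _; exact: ncdf_ge0. Qed.

Lemma smoothed_le1 c w : smoothed c w <= 1.
Proof. by apply: prodr_ile1 => j _; rewrite /heat ncdf_ge0 ncdf_le1. Qed.

Lemma L1_smoothed c : L1 P (smoothed c).
Proof.
apply: (@L1_bounded _ _ _ P 1 _ (measurable_smoothed c)) => w.
by rewrite ger0_norm ?smoothed_ge0 ?smoothed_le1.
Qed.

Lemma measurable_selfnormalized_event : measurable Ev.
Proof.
have -> : Ev = \bigcap_(j in [set j | (j < m)%N]) [set w | S j w / D w <= x j].
  by apply/seteqP; split.
apply: fin_bigcap_measurable; first exact: finite_II.
move=> j _; apply: measurable_set_ler => //.
apply: measurable_funM => //; apply: measurableT_comp => //.
exact: measurable_invr.
Qed.

Let mBad : measurable Bad.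
Proof.
apply: measurable_set_ltr => //.
by apply: measurableT_comp => //; exact: measurable_funB.
Qed.

Let D_near w : ~ Bad w -> 0 < D w /\ forall j,
  x j * G - `|x j| * k <= x j * D w <= x j * G + `|x j| * k.
Proof.
rewrite /Bad /= => /negP; rewrite -leNgt => h.
split; first by move: h; rewrite ler_norml => /andP[h _]; move: kG; lra.
move=> j; have : `|x j * (D w - G)| <= `|x j| * k by rewrite normrM ler_wpM2l.
by rewrite ler_norml mulrBr => /andP[h1 h2]; apply/andP; split; lra.
Qed.

(** On the event and off [Bad], each sum is at least [k] below [up j], so each of the [m] smoothed
    factors is at least [ncdf k^-1]. *)
Lemma sandwich_upper : ncdf k^-1 ^+ m * fine (P Ev) <=
  \int[P]_w smoothed up w + fine (P Bad).
Proof.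
rewrite -!expect_indic //; last exact: measurable_selfnormalized_event.
have LE := L1_indic P measurable_selfnormalized_event.
have LBad := L1_indic P mBad.
rewrite -expectZ // -expectD //; last exact: L1_smoothed.
apply: expect_le; [exact: L1Z|by apply: L1D => //; exact: L1_smoothed|].
move=> w; rewrite !indicE_if; have s0 := smoothed_ge0 up w.
have n1 : ncdf k^-1 ^+ m <= 1 by rewrite exprn_ile1 ?ncdf_ge0 ?ncdf_le1.
have [Bw|nB] := pselect (Bad w).
  rewrite (introT (asboolP _) Bw); case: ifP => _; first by rewrite mulr1; lra.
  by rewrite mulr0; lra.
rewrite (introF (asboolP _) nB) addr0; case: ifPn => [/asboolP Ew|_]; last by rewrite mulr0.
rewrite mulr1 -[X in _ ^+ X]card_ord -prodr_const; apply: ler_prod => j _.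
rewrite ncdf_ge0 heatE; apply: ncdf_nondecreasing.
have [D0 /(_ j) /andP[_ h2]] := D_near nB.
have := Ew j (ltn_ord j); rewrite ler_pdivrMr // => h1.
rewrite ler_pdivlMr // /q expr2 mulrA mulVf ?gt_eqF // mul1r /up; lra.
Qed.

(** Off [Bad], if the event fails then some sum exceeds [dn j] by at least [k]. Its factor is at
    most [ncdf (- k^-1)], and the others are at most 1. *)
Lemma sandwich_lower : \int[P]_w smoothed dn w <=
  fine (P Ev) + ncdf (- k^-1) + fine (P Bad).
Proof.
rewrite -!expect_indic //; last exact: measurable_selfnormalized_event.
have LE := L1_indic P measurable_selfnormalized_event.
have LBad := L1_indic P mBad.
rewrite -[ncdf _](expect_cst P) -!expectD //; try exact: L1_cst; last first.
  by apply: L1D => //; exact: L1_cst.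
apply: expect_le; first exact: L1_smoothed.
  by do 2 (apply: L1D => //); exact: L1_cst.
move=> w; rewrite !indicE_if; have s1 := smoothed_le1 dn w.
have n0 := ncdf_ge0 (- k^-1).
have [Bw|nB] := pselect (Bad w).
  by rewrite (introT (asboolP _) Bw); case: ifP => _; lra.
rewrite (introF (asboolP _) nB) addr0; case: ifPn => [_|/asboolP Ew]; first by lra.
rewrite add0r.
have [j jm Sj] : exists2 j : nat, (j < m)%N & ~ (S j w / D w <= x j).
  by apply: contrapT => h; apply: Ew => j jm; apply: contrapT => Sj; apply: h; exists j.
rewrite /smoothed (bigD1 (Ordinal jm)) //=.
apply: (@le_trans _ _ (heat (dn j) (q ^+ 2) (S j w) * 1)).
  by apply: ler_wpM2l; [exact: ncdf_ge0|
    apply: prodr_ile1 => i _; rewrite /heat ncdf_ge0 ncdf_le1].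
rewrite mulr1 heatE; apply: ncdf_nondecreasing.
have [D0 /(_ j) /andP[h1 _]] := D_near nB.
move/negP: Sj; rewrite -ltNge ltr_pdivlMr // => h2.
rewrite ler_pdivrMr // /q expr2 mulNr mulrA mulVf ?gt_eqF // mul1r /dn; lra.
Qed.

End Sandwich.

Lemma cvg_prod_ord (R : realType) (m : nat) (f : nat -> nat -> R) (l : nat -> R) :
  (forall j, (fun n => f n j) @ \oo --> l j) ->
  (fun n => \prod_(j < m) f n j) @ \oo --> \prod_(j < m) l j.
Proof.
move=> fl; elim: m => [|m IH].
  by under eq_fun do rewrite big_ord0; rewrite big_ord0; exact: cvg_cst.
under eq_fun do rewrite big_ord_recr /=; rewrite big_ord_recr /=.
exact: cvgM.
Qed.

(** * Central limit theorem for the self-normalized array *)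

Section ArrayClt.
Context {R : realType} (d : nat -> measure_display) (T : forall n, measurableType (d n)).
Variables (P : forall n, probability (T n) R) (Y : forall n, nat -> T n -> R).
Variables (s2 : nat -> nat -> R) (M G0 G1 : R) (m : nat).
Arguments Y : clear implicits.
Hypothesis mY : forall n t, measurable_fun setT (Y n t).
Hypothesis indepY : forall n, independent_family (P n) setT (Y n).
Hypothesis Y0 : forall n w, Y n 0 w = 0.
Hypothesis EY : forall n t, \int[P n]_w Y n t w = 0.
Hypothesis EY2 : forall n t, \int[P n]_w (Y n t w ^+ 2) = s2 n t.
Hypothesis LY4 : forall n t, L1 (P n) (fun w => Y n t w ^+ 4).
Hypothesis EY4 : forall n t, \int[P n]_w (Y n t w ^+ 4) <= M.
Hypotheses (G0_gt0 : 0 < G0) (G1_gt0 : 0 < G1).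
Hypothesis cvgG0 : (fun n => n%:R^-1 * \sum_(t < n.+1) s2 n t) @ \oo --> G0.
Hypothesis cvgG1 : forall j,
  (fun n => n%:R^-1 * \sum_(t < n.+1) s2 n t * s2 n (t - j.+1)%N) @ \oo --> G1.

Let r n : R := (Num.sqrt n%:R)^-1.
Let S n j w := lagsum (Y n) (r n) n.+1 j w.
Let D n w := n%:R^-1 * \sum_(t < n.+1) Y n t w ^+ 2.

Arguments S : clear implicits.
Arguments D : clear implicits.

Let mS n j : measurable_fun setT (S n j).
Proof.
apply: measurable_funM => //; apply: measurable_sum => t.
exact: measurable_funM.
Qed.

Let mD n : measurable_fun setT (D n).
Proof.
apply: measurable_funM => //; apply: measurable_sum => t.
exact: measurable_funX.
Qed.

Let r_cvg : r @ \oo --> (0 : R).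
Proof.
apply/cvgrPdist_lt => e e0; near=> n.
rewrite sub0r normrN ger0_norm ?invr_ge0 // /r.
have n0 : 0 < n%:R :> R by rewrite ltr0n; near: n; exact: nbhs_infty_gt.
rewrite invf_plt ?posrE ?sqrtr_gt0 //.
rewrite -[ltLHS](@ger0_norm _ e^-1) ?invr_ge0 ?ltW // -sqrtr_sqr ltr_sqrt //.
by near: n; exact: nbhs_infty_gtr.
Unshelve. all: by end_near. Qed.

Let r2E n : r n ^+ 2 = n%:R^-1.
Proof. by rewrite /r exprVn sqr_sqrtr. Qed.

(** With [k] fixed, the Lindeberg error is (n + 1) C r^3 with r^2 = 1/n, hence at most 2 C r. The
    Gaussian side converges because [heat] is continuous in the variance at the positive limit
    [(k ^+ 2) ^+ 2 + G1]. *)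
Lemma smoothed_cvg k (c : nat -> R) : 0 < k -> k <= 1 ->
  (fun n => \int[P n]_w smoothed m (S n) k c w) @ \oo -->
    \prod_(j < m) ncdf (c j / Num.sqrt ((k ^+ 2) ^+ 2 + G1)).
Proof.
move=> k0 k1; set e := k ^+ 2.
have e0 : 0 < e by rewrite exprn_gt0.
have e1 : e <= 1 by rewrite exprn_ile1 // ltW.
pose L n := \prod_(j < m)
  heat (c j) (e ^+ 2 + \sum_(0 <= t < n.+1) lagvar (s2 n) (r n) t j) 0.
have cL : L @ \oo --> \prod_(j < m) ncdf (c j / Num.sqrt (e ^+ 2 + G1)).
  apply: (@cvg_prod_ord _ m (fun n j =>
    heat (c j) (e ^+ 2 + \sum_(0 <= t < n.+1) lagvar (s2 n) (r n) t j) 0)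
    (fun j => ncdf (c j / Num.sqrt (e ^+ 2 + G1)))) => j.
  have sG : 0 < e ^+ 2 + G1 by rewrite addr_gt0 // exprn_gt0.
  have ch : {for e ^+ 2 + G1, continuous (fun s => heat (c j) s 0)}.
    apply/differentiable_continuous/derivable1_diffP.
    by case: (is_derive_heat_time (c j) 0 sG).
  have -> : ncdf (c j / Num.sqrt (e ^+ 2 + G1)) = heat (c j) (e ^+ 2 + G1) 0.
    by rewrite /heat subr0.
  apply: (continuous_cvg _ ch); apply: cvgD; first exact: cvg_cst.
  apply: cvg_trans (cvgG1 j); apply: near_eq_cvg; near=> n => /=.
  by rewrite big_mkord /lagvar -mulr_sumr r2E.
pose C := lindeberg_const M m e.
have C0 : 0 <= 2 * C.
  have M0 : 0 <= 1 + M.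
    have h1 := s2_ge0 (@EY2 0%N) 0%N.
    have h2 := s2_le (@mY 0%N) (@EY2 0%N) (@LY4 0%N) (@EY4 0%N) 0%N.
    exact: le_trans h1 h2.
  have e40 : 0 <= 16 / e ^+ 4 by rewrite divr_ge0 // exprn_ge0 // ltW.
  rewrite mulr_ge0 // /C /lindeberg_const; apply: mulr_ge0; first apply: mulr_ge0.
  - by rewrite exprn_ge0 // mulr_ge0 // mulr_ge0.
  - exact: exprn_ge0.
  - by rewrite addr_ge0 // !mulr_ge0 ?exprn_ge0 ?addr_ge0.
have bnd : \forall n \near \oo,
    `|\int[P n]_w smoothed m (S n) k c w - L n| <= 2 * C * r n.
  near=> n.
  have n0 : 0 < n%:R :> R by rewrite ltr0n; near: n; exact: nbhs_infty_gt.
  have n1 : 1 <= n%:R :> R by rewrite ler1n -(ltr0n R).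
  have r0 : 0 <= r n by rewrite invr_ge0.
  have := lindeberg_bound (@mY n) (@indepY n) (@Y0 n) (@EY n) (@EY2 n) (@LY4 n) (@EY4 n)
    m c n.+1 r0 e0 e1.
  move=> /le_trans; apply.
  rewrite -/C exprS r2E.
  have -> : n.+1%:R * (C * (r n * n%:R^-1)) = (n.+1%:R / n%:R) * (C * r n) by ring.
  have C0' : 0 <= C by rewrite -(pmulr_rge0 _ (ltr0n R 2)).
  rewrite -[leRHS]mulrA; apply: ler_wpM2r; first by rewrite mulr_ge0.
  by rewrite ler_pdivrMr // -natr1; lra.
have cE : (fun n => \int[P n]_w smoothed m (S n) k c w - L n) @ \oo --> (0 : R).
  apply/norm_cvg0P; apply: (@squeeze_cvgr _ _ _ _ (fun=> 0) (fun n => 2 * C * r n)).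
  - by near=> n; rewrite normr_ge0 /=; near: n.
  - exact: cvg_cst.
  - rewrite -(mulr0 (2 * C)); apply: (@cvgM _ _ _ _ (fun=> 2 * C) r) => //.
    exact: cvg_cst.
rewrite -[X in _ --> X]add0r.
have -> : (fun n => \int[P n]_w smoothed m (S n) k c w) =
    fun n => (\int[P n]_w smoothed m (S n) k c w - L n) + L n.
  by apply/funext => n; rewrite subrK.
exact: cvgD cE cL.
Unshelve. all: by end_near. Qed.

Lemma bad_event_cvg k : 0 < k ->
  (fun n => fine (P n [set w | k < `|D n w - G0|])) @ \oo --> (0 : R).
Proof.
(* Half of [k] absorbs the bias of the mean. Chebyshev at level n k / 2 then gives (n + 1) |M| / (n
   k / 2)^2, and n + 1 <= 2 n yields the 8. *)
move=> k0; pose K := 8 * `|M| / k ^+ 2.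
apply: (@squeeze_cvgr _ _ _ _ (fun=> 0) (fun n => K * n%:R^-1)); last 2 first.
- exact: cvg_cst.
- rewrite -(mulr0 K); apply: (@cvgM _ _ _ _ (fun=> K)); first exact: cvg_cst.
  by apply/gtr0_cvgV0; [near=> n; rewrite ltr0n; near: n; exact: nbhs_infty_gt
    |exact: cvgr_idn].
near=> n; rewrite fine_ge0 //=.
have n0 : 0 < n%:R :> R by rewrite ltr0n; near: n; exact: nbhs_infty_gt.
have n1 : 1 <= n%:R :> R by rewrite ler1n -(ltr0n R).
have an : `|G0 - n%:R^-1 * \sum_(t < n.+1) s2 n t| <= k / 2.
  by near: n; move/cvgrPdist_le : cvgG0; apply; rewrite divr_gt0.
pose V w := \sum_(t < n.+1) (Y n t w ^+ 2 - s2 n t).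
pose eps := n%:R * (k / 2).
have eps0 : 0 < eps by rewrite !mulr_gt0 // invr_gt0.
have mV : measurable_fun setT V.
  by apply: measurable_sum => t; apply: measurable_funB => //; exact: measurable_funX.
have mBad : measurable [set w | k < `|D n w - G0|].
  apply: measurable_set_ltr => //; apply: measurableT_comp => //.
  exact: measurable_funB.
have mTail : measurable [set w | eps < `|V w|].
  by apply: measurable_set_ltr => //; exact: measurableT_comp.
have sub : fine (P n [set w | k < `|D n w - G0|]) <= fine (P n [set w | eps < `|V w|]).
  apply: fine_le; rewrite ?fin_num_measure //.
  apply: le_measure; rewrite ?inE // => w /= kD.
  have VE : V w = n%:R * (D n w - n%:R^-1 * \sum_(t < n.+1) s2 n t).
    by rewrite /V sumrB /D -mulrBr mulrA divff ?mul1r // gt_eqF.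
  rewrite VE normrM ger0_norm ?ltW // ltr_pM2l //.
  have := ler_normD (D n w - n%:R^-1 * \sum_(t < n.+1) s2 n t)
    (n%:R^-1 * \sum_(t < n.+1) s2 n t - G0).
  by rewrite addrA subrK [X in _ <= _ + X]distrC => h; move: an kD h; lra.
have tail := quadratic_variation_tail (@mY n) (@indepY n) (@EY2 n) (@LY4 n) (@EY4 n)
  n.+1 eps0.
rewrite -/V in tail.
apply: le_trans sub _.
rewrite -(ler_pM2l (exprn_gt0 2 eps0)); apply: le_trans tail _.
have -> : eps ^+ 2 * (K / n%:R) = 2 * n%:R * `|M|.
  by rewrite /eps /K; field; rewrite !gt_eqF.
apply: (@le_trans _ _ (n.+1%:R * `|M|)); first by rewrite ler_wpM2l ?ler_norm.
by rewrite ler_wpM2r // -natr1; lra.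
Unshelve. all: by end_near. Qed.

Lemma selfnormalized_clt (x : nat -> R) :
  (fun n => fine (P n [set w | forall j, (j < m)%N -> S n j w / D n w <= x j]))
    @ \oo --> \prod_(j < m) ncdf (x j * G0 / Num.sqrt G1).
Proof.
set p := fun n => fine _; set target := \prod_(j < m) _.
pose k (i : nat) : R := i.+1%:R^-1.
have k0 i : 0 < k i by rewrite invr_gt0.
have k1 i : k i <= 1 by rewrite invf_le1 // ler1n.
have kc : k @ \oo --> (0 : R) by exact: cvg_harmonic.
have kVc : (fun i => (k i)^-1) @ \oo --> +oo%R.
  apply/cvgryPge => A; near=> i; rewrite invrK.
  apply: (@le_trans _ _ i%:R); last by rewrite ler_nat.
  by near: i; exact: nbhs_infty_ger.
pose up i j := x j * G0 + `|x j| * k i + k i.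
pose dn i j := x j * G0 - `|x j| * k i - k i.
pose lim c i := \prod_(j < m) ncdf ((c j : R) / Num.sqrt ((k i ^+ 2) ^+ 2 + G1)).
have lim_cvg (c : nat -> nat -> R) : (forall j, (fun i => c i j) @ \oo --> x j * G0) ->
    (fun i => lim (c i) i) @ \oo --> target.
  move=> cc; apply: (@cvg_prod_ord _ m
    (fun i j => ncdf (c i j / Num.sqrt ((k i ^+ 2) ^+ 2 + G1)))
    (fun j => ncdf (x j * G0 / Num.sqrt G1))) => j.
  apply: continuous_cvg; first exact: ncdf_continuous.
  apply: cvgM; first exact: cc.
  apply: cvgV; first by rewrite gt_eqF // sqrtr_gt0.
  apply: continuous_cvg; first exact: sqrt_continuous.
  rewrite -[X in _ --> X]add0r; apply: cvgD; last exact: cvg_cst.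
  rewrite [X in _ --> X](_ : 0 = (0 * 0) * (0 * 0)); last by rewrite !mul0r.
  by under eq_fun do rewrite !expr2; do 2 (apply: cvgM => //).
have xk j : (fun i => `|x j| * k i) @ \oo --> (0 : R).
  rewrite -(mulr0 `|x j|); apply: (@cvgM _ _ _ _ (fun=> `|x j|)) => //.
  exact: cvg_cst.
have up_cvg : (fun i => lim (up i) i) @ \oo --> target.
  apply: lim_cvg => j; rewrite -[X in _ --> X]addr0; apply: cvgD => //.
  by rewrite -[X in _ --> X]addr0; apply: cvgD => //; exact: cvg_cst.
have dn_cvg : (fun i => lim (dn i) i) @ \oo --> target.
  apply: lim_cvg => j; rewrite -[X in _ --> X]subr0; apply: cvgB => //.
  by rewrite -[X in _ --> X]subr0; apply: cvgB => //; exact: cvg_cst.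
have hi_cvg : (fun i => 1 - ncdf (k i)^-1 ^+ m) @ \oo --> (0 : R).
  rewrite [X in _ --> X](_ : 0 = 1 - 1 ^+ m); last by rewrite expr1n subrr.
  apply: cvgB; first exact: cvg_cst.
  have h : (fun i => ncdf (k i)^-1) @ \oo --> (1 : R).
    exact: cvg_comp kVc cvg_ncdfy.
  elim: m => [|m' IH]; first by under eq_fun do rewrite expr0; exact: cvg_cst.
  by under eq_fun do rewrite exprS; rewrite exprS; exact: cvgM.
have lo_cvg : (fun i => ncdf (- (k i)^-1)) @ \oo --> (0 : R).
  by apply: cvg_comp cvg_ncdfNy; apply/cvgNrNy.
apply/cvgrPdist_le => eps eps0.
have e4 : 0 < eps / 4 by rewrite divr_gt0.
(* The margin is fixed before n grows. Each side of the sandwich has four errors: the shifted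
   thresholds, the tail of the smoothing, the convergence in n at this margin, and the bad event.
   The condition [k i < G0] keeps the denominator positive off the bad event. *)
have [i [kG upe dne hie loe]] : exists i, [/\ k i < G0,
    `|target - lim (up i) i| <= eps / 4, `|target - lim (dn i) i| <= eps / 4,
    `|0 - (1 - ncdf (k i)^-1 ^+ m)| <= eps / 4 & `|0 - ncdf (- (k i)^-1)| <= eps / 4].
  near \oo => i; exists i; split; near: i.
  - by move/cvgrPdist_lt: kc => /(_ _ G0_gt0); apply: filterS => i;
      rewrite sub0r normrN ger0_norm // ltW.
  - by move/cvgrPdist_le: up_cvg; apply.
  - by move/cvgrPdist_le: dn_cvg; apply.
  - by move/cvgrPdist_le: hi_cvg; apply.
  - by move/cvgrPdist_le: lo_cvg; apply.
pose u n := \int[P n]_w smoothed m (S n) (k i) (up i) w.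
pose l n := \int[P n]_w smoothed m (S n) (k i) (dn i) w.
pose b n := fine (P n [set w | k i < `|D n w - G0|]).
have cu : u @ \oo --> lim (up i) i := @smoothed_cvg (k i) (up i) (k0 i) (k1 i).
have cl : l @ \oo --> lim (dn i) i := @smoothed_cvg (k i) (dn i) (k0 i) (k1 i).
have cb : b @ \oo --> (0 : R) := bad_event_cvg (k0 i).
have U n : ncdf (k i)^-1 ^+ m * p n <= u n + b n :=
  sandwich_upper (P n) m x (@mS n) (@mD n) (k0 i) kG.
have L n : l n <= p n + ncdf (- (k i)^-1) + b n :=
  sandwich_lower (P n) m x (@mS n) (@mD n) (k0 i) kG.
have p1 n : p n <= 1.
  rewrite -lee_fin fineK ?fin_num_measure //; last 1 first.
    exact: measurable_selfnormalized_event.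
  by apply: probability_le1; exact: measurable_selfnormalized_event.
have p0 n : 0 <= p n by apply: fine_ge0.
move: u l b p cu cl cb U L p1 p0 => u l b p cu cl cb U L p1 p0.
near=> n.
have Ue : `|lim (up i) i - u n| <= eps / 4.
  by near: n; move/cvgrPdist_le: cu; apply.
have Le : `|lim (dn i) i - l n| <= eps / 4.
  by near: n; move/cvgrPdist_le: cl; apply.
have Be : `|0 - b n| <= eps / 4.
  by near: n; move/cvgrPdist_le: cb; apply.
move: (U n) (L n) (p1 n) (p0 n) => {}U {}L {}p1 {}p0.
have n1 : ncdf (k i)^-1 ^+ m <= 1 by rewrite exprn_ile1 ?ncdf_ge0 ?ncdf_le1.
move: upe dne hie loe Ue Le Be; rewrite !ler_norml.
move=> /andP[? ?] /andP[? ?] /andP[? ?] /andP[? ?] /andP[? ?] /andP[? ?] /andP[? ?].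
by apply/andP; split; nra.
Unshelve. all: by end_near. Qed.

End ArrayClt.

(** * The limiting variances *)

Section UnitInterval.
Context {R : realType}.
Local Notation mu := (@lebesgue_measure R).
Local Notation I01 := (`]0, 1]%classic : set R).

Let muI : mu I01 = 1%E.
Proof. by rewrite lebesgue_measure_itv /= lte_fin ltr01 -EFinB subr0. Qed.

Lemma integrable_unit_interval (f : R -> R) (C : R) : measurable_fun I01 f ->
  (forall s, I01 s -> `|f s| <= C) -> mu.-integrable I01 (EFin \o f).
Proof.
move=> mf fC.
have fI : (lebesgue_measure I01 < +oo)%E by rewrite [X in (X < _)%E]muI ltry.
apply: measurable_bounded_integrable => //.
exists C; split; first exact: num_real.
by move=> x Cx s Is /=; apply: le_trans (fC s Is) _; exact: ltW.
Qed.

Lemma integrable_unit_intervalB (f1 f2 : R -> R) :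
  mu.-integrable I01 (EFin \o f1) -> mu.-integrable I01 (EFin \o f2) ->
  mu.-integrable I01 (EFin \o (fun s => f1 s - f2 s)).
Proof.
move=> i1 i2.
have h : mu.-integrable I01 (fun x => (EFin \o f1) x - (EFin \o f2) x)%E.
  by apply: integrableB.
by apply: eq_integrable h.
Qed.

(** A zero integral would make [f] vanish almost everywhere on a set of measure 1. *)
Lemma Rintegral_unit_interval_gt0 (f : R -> R) (C : R) : measurable_fun I01 f ->
  (forall s, I01 s -> 0 < f s <= C) -> 0 < \int[mu]_(s in I01) f s.
Proof.
move=> mf f0.
have fI : mu.-integrable I01 (EFin \o f).
  apply: (@integrable_unit_interval _ C) => // s /f0 /andP[h1 h2].
  by rewrite gtr0_norm.
have ge0 : 0 <= \int[mu]_(s in I01) f s.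
  by apply: Rintegral_ge0 => s /f0 /andP[/ltW].
rewrite lt_neqAle ge0 andbT; apply/eqP => I0.
have J0 : (\int[mu]_(s in I01) `|(EFin \o f) s| = 0)%E.
  transitivity (\int[mu]_(s in I01) (f s)%:E)%E.
    apply: eq_integral => s /[!inE] /f0 /andP[h1 _] /=.
    by rewrite gtr0_norm.
  rewrite -[LHS]fineK; last exact: integrable_fin_num fI.
  by congr EFin; exact: (esym I0).
have mfe : measurable_fun I01 (EFin \o f) by exact/measurable_EFinP.
have [N [mN N0 sub]] := (ae_eq_integral_abs mu (measurable_itv _) mfe).1 J0.
have IN : I01 `<=` N.
  move=> s Is; apply: sub => /= /(_ Is) [fs].
  by have /andP[] := f0 s Is; rewrite fs ltxx.
have : (mu I01 <= mu N)%E by apply: le_measure; rewrite ?inE //; exact: measurable_itv.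
by rewrite [mu N]N0 [X in (X <= _)%E]muI lee_fin ler10.
Qed.

Lemma grid_in n t : (1 <= t <= n)%N -> (t%:R / n%:R : R) \in `]0, 1].
Proof.
move=> /andP[t1 tn]; rewrite in_itv /=.
have n0 : 0 < n%:R :> R by rewrite ltr0n (leq_trans t1).
apply/andP; split; first by rewrite divr_gt0 // ltr0n.
by rewrite ler_pdivrMr // mul1r ler_nat.
Qed.

(** On the cell containing [s], the lagged point is within (h + 1) / n of [s], uniformly in [t].
    Truncation does no harm, since the natural difference still lies between t - h and t. *)
Lemma grid_cvg (f : R -> R) (s : R) (h : nat) e : {for s, continuous f} -> 0 < e ->
  \forall n \near \oo, forall t, (1 <= t <= n)%N -> (t.-1)%:R / n%:R < s <= t%:R / n%:R ->
    `|f ((t - h)%N%:R / n%:R) - f s| <= e.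
Proof.
move=> /cvgrPdist_le /(_ _ _)/nbhs_ballP cf e0.
have [r /= r0 hr] := cf e e0.
near=> n => t /andP[t1 tn] /andP[ts st].
have n0 : 0 < n%:R :> R by rewrite ltr0n; near: n; exact: nbhs_infty_gt.
rewrite distrC; apply: hr; rewrite /ball /=.
have hn : h.+1%:R / n%:R < r.
  rewrite ltr_pdivrMr // mulrC -ltr_pdivrMr //.
  by near: n; exact: nbhs_infty_gtr.
apply: le_lt_trans hn.
move: ts st; rewrite ltr_pdivrMr // ler_pdivlMr //.
have le1 : (t.-1)%:R + 1 = t%:R :> R by rewrite natr1 prednK.
have le2 : t%:R - h%:R <= (t - h)%N%:R :> R by rewrite lerBlDr -natrD ler_nat addnC -leq_subLR.
have le3 : (t - h)%N%:R <= t%:R :> R by rewrite ler_nat leq_subr.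
have le4 : h%:R + 1 = h.+1%:R :> R by rewrite natr1.
move=> h1 h2; rewrite ler_norml; apply/andP; split.
  rewrite lerBrDr -mulNr -mulrDl ler_pdivrMr //; lra.
by rewrite lerBlDr -mulrDl ler_pdivlMr //; lra.
Unshelve. all: by end_near. Qed.

End UnitInterval.

Lemma powR_le_sum (R : realType) (x q q' : R) : 0 <= x -> 0 < q -> q <= q' ->
  x `^ q <= 1 + x `^ q'.
Proof.
move=> x0 q0 qq'; have [x1|x1] := leP x 1.
  apply: (@le_trans _ _ 1); last by rewrite lerDl powR_ge0.
  have one : 1 `^ q = 1 :> R by rewrite powR1.
  by rewrite -[leRHS]one ge0_ler_powR ?nnegrE // ltW.
by apply: (@le_trans _ _ (x `^ q')); rewrite ?lerDr // ler_powR // ltW.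
Qed.

Lemma cond_expectation_fin (R : realType) d (T : measurableType d)
    (P : probability T R) (A : set T) (X : T -> R) : measurable A ->
  measurable_fun setT X -> (forall w, 0 <= X w) ->
  (\int[P]_w (X w)%:E < +oo)%E -> cond_expectation P A X \is a fin_num.
Proof.
move=> mA mX X0 Xoo; rewrite /cond_expectation fin_numM //.
rewrite ge0_fin_numE; last by apply: integral_ge0 => w _; rewrite lee_fin.
apply: le_lt_trans Xoo; apply: ge0_subset_integral => //.
- exact/measurable_EFinP.
- by move=> w _; rewrite lee_fin.
Qed.

Section LimitVariances.
Context {R : realType}.
Variables (delta m1 m2 Cv : R) (v g : R -> R).
Local Notation mu := (@lebesgue_measure R).
Local Notation I01 := (`]0, 1]%classic : set R).
Hypothesis delta_gt0 : 0 < delta.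
Hypothesis m2_gt0 : 0 < m2.
Hypothesis m12 : m1 ^+ 2 <= m2.
Hypothesis g_bounds : forall u, I01 u -> 0 < g u < 1.
Hypothesis v_bounds : forall u, I01 u -> 0 < v u <= Cv.
Hypothesis g_lip : piecewise_lipschitz g.
Hypothesis v_lip : piecewise_lipschitz v.

(** The function f(u): the value of [centered_power_var] with volatility [v u] and observation
    probability [g u]. *)
Definition var_density (u : R) : R :=
  v u `^ (2 * delta) * (m2 * g u - m1 ^+ 2 * g u ^+ 2).

Let Cf := Cv `^ (2 * delta) * m2.

Lemma var_density_bounds u : I01 u -> 0 < var_density u <= Cf.
Proof.
move=> Iu; have /andP[g0 g1] := g_bounds Iu; have /andP[v0 vC] := v_bounds Iu.
have p0 : 0 < v u `^ (2 * delta) by rewrite powR_gt0.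
have pC : v u `^ (2 * delta) <= Cv `^ (2 * delta).
  by rewrite ge0_ler_powR ?nnegrE ?mulr_ge0 // ?ltW // (lt_le_trans v0).
have hE : m2 * g u - m1 ^+ 2 * g u ^+ 2 = g u * (m2 - m1 ^+ 2 * g u) by ring.
(* Strictness comes from [g u < 1] when [m1] is nonzero, and from [0 < m2] otherwise. *)
have h0 : 0 < m2 - m1 ^+ 2 * g u.
  have := sqr_ge0 m1; rewrite le_eqVlt => /predU1P[<-|m10].
    by rewrite mul0r subr0.
  by rewrite subr_gt0; apply: lt_le_trans m12; rewrite gtr_pMr.
have h1 : m2 * g u - m1 ^+ 2 * g u ^+ 2 <= m2.
  have : 0 <= m1 ^+ 2 * g u ^+ 2 by rewrite mulr_ge0 ?sqr_ge0.
  have : m2 * g u <= m2 by rewrite ler_piMr // ltW.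
  by lra.
rewrite /var_density hE mulr_gt0 ?mulr_gt0 //=.
by apply: ler_pM => //; [exact: ltW|rewrite mulr_ge0 // ltW|rewrite -hE].
Qed.

Let mv q : measurable_fun I01 (fun u => v u `^ q).
Proof.
have [_ mv] := piecewise_lipschitzP v_lip.
exact: measurableT_comp (measurable_powR q) mv.
Qed.

Let mg k : measurable_fun I01 (fun u => g u ^+ k).
Proof. by have [_ mg] := piecewise_lipschitzP g_lip; exact: measurable_funX. Qed.

Lemma measurable_var_density : measurable_fun I01 var_density.
Proof.
apply: measurable_funM; first exact: mv.
apply: measurable_funB; apply: measurable_funM => //.
by have [_] := piecewise_lipschitzP g_lip.
Qed.

Lemma continuous_var_density :
  {ae mu, forall s, I01 s -> {for s, continuous var_density}}.
Proof.
have [[N1 [fN1 cv]] _] := piecewise_lipschitzP v_lip.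
have [[N2 [fN2 cg]] _] := piecewise_lipschitzP g_lip.
have fN : finite_set (N1 `|` N2) by rewrite finite_setU.
exists (N1 `|` N2); split.
- apply: countable_measurable; last exact: finite_set_countable.
  by move=> x; exact: measurable_set1.
- exact: (countable_lebesgue_measure0 (finite_set_countable fN)).
move=> s /= nc; apply: contrapT => nN; apply: nc => Is.
have cvs := cv s Is (fun h => nN (or_introl h)).
have cgs := cg s Is (fun h => nN (or_intror h)).
have /andP[v0 _] := v_bounds Is.
have cp : {for v s, continuous (fun x => x `^ (2 * delta))}.
  apply/differentiable_continuous/derivable1_diffP.
  by case: (is_derive1_powR (2 * delta) v0).
have cpv : (fun u => v u `^ (2 * delta)) @ s --> v s `^ (2 * delta).
  exact: continuous_cvg cp cvs.
apply: cvgM => //; apply: cvgB.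
  by apply: cvgM => //; exact: cvg_cst.
by apply: cvgM; [exact: cvg_cst|apply: cvgM].
Qed.

Definition var_array (n t : nat) : R :=
  if (1 <= t <= n)%N then var_density (t%:R / n%:R) else 0.

Let Cf0 : 0 <= Cf.
Proof. by rewrite mulr_ge0 ?powR_ge0 // ltW. Qed.

Let var_array_bound n t : `|var_array n t| <= Cf.
Proof.
rewrite /var_array; case: ifPn => [tn|_]; last by rewrite normr0.
have /andP[f0 fC] := var_density_bounds (grid_in tn).
by rewrite gtr0_norm.
Qed.

Lemma cvg_mean_var : (fun n => n%:R^-1 * \sum_(t < n.+1) var_array n t) @ \oo -->
  \int[mu]_(s in I01) var_density s.
Proof.
have -> : (fun n => n%:R^-1 * \sum_(t < n.+1) var_array n t) =
    fun n => n%:R^-1 * \sum_(1 <= t < n.+1) var_array n t.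
  apply/funext => n; rewrite -(big_mkord xpredT (var_array n)) big_ltn //.
  by rewrite {1}/var_array /= add0r.
apply: (@riemann_sum _ _ _ Cf) => //; first exact: measurable_var_density.
move: continuous_var_density; apply: filterS; first exact: (ae_filter_ringOfSetsType mu).
move=> s cs Is e e0; near=> n => t tn ts; rewrite /var_array tn.
rewrite -[t in t%:R / _]subn0; move: t tn ts; near: n.
have [N _ hN] := grid_cvg 0 (cs Is) e0.
by exists N => // n Nn t tn ts; exact: hN.
Unshelve. all: by end_near. Qed.

Lemma cvg_mean_var_lag (j : nat) :
  (fun n => n%:R^-1 * \sum_(t < n.+1) var_array n t * var_array n (t - j.+1)%N)
    @ \oo --> \int[mu]_(s in I01) (var_density s ^+ 2).
Proof.
have -> : (fun n => n%:R^-1 * \sum_(t < n.+1) var_array n t * var_array n (t - j.+1)%N) =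
    fun n => n%:R^-1 * \sum_(1 <= t < n.+1) var_array n t * var_array n (t - j.+1)%N.
  apply/funext => n.
  rewrite -(big_mkord xpredT (fun t => var_array n t * var_array n (t - j.+1)%N)).
  by rewrite big_ltn // {1}/var_array /= mul0r add0r.
apply: (@riemann_sum _ (fun n t => var_array n t * var_array n (t - j.+1)%N) _ (Cf * Cf)).
- by move=> n t _; exact: ler_norm_mul.
- by apply: measurable_funX; exact: measurable_var_density.
move: continuous_var_density; apply: filterS; first exact: (ae_filter_ringOfSetsType mu).
move=> s cs Is e e0.
have /andP[f0 fC] := var_density_bounds Is.
have Cf1 : 0 < Cf by exact: lt_le_trans fC.
pose e' := e / (2 * Cf).
have e'0 : 0 < e' by rewrite divr_gt0 // mulr_gt0.
near=> n => t tn ts.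
have s0 : 0 < s by have := Is; rewrite /= in_itv /= => /andP[].
have n0 : 0 < n%:R :> R by rewrite ltr0n; near: n; exact: nbhs_infty_gt.
(* For fixed [s > 0] and large n, the cell containing [s] has an index beyond the lag, so the zero
   padding of [var_array] is not reached. *)
have tj : (j.+1 < t)%N.
  rewrite -(ltr_nat R); have /andP[_ st] := ts.
  rewrite -(ltr_pM2r (_ : 0 < n%:R^-1)) ?invr_gt0 //; apply: lt_le_trans st.
  rewrite ltr_pdivrMr // mulrC -ltr_pdivrMr //.
  by near: n; exact: nbhs_infty_gtr.
have tjn : (1 <= t - j.+1 <= n)%N.
  by rewrite subn_gt0 tj (leq_trans (leq_subr _ _)) //; case/andP: tn.
have b0 : `|var_array n t - var_density s| <= e'.
  rewrite /var_array tn -[t in t%:R / _]subn0; move: t tn ts {tj tjn}; near: n.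
  have [N _ hN] := grid_cvg 0 (cs Is) e'0.
  by exists N => // n Nn t tn ts; exact: hN.
have b1 : `|var_array n (t - j.+1)%N - var_density s| <= e'.
  rewrite /var_array tjn; move: t tn ts {tj tjn b0}; near: n.
  have [N _ hN] := grid_cvg j.+1 (cs Is) e'0.
  by exists N => // n Nn t tn ts; exact: hN.
have -> : var_array n t * var_array n (t - j.+1)%N - var_density s ^+ 2 =
    var_array n t * (var_array n (t - j.+1)%N - var_density s) +
    (var_array n t - var_density s) * var_density s by ring.
have fs : `|var_density s| <= Cf by rewrite gtr0_norm.
apply: le_trans (ler_norm_add (ler_norm_mul (var_array_bound n t) b1)
  (ler_norm_mul b0 fs)) _.
by rewrite le_eqVlt; apply/orP; left; apply/eqP; rewrite /e'; field; rewrite gt_eqF.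
Unshelve. all: by end_near. Qed.

Let int_vg (q k : nat) c : mu.-integrable I01
  (EFin \o (fun s => c * (v s `^ (q%:R * delta) * g s ^+ k))).
Proof.
apply: (@integrable_unit_interval _ _ (`|c| * (Cv `^ (q%:R * delta) * 1))).
  by apply: measurable_funM => //; apply: measurable_funM.
move=> s Is; have /andP[g0 g1] := g_bounds Is; have /andP[v0 vC] := v_bounds Is.
rewrite normrM ler_wpM2l // normrM; apply: ler_pM => //.
  rewrite ger0_norm ?powR_ge0 //; apply: ge0_ler_powR; rewrite ?nnegrE //.
  - by rewrite mulr_ge0 // ltW.
  - exact: ltW.
  - exact: ltW (lt_le_trans v0 vC).
by rewrite ger0_norm ?exprn_ge0 ?exprn_ile1 // ltW.
Qed.

Let int_vgE (q k : nat) c : \int[mu]_(s in I01) (c * (v s `^ (q%:R * delta) * g s ^+ k)) =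
  c * \int[mu]_(s in I01) (v s `^ (q%:R * delta) * g s ^+ k).
Proof.
rewrite RintegralZl //; have := int_vg q k 1; apply: eq_integrable => //.
by move=> s _ /=; rewrite mul1r.
Qed.

Lemma zeta_numE : zeta_num delta m1 m2 v g = \int[mu]_(s in I01) (var_density s ^+ 2).
Proof.
rewrite /zeta_num -!(int_vgE 4).
rewrite -RintegralB //; [|exact: int_vg..].
rewrite -RintegralD //; [|apply: integrable_unit_intervalB; exact: int_vg].
apply: eq_Rintegral => s _; rewrite /var_density exprMn.
have -> : (v s `^ (2 * delta)) ^+ 2 = v s `^ (4 * delta).
  rewrite -powR_mulrn ?powR_ge0 // -powRrM; congr (_ `^ _); ring.
by ring.
Qed.

Lemma zeta_denE : zeta_den delta m1 m2 v g = (\int[mu]_(s in I01) var_density s) ^+ 2.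
Proof.
have -> : \int[mu]_(s in I01) var_density s =
    m2 * \int[mu]_(s in I01) (v s `^ (2 * delta) * g s ^+ 1)
    - m1 ^+ 2 * \int[mu]_(s in I01) (v s `^ (2 * delta) * g s ^+ 2).
  rewrite -!(int_vgE 2) -RintegralB //; [|exact: int_vg..].
  by apply: eq_Rintegral => s _; rewrite /var_density; ring.
by rewrite /zeta_den; ring.
Qed.

Lemma mean_var_gt0 : 0 < \int[mu]_(s in I01) var_density s.
Proof.
by apply: (@Rintegral_unit_interval_gt0 _ _ Cf measurable_var_density) => s Is;
  exact: var_density_bounds.
Qed.

Lemma mean_sqr_var_gt0 : 0 < \int[mu]_(s in I01) (var_density s ^+ 2).
Proof.
apply: (@Rintegral_unit_interval_gt0 _ _ (Cf ^+ 2)).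
  by apply: measurable_funX; exact: measurable_var_density.
move=> s /var_density_bounds /andP[f0 fC].
by rewrite exprn_gt0 //= lerXn2r ?nnegrE // ltW.
Qed.

End LimitVariances.

(** * Reduction of the power autocorrelations to the array *)

Section PaddedArray.
Context {R : realType} {d : measure_display} {T : measurableType d}.
Variables (P : probability T R) (delta : R) (v : R -> R).
Variables (n : nat) (eta : nat -> T -> R) (a : nat -> T -> bool).

Definition padded_return (t : nat) (w : T) : R :=
  if (1 <= t <= n)%N then centered_power_return P delta v n eta a t w else 0.

(** The terms with [t <= h], absent from the autocovariance, vanish here: [t - h] truncates to 0,
    where the padded return is 0. *)
Lemma power_autocov_lagged (h : nat) (w : T) :
  power_autocov P delta v n eta a h w =
  n%:R^-1 * \sum_(t < n.+1) padded_return t w * padded_return (t - h)%N w.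
Proof.
rewrite /power_autocov; congr (_ * _).
rewrite (big_nat_widenl (1 + h) 0) // big_mkcond big_mkord.
apply: eq_bigr => t _ /=; rewrite /padded_return.
have tn : (t <= n)%N by rewrite -ltnS.
rewrite tn andbT (leq_trans (leq_subr _ _) tn) andbT subn_gt0 add1n.
case: ltnP => ht; last by rewrite mulr0.
by rewrite (leq_ltn_trans _ ht).
Qed.

Lemma sqrt_power_autocorrE (j : nat) (w : T) : (0 < n)%N ->
  Num.sqrt n%:R * power_autocorr P delta v n eta a j.+1 w =
  lagsum padded_return (Num.sqrt n%:R)^-1 n.+1 j w /
    (n%:R^-1 * \sum_(t < n.+1) padded_return t w ^+ 2).
Proof.
move=> n0; rewrite /power_autocorr !power_autocov_lagged mulrA mulrA.
have s0 : Num.sqrt n%:R != 0 :> R by rewrite sqrtr_eq0 -ltNge ltr0n.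
have -> : Num.sqrt n%:R * n%:R^-1 = (Num.sqrt n%:R)^-1 :> R.
  by rewrite -[n%:R in X in _ * X](@sqr_sqrtr _ n%:R) // expr2 invfM mulrA mulfV ?mul1r.
congr (_ / (_ * _)); apply: eq_bigr => t _.
by rewrite subn0 expr2.
Qed.

End PaddedArray.

Section VolatilityBounds.
Context {R : realType}.

Lemma ereal_bounds_ubound (v : R -> R) :
  (0 < ereal_inf [set (v r)%:E | r in `]0%R, 1%R]])%E ->
  (ereal_sup [set (v r)%:E | r in `]0%R, 1%R]] < +oo)%E ->
  exists C, forall u, (`]0, 1]%classic : set R) u -> 0 < v u <= C.
Proof.
move=> vinf vsup; set s := ereal_sup _ in vsup.
have vs u : (`]0, 1]%classic : set R) u -> ((v u)%:E <= s)%E.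
  by move=> Iu; apply: ereal_sup_ubound; exists u.
have I1 : (`]0, 1]%classic : set R) 1 by rewrite /= in_itv /= ltr01 lexx.
have sfin : s \is a fin_num.
  by rewrite fin_numElt vsup andbT; apply: lt_le_trans (vs _ I1); rewrite ltNyr.
exists (fine s) => u Iu; apply/andP; split.
  by rewrite -lte_fin; apply: lt_le_trans vinf _; apply: ereal_inf_lbound; exists u.
by rewrite -lee_fin fineK //; exact: vs.
Qed.

End VolatilityBounds.

Section CensoredPowers.
Context {R : realType} {d : measure_display} {T : measurableType d}.
Variables (P : probability T R) (eta : {RV P >-> R}) (a : {RV P >-> bool}).

Lemma cond_abs_moment_fin (q q' : R) : 0 < q -> q <= q' ->
  ('E_P[fun w => (`|eta w| `^ q')%R] < +oo)%E ->
  cond_expectation P (a @^-1` [set true]) (fun w => `|eta w| `^ q) \is a fin_num.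
Proof.
move=> q0 qq'; rewrite unlock => E.
have me p : measurable_fun setT (fun w => `|eta w| `^ p).
  exact: (measurableT_comp (measurable_abs_powR p)).
apply: cond_expectation_fin; first exact: measurable_funPTI.
- exact: me.
- by move=> w; exact: powR_ge0.
have le1 : (\int[P]_w (`|eta w| `^ q)%:E <= \int[P]_w (1 + `|eta w| `^ q')%:E)%E.
  apply: ge0_le_integral => //.
  - by apply/measurable_EFinP; apply: me.
  - by apply/measurable_EFinP; apply: measurable_funD => //; apply: me.
  - by move=> w _; rewrite lee_fin powR_le_sum.
apply: le_lt_trans le1 _.
under eq_integral do rewrite EFinD.
rewrite ge0_integralD //.
- by rewrite integral_cst // mul1e lte_add_pinfty // [X in (X < _)%E]probability_setT ltry.
- by apply/measurable_EFinP; apply: me.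
Qed.

End CensoredPowers.

Theorem proposition3p4 (R : realType) (delta : R) (g v : R -> R)
  (d : nat -> measure_display) (T : forall n, measurableType (d n))
  (P : forall n, probability (T n) R)
  (eta : forall n, nat -> {RV (P n) >-> R})
  (a : forall n, nat -> {RV (P n) >-> bool})
  (delta_gt0 : 0 < delta)
  (indep : forall n, independent_family (P n) [set t | (1 <= t <= n)%N]
     (fun (t : nat) w => (eta n t w, a n t w)))
  (mean_eta : forall n t, (1 <= t <= n)%N ->
     cond_expectation (P n) (a n t @^-1` [set true]) (eta n t) = 0%E)
  (var_eta : forall n t, (1 <= t <= n)%N ->
     cond_expectation (P n) (a n t @^-1` [set true])
       (fun w => eta n t w ^+ 2) = 1%E)
  (same_law : forall n t n' t', (1 <= t <= n)%N -> (1 <= t' <= n')%N ->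
     forall B : set R, measurable B ->
     cond_distribution (P n) (a n t @^-1` [set true]) (eta n t) B =
     cond_distribution (P n') (a n' t' @^-1` [set true]) (eta n' t') B)
  (prob_a : forall n t, (1 <= t <= n)%N ->
     P n (a n t @^-1` [set true]) = (g (t%:R / n%:R))%:E)
  (g_meas : measurable_fun (`]0, 1]%classic : set R) g)
  (g_nonconst : exists u u' : R, [/\ u \in `]0, 1], u' \in `]0, 1] & g u <> g u'])
  (g_bounds : forall u : R, u \in `]0, 1] -> 0 < g u < 1)
  (g_lip : piecewise_lipschitz g)
  (v_lip : piecewise_lipschitz v)
  (v_inf : (0 < ereal_inf [set (v r)%:E | r in `]0%R, 1%R]])%E)
  (v_sup : (ereal_sup [set (v r)%:E | r in `]0%R, 1%R]] < +oo)%E)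
  (moment_eta : forall n t, (1 <= t <= n)%N ->
     ('E_(P n)[fun w => (`|eta n t w| `^ (4 * delta))%R] < +oo)%E) :
  forall (n0 t0 : nat) (m1 m2 : R), (1 <= t0 <= n0)%N ->
  m1 = fine (cond_expectation (P n0) (a n0 t0 @^-1` [set true])
    (fun w => `|eta n0 t0 w : R| `^ delta)) ->
  m2 = fine (cond_expectation (P n0) (a n0 t0 @^-1` [set true])
    (fun w => `|eta n0 t0 w : R| `^ (2 * delta))) ->
  forall m : nat, (1 <= m)%N ->
  cvg_in_distribution P
    (fun n w => Num.sqrt n%:R *:
      power_autocorr_vec (P n) delta v n (eta n) (a n) m w)
    (multinormal_cdf 0 (zeta delta m1 m2 v g)%:M).
Proof.
move=> n0 t0 m1 m2 tn0 m1E m2E m m_gt0 x _.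
have [Cv v_bounds] := ereal_bounds_ubound v_inf v_sup.
have g_bounds' u : (`]0, 1]%classic : set R) u -> 0 < g u < 1.
  by move=> Iu; exact: g_bounds.
(* By [same_law] a conditional moment has one value for all n and t, namely the one at [n0], [t0];
   it is finite by domination by the moment of order 4 delta. *)
have moments q : 0 < q -> q <= 4 * delta -> exists c, forall n t, (1 <= t <= n)%N ->
    cond_expectation (P n) (a n t @^-1` [set true]) (fun w => `|eta n t w| `^ q) = c%:E.
  move=> q0 q4.
  have /fineK e := cond_abs_moment_fin (a n0 t0) q0 q4 (moment_eta _ _ tn0).
  exists (fine (cond_expectation (P n0) (a n0 t0 @^-1` [set true])
    (fun w => `|eta n0 t0 w| `^ q))) => n t tn; rewrite e.
  exact: (cond_expectation_law (same_law _ _ _ _ tn tn0) (measurable_abs_powR q)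
    (fun x => powR_ge0 _ _)).
have [||c1 Ec1] := moments delta; [by []|by nra|].
have [||c2 Ec2] := moments (2 * delta); [by nra|by nra|].
have [||m4 Em4] := moments (4 * delta); [by nra|by []|].
have Em1 : c1 = m1 by rewrite m1E (Ec1 _ _ tn0).
have Em2 : c2 = m2 by rewrite m2E (Ec2 _ _ tn0).
move: Ec1 Ec2; rewrite {}Em1 {}Em2 => Em1 Em2 {m1E m2E moments}.
have grid n t : (1 <= t <= n)%N -> (`]0, 1]%classic : set R) (t%:R / n%:R).
  exact: grid_in.
have p_gt0 n t : (1 <= t <= n)%N -> 0 < g (t%:R / n%:R).
  by move=> /grid /g_bounds' /andP[].
have v_gt0 n t : (1 <= t <= n)%N -> 0 < v (t%:R / n%:R).
  by move=> /grid /v_bounds /andP[].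
have m2_gt0 := power_moment_gt0 (prob_a _ _ tn0) (p_gt0 _ _ tn0) (Em1 _ _ tn0) (Em2 _ _ tn0)
  (var_eta _ _ tn0).
have m12 := power_moment_sqr_le (prob_a _ _ tn0) (p_gt0 _ _ tn0) (Em1 _ _ tn0) (Em2 _ _ tn0).
have m1_ge0 := power_moment_ge0 (prob_a _ _ tn0) (p_gt0 _ _ tn0) (Em1 _ _ tn0).
have m4_ge0 := power_moment_ge0 (prob_a _ _ tn0) (p_gt0 _ _ tn0) (Em4 _ _ tn0).
pose Y n := padded_return (P n) delta v n (eta n) (a n).
pose W n t w := `|(a n t w)%:R * (v (t%:R / n%:R) * eta n t w)| `^ delta.
pose c n t := v (t%:R / n%:R) `^ delta * (g (t%:R / n%:R) * m1).
have YE n t : (1 <= t <= n)%N -> Y n t = fun w => W n t w - c n t.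
  move=> tn; apply/funext => w; rewrite /Y /padded_return tn /centered_power_return.
  have [_ EW] := censored_power_mean (prob_a _ _ tn) (p_gt0 _ _ tn) delta_gt0 (v_gt0 _ _ tn)
    (Em1 _ _ tn).
  congr (_ - _); rewrite unlock; exact: EW.
have Y0 n t : ~~ (1 <= t <= n)%N -> Y n t = fun=> 0.
  by move=> /negPf tn; apply/funext => w; rewrite /Y /padded_return tn.
have mY n t : measurable_fun setT (Y n t).
  have [tn|tn] := boolP (1 <= t <= n)%N; last by rewrite Y0 //; exact: measurable_cst.
  by rewrite YE //; apply: measurable_funB => //; exact: measurable_censored_power.
have indepY n : independent_family (P n) setT (Y n).
  apply: (independent_family_comp (indep n)
    (F := fun t z => `|(z.2 : bool)%:R * (v (t%:R / n%:R) * z.1)| `^ delta - c n t)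
    (c := 0)).
  - move=> t _; apply: measurable_funB => //.
    apply: (measurableT_comp (measurable_abs_powR delta)).
    apply: measurable_funM; last by apply: measurable_funM.
    apply: (measurableT_comp (f := fun b : bool => b%:R : R)) => //.
  - by move=> t w tn; rewrite YE.
  - by move=> t w tn; rewrite Y0 //; exact/negP.
pose s2 := var_array delta m1 m2 v g.
have EY n t : \int[P n]_w Y n t w = 0.
  have [tn|tn] := boolP (1 <= t <= n)%N; last by rewrite Y0 //= expect_cst.
  rewrite YE //.
  exact: (centered_power_mean (prob_a _ _ tn) (p_gt0 _ _ tn) delta_gt0 (v_gt0 _ _ tn)
    (Em1 _ _ tn)).
have EY2 n t : \int[P n]_w Y n t w ^+ 2 = s2 n t.
  rewrite /s2 /var_array; case: ifPn => tn; last first.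
    by rewrite Y0 //= expect_cst expr0n.
  rewrite YE //.
  exact: (centered_power_var (prob_a _ _ tn) (p_gt0 _ _ tn) delta_gt0 (v_gt0 _ _ tn)
    (Em1 _ _ tn) (Em2 _ _ tn)).
(* The bound of [centered_power_fourth] made uniform in n and t through [v <= Cv] and [g < 1]. *)
pose M := 8 * (Cv `^ (4 * delta) * m4 + (Cv `^ delta * m1) ^+ 4).
have [LY4 EY4] : (forall n t, L1 (P n) (fun w => Y n t w ^+ 4)) /\
    (forall n t, \int[P n]_w Y n t w ^+ 4 <= M).
  apply: all_and2 => n; apply: all_and2 => t.
  have [tn|tn] := boolP (1 <= t <= n)%N; last first.
    rewrite Y0 //=; split; first exact: L1_cst.
    by rewrite expect_cst expr0n /M mulr_ge0 // addr_ge0 ?exprn_ge0 ?mulr_ge0 ?powR_ge0.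
  rewrite YE //.
  have [L4 E4] := centered_power_fourth (prob_a _ _ tn) (p_gt0 _ _ tn) m1 delta_gt0
    (v_gt0 _ _ tn) (Em4 _ _ tn).
  split; first exact: L4.
  apply: le_trans E4 _; rewrite ler_wpM2l //.
  have /andP[v0 vC] := v_bounds _ (grid _ _ tn).
  have /andP[g0 g1] := g_bounds' _ (grid _ _ tn).
  have vp q : 0 <= q -> v (t%:R / n%:R) `^ q <= Cv `^ q.
    move=> q0; apply: ge0_ler_powR; rewrite ?nnegrE // ?ltW //.
    exact: lt_le_trans vC.
  have gm c' : 0 <= c' -> g (t%:R / n%:R) * c' <= c'.
    by move=> c0; rewrite ler_piMl // ltW.
  apply: lerD.
    apply: ler_pM; rewrite ?powR_ge0 ?mulr_ge0 ?gm ?(ltW g0) //.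
    by apply: vp; rewrite mulr_ge0 // ltW.
  rewrite lerXn2r // ?nnegrE ?mulr_ge0 ?powR_ge0 ?(ltW g0) //.
  by apply: ler_pM; rewrite ?powR_ge0 ?mulr_ge0 ?gm ?(ltW g0) // vp // ltW.
have G0_gt0 := mean_var_gt0 delta_gt0 m2_gt0 m12 g_bounds' v_bounds g_lip v_lip.
have G1_gt0 := mean_sqr_var_gt0 delta_gt0 m2_gt0 m12 g_bounds' v_bounds g_lip v_lip.
have zeta_gt0 : 0 < zeta delta m1 m2 v g.
  rewrite /zeta (zeta_numE m1 m2 delta_gt0 g_bounds' v_bounds g_lip v_lip)
    (zeta_denE m1 m2 delta_gt0 g_bounds' v_bounds g_lip v_lip).
  by rewrite divr_gt0 // exprn_gt0.
(* Thresholds indexed by nat, as in [selfnormalized_clt]; the value 0 beyond [m] is never read. *)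
pose x' j := if insub j is Some i then x 0 i else 0.
have x'E (i : 'I_m) : x' i = x 0 i by rewrite /x' valK.
have clt := selfnormalized_clt (m := m) mY indepY (fun n w => erefl) EY EY2 LY4 EY4
  G0_gt0 G1_gt0 (cvg_mean_var delta_gt0 m2_gt0 m12 g_bounds' v_bounds g_lip v_lip)
  (cvg_mean_var_lag delta_gt0 m2_gt0 m12 g_bounds' v_bounds g_lip v_lip) (x := x').
rewrite multinormal_cdf_scalar //.
(* With G0 the integral of f and G1 that of f^2, zeta = G1 / G0^2 and G0 > 0, so x / sqrt(zeta) = x
   G0 / sqrt(G1). *)
have -> : \prod_(j < m) ncdf (x 0 j / Num.sqrt (zeta delta m1 m2 v g)) =
    \prod_(j < m) ncdf (x' j * \int[lebesgue_measure]_(s in `]0, 1])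
      var_density delta m1 m2 v g s / Num.sqrt (\int[lebesgue_measure]_(s in `]0, 1])
      (var_density delta m1 m2 v g s ^+ 2))).
  apply: eq_bigr => j _; congr ncdf; rewrite x'E /zeta.
  rewrite (zeta_numE m1 m2 delta_gt0 g_bounds' v_bounds g_lip v_lip)
    (zeta_denE m1 m2 delta_gt0 g_bounds' v_bounds g_lip v_lip).
  rewrite sqrtrM ?(ltW G1_gt0) // sqrtrV ?sqr_ge0 // sqrtr_sqr gtr0_norm //.
  by rewrite invfM invrK mulrA mulrAC.
apply: cvg_trans clt; apply: near_eq_cvg; near=> n.
have n_gt0 : (0 < n)%N by near: n; exact: nbhs_infty_gt.
congr (fine (P n _)); apply/seteqP; split => w /= h.
  by move=> j; rewrite !mxE sqrt_power_autocorrE // -x'E; exact: h.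
move=> j jm; have := h (Ordinal jm).
by rewrite !mxE sqrt_power_autocorrE // -x'E.
Unshelve. all: by end_near. Qed.
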